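(* (i) Let $F\in C^\infty(\mathbb{R}^{2n})$ and suppose there are $K>0$ and $C>0$ such that for all multi-indices $(\alpha,\beta)\in\mathbb{N}^n\times\mathbb{N}^n$, $$\|\partial_x^\alpha\partial_\xi^\beta F\|_{L^\infty(\mathbb{R}^{2n})}\le K\,C^{|\alpha+\beta|}\sqrt{\alpha!\,\beta!}.$$ If $0<\lambda<1/(2C^2)$, then $F\in D_\lambda(\mathbb{R}^{2n})$. (ii) Conversely, let $\lambda>0$. There are constants $K>0$ and $C>0$, independent of $F$ and $\alpha$, such that for all $F\in D_\lambda(\mathbb{R}^{2n})$ and all multi-indices $\alpha\in\mathbb{N}^{2n}$, $$\|\partial^\alpha F\|_{L^\infty(\mathbb{R}^{2n})}\le K\sqrt{\alpha!}\,\Big(\frac C\lambda\Big)^{|\alpha|/2}\|F\|_{D_\lambda(\mathbb{R}^{2n})}.$$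
   Context: Points of $\mathbb{R}^{2n}$ are written $X=(x,\xi)$ with $x,\xi\in\mathbb{R}^n$. For $\lambda>0$, $D_\lambda(\mathbb{R}^{2n})$ is the set of functions $F:\mathbb{R}^{2n}\to\mathbb{C}$ for which there is a real-analytic function $(X,Y)\mapsto F^{\rm ext}(X,Y)$ on $\mathbb{R}^{2n}\times\mathbb{R}^{2n}\simeq\mathbb{C}^{2n}$ (necessarily unique) such that, with $X=(x,\xi)$, $Y=(y,\eta)$: 1. $(\partial_{x_j}+i\partial_{\xi_j})F^{\rm ext}(X,Y)=0$ and $(\partial_{y_j}-i\partial_{\eta_j})F^{\rm ext}(X,Y)=0$ for $1\le j\le n$; 2. $F^{\rm ext}(X,X)=F(X)$; 3. there is $\psi_F\in L^1(\mathbb{R}^{2n})\cap L^\infty(\mathbb{R}^{2n})$ with $|F^{\rm ext}(X,Y)|\le e^{\frac1{4\lambda}|X-Y|^2}\psi_F(X-Y)$ for all $X,Y$. The norm is $\|F\|_{D_\lambda(\mathbb{R}^{2n})}=\|\psi_F\|_{L^1}+\|\psi_F\|_{L^\infty}$, where $\psi_F$ is taken to be the least admissible function, $\psi_F(V)=\sup_{X-Y=V}|F^{\rm ext}(X,Y)|e^{-|V|^2/(4\lambda)}$. *)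

(* Defs.v *)
From HB Require Import structures.
From mathcomp Require Import all_boot all_order all_algebra.
From mathcomp Require Import complex.
From mathcomp Require Import all_classical all_reals all_analysis.

Set Implicit Arguments.
Unset Strict Implicit.
Unset Printing Implicit Defensive.

Import Order.TTheory GRing.Theory Num.Theory.
Import numFieldNormedType.Exports.

Local Open Scope classical_set_scope.
Local Open Scope ring_scope.
Local Open Scope complex_scope.

(* Lebesgue measure on N.-tuple R, by recursion on N: the point mass in
   dimension 0, the image of dx \x (measure in dimension N) under
   (x, t) |-> x :: t in dimension N.+1. *)
Section lebesgue_measure_tuple.
Variable R : realType.
Local Notation mR := (measurableTypeR R).

Definition tuple_of_prod N (p : mR * N.-tuple mR) : N.+1.-tuple mR :=
  [tuple of p.1 :: p.2].

Lemma measurable_tuple_of_prod N : measurable_fun setT (@tuple_of_prod N).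
Proof. exact: measurable_cons. Qed.

Section leb_cons.
Variables (N : nat) (m : {sigma_finite_measure set (N.-tuple mR) -> \bar R}).

Definition leb_cons : set (N.+1.-tuple mR) -> \bar R :=
  pushforward (lebesgue_measure \x m)%E (@tuple_of_prod N).

HB.instance Definition _ := Measure.copy leb_cons
  (measure_function_pushforward__canonical__measure_function_Measure
    (lebesgue_measure \x m)%E (@measurable_tuple_of_prod N)).

Lemma leb_cons_sigma_finite : sigma_finite setT leb_cons.
Proof.
have /sigma_finiteP[F [TF ndF Foo]] := sigma_finiteT (@lebesgue_measure R).
have /sigma_finiteP[G [TG ndG Goo]] := sigma_finiteT m.
pose g (t : N.+1.-tuple mR) : mR * N.-tuple mR := (thead t, [tuple of behead t]).
have mg : measurable_fun setT g.
  by apply/measurable_fun_pair; [exact: measurable_tnth|exact: measurable_behead].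
have gK : cancel (@tuple_of_prod N) g.
  by move=> [x t]; congr pair; apply/val_inj.
exists (fun k => g @^-1` (F k `*` G k)).
  apply/esym/seteqP; split => // t _.
  have [k1 _ Fk1] : (\bigcup_k F k) (g t).1 by rewrite -TF.
  have [k2 _ Gk2] : (\bigcup_k G k) (g t).2 by rewrite -TG.
  exists (maxn k1 k2) => //; split.
    by move: (g t).1 Fk1; exact/subsetPset/ndF/leq_maxl.
  by move: (g t).2 Gk2; exact/subsetPset/ndG/leq_maxr.
move=> k; have [mF Fk] := Foo k; have [mG Gk] := Goo k; split.
  by rewrite -[X in measurable X]setTI; apply: mg => //; exact: measurableX.
rewrite /leb_cons /pushforward -comp_preimage.
rewrite (_ : _ \o _ = id) ?preimage_id; last by apply/funext => p /=; rewrite gK.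
by rewrite product_measure1E// lte_mul_pinfty// ge0_fin_numE.
Qed.

HB.instance Definition _ :=
  Measure_isSigmaFinite.Build _ _ _ leb_cons leb_cons_sigma_finite.
End leb_cons.

Fixpoint leb N : {sigma_finite_measure set (N.-tuple mR) -> \bar R} :=
  match N with
  | 0%N => \d_ ([tuple] : 0.-tuple mR)
  | N'.+1 => leb_cons (leb N')
  end.

(* 'rV[R]_N carries no sigma-algebra in the library, so L^p notions on R^N are
   read through the coordinate map. *)
Definition row_of_tuple N (t : N.-tuple mR) : 'rV[R]_N := \row_i tnth t i.

Definition normL N (p : \bar R) (f : 'rV[R]_N -> \bar R) : \bar R :=
  'N[leb N]_p[f \o @row_of_tuple N].

Definition inL N (p : \bar R) (f : 'rV[R]_N -> R) : Prop :=
  (f \o @row_of_tuple N) \in Lfun (leb N) p.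

End lebesgue_measure_tuple.

Section multi_indices.
Context {N : nat}.
Implicit Type a : {ffun 'I_N -> nat}.

Definition mlen a : nat := (\sum_i a i)%N.
Definition mfact a : nat := (\prod_i (a i)`!)%N.

Definition mcat {M : nat} a (b : {ffun 'I_M -> nat}) : {ffun 'I_(N + M) -> nat} :=
  [ffun k => match fintype.split k with inl i => a i | inr j => b j end].

End multi_indices.

Section calculus.
Variable R : realType.

Definition sqnorm N (V : 'rV[R]_N) : R := \sum_i V 0 i ^+ 2.

(* R[i] is not a normed module over R in the library, so the real and imaginary
   parts are differentiated separately. *)
Definition cpartial N (i : 'I_N) (F : 'rV[R]_N -> R[i]) : 'rV[R]_N -> R[i] :=
  fun X => 'D_(delta_mx 0 i) (fun Y => complex.Re (F Y)) X
        +i* 'D_(delta_mx 0 i) (fun Y => complex.Im (F Y)) X.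

Definition mpartial N (a : {ffun 'I_N -> nat}) (F : 'rV[R]_N -> R[i]) :
    'rV[R]_N -> R[i] :=
  foldr (fun i G => iter (a i) (cpartial i) G) F (enum 'I_N).

(* C^oo: every iterated partial derivative, in any order, is continuous and has
   all its first-order partial derivatives. *)
Definition csmooth N (F : 'rV[R]_N -> R[i]) : Prop :=
  forall s : seq 'I_N, let G := foldr (@cpartial N) F s in
  [/\ continuous (fun X => complex.Re (G X)),
      continuous (fun X => complex.Im (G X)) &
      forall (i : 'I_N) (X : 'rV[R]_N),
        derivable (fun Y => complex.Re (G Y)) X (delta_mx 0 i) /\
        derivable (fun Y => complex.Im (G Y)) X (delta_mx 0 i)].

Definition monomial N (a : {ffun 'I_N -> nat}) (h : 'rV[R]_N) : R :=
  \prod_i h 0 i ^+ a i.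

(* Around every point, f is the sum of an absolutely convergent power series;
   the sum is taken along the cubes {0, ..., m-1}^N. *)
Definition real_analytic N (f : 'rV[R]_N -> R) : Prop :=
  forall X : 'rV[R]_N, exists (r : R) (c : {ffun 'I_N -> nat} -> R),
    0 < r /\
    forall h : 'rV[R]_N, (forall i, `|h 0 i| < r) ->
      summable [set: {ffun 'I_N -> nat}] (fun a => (c a * monomial a h)%:E) /\
      (fun m : nat => \sum_(k : {ffun 'I_N -> 'I_m})
          let a := [ffun i => val (k i)] in c a * monomial a h)
        @ \oo --> f (X + h).

Definition creal_analytic N (F : 'rV[R]_N -> R[i]) : Prop :=
  real_analytic (fun X => complex.Re (F X)) /\
  real_analytic (fun X => complex.Im (F X)).

Definition cnormLoo N (F : 'rV[R]_N -> R[i]) : \bar R :=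
  normL +oo (fun X => (Normc.normc (F X))%:E).

End calculus.

(* X = (x, xi) is an element of 'rV_(n + n) with x on the left and xi on the
   right; the pair (X, Y) is row_mx X Y. *)
Section D_lambda.
Context {R : realType} {n : nat}.

Definition ix (j : 'I_n) : 'I_(n + n + (n + n)) := lshift (n + n) (lshift n j).
Definition ixi (j : 'I_n) : 'I_(n + n + (n + n)) := lshift (n + n) (rshift n j).
Definition iy (j : 'I_n) : 'I_(n + n + (n + n)) := rshift (n + n) (lshift n j).
Definition ieta (j : 'I_n) : 'I_(n + n + (n + n)) := rshift (n + n) (rshift n j).

Implicit Types (F : 'rV[R]_(n + n) -> R[i]) (G : 'rV[R]_(n + n + (n + n)) -> R[i]).

Definition is_Fext (lam : R) F G : Prop :=
  [/\ creal_analytic G,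
      forall (j : 'I_n) Z,
        cpartial (ix j) G Z + (0 +i* 1) * cpartial (ixi j) G Z = 0 /\
        cpartial (iy j) G Z - (0 +i* 1) * cpartial (ieta j) G Z = 0,
      forall X : 'rV[R]_(n + n), G (row_mx X X) = F X &
      exists psi : 'rV[R]_(n + n) -> R, [/\ inL 1 psi, inL +oo psi &
        forall X Y : 'rV[R]_(n + n), Normc.normc (G (row_mx X Y)) <=
          expR (sqnorm (X - Y) / (4 * lam)) * psi (X - Y)]].

Definition in_D (lam : R) F : Prop := exists G, is_Fext lam F G.

(* Such a G is unique; the default value is only reached when F is not in
   D_lambda. *)
Definition Fext (lam : R) F : 'rV[R]_(n + n + (n + n)) -> R[i] :=
  xget (fun=> 0) [set G | is_Fext lam F G].

Definition psi_min (lam : R) F (V : 'rV[R]_(n + n)) : \bar R :=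
  ereal_sup [set y | exists X Y : 'rV[R]_(n + n), X - Y = V /\
    y = (Normc.normc (Fext lam F (row_mx X Y))
         * expR (- (sqnorm V / (4 * lam))))%:E].

Definition normD (lam : R) F : \bar R :=
  (normL 1 (psi_min lam F) + normL +oo (psi_min lam F))%E.

End D_lambda.

(* Main.v *)
Require Import Defs.
From HB Require Import structures.
From mathcomp Require Import all_boot all_order all_algebra.
From mathcomp Require Import complex.
From mathcomp Require Import all_classical all_reals all_analysis.
From mathcomp Require Import measurable_realfun ess_sup_inf ring lra.

(** Identify (x, xi) with z = x + i xi and put A = (X + Y) / 2 and
    B = J (X - Y) / 2, where J (x, xi) = (xi, - x). The Cauchy-Riemann equations
    of the definition of D_lambda then say that F^ext(X, Y) = F^C(A + i B) for a
    holomorphic extension F^C of F to the complexification of R^(2n). Since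
    |B|^2 = |X - Y|^2 / 4, the growth condition bounds F^C(A + i B) by
    exp(|B|^2 / lambda) times a bounded integrable function of B. Both
    implications compare the growth of F^C in the imaginary directions with the
    size of the derivatives of F on the real space.

    From derivatives to growth: F^C is the Taylor series with terms
    i^k / k! D_B^k F(A). With derivatives of order alpha bounded by
    K C^|alpha| sqrt(alpha!), Cauchy-Schwarz bounds it by a multiple of
    exp(3/2 C^2 |B|^2) (ext_sum_growth); as 1 / lambda > 2 C^2, dividing by
    exp(|B|^2 / lambda) leaves a Gaussian (gauss_inL). The derivatives of F^C are
    themselves such series, and are locally bounded by M c^k k!, whence
    analyticity (real_analytic_line_jet, real_analytic_ext_fun); the
    Cauchy-Riemann equations hold because differentiating in B multiplies by i
    (complex_ext_CR).

    From growth to derivatives: the real and imaginary parts of F^ext are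
    harmonic in each complex line spanned by a real direction l and i times it.
    In place of Cauchy's integral formula, a gradient estimate obtained from the
    maximum principle (gradient_estimate) bounds a derivative by 2 / d times the
    supremum over a square of half side d. It is iterated a_l times in the
    direction l with steps sqrt(lambda / a_l) (worddir_bound,
    diag_derivative_bound): the growth factor is then at most e^|a|, and
    k^k <= e^k k! turns the product of the 2 / d into sqrt(a!) (C / lambda)^(|a|/2).
    The estimate needs the growth bound at every point, whereas the norm is an
    essential supremum; since sets of full measure are dense (ae_leb_dense), the
    continuity of F^ext closes this gap (psi_min_bound). That F is smooth is the
    smoothness of analytic functions (real_analytic_smooth).

    Iterated derivatives are indexed by words, the sequences of the coordinates
    in which to differentiate. Expanding a k-th directional derivative then gives
    a plain sum over the words of length k, without multinomial coefficients;
    multi-indices enter only as the types of words, the numbers of occurrences of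
    the letters. *)

Set Implicit Arguments.
Unset Strict Implicit.
Unset Printing Implicit Defensive.

Import Order.TTheory GRing.Theory Num.Theory.
Import numFieldNormedType.Exports.

Local Open Scope classical_set_scope.
Local Open Scope ring_scope.
Local Open Scope complex_scope.

(** * Derivatives along lines and iterated partial derivatives *)

Section line_derivatives.
Context {R : realType} {V : normedModType R}.
Implicit Types (f g : V -> R) (X v w : V).

Lemma is_derive_cvg f X v d :
  (fun h : R => h^-1 *: (f (h *: v + X) - f X)) @ 0^' --> d ->
  is_derive X v f d.
Proof. by move=> fd; apply: DeriveDef; [exact: cvgP fd|exact: cvg_lim fd]. Qed.

Lemma is_derive_line f X v t d : is_derive (X + t *: v) v f d ->
  is_derive t 1 (fun s : R => f (X + s *: v)) d.
Proof.
move=> [/cvg_ex[l fl] <-]; have -> : 'D_v f (X + t *: v) = l.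
  exact: cvg_lim fl.
apply: DeriveDef; [apply: (cvgP l)|apply: cvg_lim => //]; move: fl;
  apply: cvg_trans; apply: near_eq_cvg; near=> h => /=;
  by rewrite [h *: 1]mulr1 scalerDl [in RHS]addrCA.
Unshelve. all: by end_near. Qed.

Lemma is_derive_line0 f X v d : is_derive (0 : R) 1 (fun s : R => f (X + s *: v)) d ->
  is_derive X v f d.
Proof.
move=> [/cvg_ex[l fl] <-]; apply: is_derive_cvg.
have -> : 'D_1 (fun s : R => f (X + s *: v)) (0 : R) = l by exact: cvg_lim fl.
move: fl; apply: cvg_trans; apply: near_eq_cvg; near=> h => /=.
by rewrite [h *: 1]mulr1 addr0 scale0r addr0 [X + _]addrC.
Unshelve. all: by end_near. Qed.

Lemma mvt_centered (phi dphi : R -> R) (t : R) :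
  (forall s : R, is_derive s 1 phi (dphi s)) ->
  exists c : R, `|c| <= `|t| /\ phi t - phi 0 = t * dphi c.
Proof.
move=> dp.
have cphi (a b : R) : {within `[a, b], continuous phi}.
  by apply: derivable_within_continuous => x _; case: (dp x).
have [t0|/ltW t0] := leP 0 t.
- have [c c0t e] := MVT_segment t0 (fun x _ => dp x) (cphi 0 t).
  exists c; split; last by rewrite e subr0 mulrC.
  by move: c0t; rewrite in_itv/= => /andP[c0 ct]; rewrite !ger0_norm.
- have [c c0t e] := MVT_segment t0 (fun x _ => dp x) (cphi t 0).
  exists c; split; last by rewrite -opprB e sub0r mulrN opprK mulrC.
  by move: c0t; rewrite in_itv/= => /andP[tc c0]; rewrite !ler0_norm// lerN2.
Qed.

Lemma line_mvt f g X v (t : R) : (forall Y, is_derive Y v f (g Y)) ->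
  exists c : R, `|c| <= `|t| /\ f (X + t *: v) - f X = t * g (X + c *: v).
Proof.
move=> fg; have [|c [ct E]] := @mvt_centered (fun s => f (X + s *: v))
  (fun s => g (X + s *: v)) t; first by move=> s; exact: is_derive_line.
by exists c; split => //; rewrite -E scale0r addr0.
Qed.

(** A quadratic remainder is the form in which derivatives pass to limits of
    series below: it survives limits of f and d with K and r fixed. *)
Lemma is_derive_quad f X v (d K r : R) : 0 < r ->
  (forall t : R, `|t| < r -> `|f (X + t *: v) - f X - t * d| <= K * t ^+ 2) ->
  is_derive X v f d.
Proof.
move=> r0 fK; apply: is_derive_cvg; apply/cvgrPdist_le => e e0; near=> h.
have h0 : h != 0 by near: h; exact: nbhs_dnbhs_neq.
have hr : `|h| < r.
  by near: h; apply: dnbhs0_lt.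
have hK : `|h| * (`|K| + 1) <= e.
  rewrite -ler_pdivlMr//.
  by near: h; apply: dnbhs0_le; rewrite divr_gt0// ltr_wpDl.
rewrite distrC (_ : _ - d = h^-1 * (f (X + h *: v) - f X - h * d)); last first.
  by rewrite [X + _]addrC mulrBr mulrA mulVf// mul1r.
rewrite normrM (le_trans (ler_wpM2l _ (fK _ hr)))// normfV.
rewrite ler_pdivrMl ?normr_gt0// (le_trans (ler_norm _))// normrM normrX.
rewrite expr2 mulrCA ler_wpM2l// mulrC (le_trans _ hK)// ler_wpM2l//.
by rewrite lerDl.
Unshelve. all: by end_near. Qed.

Lemma is_derive_dirZ f X v d (c : R) :
  is_derive X v f d -> is_derive X (c *: v) f (c * d).
Proof.
move=> fd; apply: is_derive_line0.
have h : is_derive (0 : R) 1 (fun s : R => s * c) c.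
  by apply: is_derive_eq; rewrite scaler0 add0r scaler1.
have : is_derive (0 : R) 1 ((fun s : R => f (X + s *: v)) \o (fun s => s * c)) (d * c).
  apply: is_derive1_comp; rewrite mul0r.
  by apply: is_derive_line; rewrite scale0r addr0.
rewrite mulrC; congr is_derive; apply/funext => s /=.
by rewrite scalerA.
Qed.

End line_derivatives.

Section row_derivatives.
Context {R : realType} {N : nat}.
Implicit Types (f g : 'rV[R]_N -> R) (X v w : 'rV[R]_N).

Lemma continuous_dist f X e : {for X, continuous f} -> 0 < e ->
  exists2 r, 0 < r & forall Y, `|Y| < r -> `|f (X + Y) - f X| < e.
Proof.
move=> fX e0; have /cvgrPdist_lt /(_ _ e0) := fX.
move/nbhs_ballP => [r r0 H]; exists r => // Y Yr.
rewrite distrC; apply: H; rewrite mx_norm_ball /ball_ /=.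
by rewrite opprD addNKr normrN.
Qed.

Lemma dist_continuous f X :
  (forall e, 0 < e -> exists2 r, 0 < r & forall Y, `|Y| < r -> `|f (X + Y) - f X| <= e) ->
  {for X, continuous f}.
Proof.
move=> H; apply/(@cvgrPdist_le _ _ _ (nbhs X)) => e /H[r r0 {}H].
apply/nbhs_ballP; exists r => // Y; rewrite mx_norm_ball /ball_ /= => XY.
by rewrite distrC -(subrKC X Y) H// distrC.
Qed.

Lemma coord_le_norm (h : 'rV[R]_N) i : `|h 0 i| <= `|h|.
Proof.
rewrite [leRHS]mx_normrE.
exact: (le_bigmax _ (fun ij => `|h ij.1 ij.2|) (0, i)).
Qed.

(** Moving along h v first and along h w next, the second increment is h times a
    value of gw near X by the mean value theorem; continuity of gw suffices for
    it to converge. *)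
Lemma is_derive_dirD f v w gv gw :
  (forall X, is_derive X v f (gv X)) -> (forall X, is_derive X w f (gw X)) ->
  continuous gw ->
  forall X, is_derive X (v + w) f (gv X + gw X).
Proof.
move=> fv fw cw X; apply: is_derive_cvg.
have fvX : (fun h : R => h^-1 *: (f (h *: v + X) - f X)) @ 0^' --> gv X.
  by have [/cvg_ex[l fl] <-] := fv X; rewrite /derive (cvg_lim _ fl).
apply/cvgrPdist_lt => e e0; have e20 : 0 < e / 2 by rewrite divr_gt0.
have /cvgrPdist_lt /(_ _ e20) fv' := fvX.
have [r r0 Hr] := continuous_dist (cw X) e20.
near=> h.
have h0 : h != 0 by near: h; exact: nbhs_dnbhs_neq.
have hr : `|h| * (`|v| + `|w| + 1) < r.
  rewrite -ltr_pdivlMr; last by rewrite ltr_wpDl// addr_ge0.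
  by near: h; apply: dnbhs0_lt; rewrite divr_gt0// ltr_wpDl// addr_ge0.
have fvh : `|gv X - h^-1 *: (f (h *: v + X) - f X)| < e / 2 by near: h.
have [c [ch E]] := line_mvt (X + h *: v) h fw.
rewrite [X in _ - X](_ : _ =
  h^-1 *: (f (h *: v + X) - f X) + gw (X + (h *: v + c *: w))); last first.
  have -> : f (h *: (v + w) + X) = f (X + h *: v) + h * gw (X + h *: v + c *: w).
    by rewrite -E [RHS]addrC subrK scalerDr [in LHS]addrC addrA.
  rewrite (addrC (h *: v) X) (addrA X) /GRing.scale/=.
  by field.
rewrite opprD addrACA (le_lt_trans (ler_normD _ _))// [e]splitr ltrD//.
rewrite distrC Hr// (le_lt_trans _ hr)// (le_trans (ler_normD _ _))// !normrZ.
by rewrite !mulrDr ler_wpDr// ?mulr1// lerD2l ler_wpM2r.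
Unshelve. all: by end_near. Qed.

End row_derivatives.

Section iterated_partials.
Context {R : realType} {N : nat}.
Implicit Types (f g : 'rV[R]_N -> R) (X v w : 'rV[R]_N) (s : seq 'I_N).

(** Schwarz's theorem: the second difference of f over the parallelogram with
    sides t v and t w is t^2 times a value of either mixed derivative close to
    X, so that the two cannot differ at X. *)
Lemma ddir_comm f gv gw gvw gwv v w :
  (forall X, is_derive X v f (gv X)) -> (forall X, is_derive X w f (gw X)) ->
  (forall X, is_derive X w gv (gvw X)) -> (forall X, is_derive X v gw (gwv X)) ->
  continuous gvw -> continuous gwv -> gvw = gwv.
Proof.
move=> fv fw gvd gwd cvw cwv; apply/funext => X; apply/eqP/negPn/negP => ne.
pose e : R := `|gvw X - gwv X| / 2.
have e0 : 0 < e by rewrite divr_gt0// normr_gt0 subr_eq0.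
have [r1 r10 H1] := continuous_dist (cvw X) e0.
have [r2 r20 H2] := continuous_dist (cwv X) e0.
pose t : R := Num.min r1 r2 / (`|v| + `|w| + 1).
have s0 : 0 < `|v| + `|w| + 1 by rewrite ltr_wpDl// addr_ge0.
have t0 : 0 < t by rewrite divr_gt0// lt_min r10 r20.
have small c1 c2 : `|c1| <= `|t| -> `|c2| <= `|t| ->
    `|c1 *: v + c2 *: w| < Num.min r1 r2.
  move=> c1t c2t; have -> : Num.min r1 r2 = t * (`|v| + `|w| + 1).
    by rewrite /t divfK// gt_eqF.
  rewrite (le_lt_trans (ler_normD _ _))// !normrZ.
  rewrite (@le_lt_trans _ _ (t * (`|v| + `|w|)))//; last by rewrite ltr_pM2l// ltrDl.
  by rewrite mulrDr lerD// ler_wpM2r// -(gtr0_norm t0).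
pose D := f (X + t *: v + t *: w) - f (X + t *: v) - (f (X + t *: w) - f X).
have [P [Ps DP]] : exists P, `|P| < Num.min r1 r2 /\ D = t ^+ 2 * gvw (X + P).
  have dh Y : is_derive Y v (fun Y => f (Y + t *: w) - f Y) (gv (Y + t *: w) - gv Y).
    apply: is_deriveB => //; apply: is_derive_line0.
    have := @is_derive_line _ _ f (Y + t *: w) v 0 (gv (Y + t *: w)).
    rewrite scale0r addr0 => /(_ (fv _)); congr is_derive.
    by apply/funext => x; rewrite addrAC.
  have [c1 [c1t E1]] := line_mvt X t dh.
  have [c2 [c2t E2]] := line_mvt (X + c1 *: v) t gvd.
  exists (c1 *: v + c2 *: w); split; first exact: small.
  rewrite addrA expr2 -mulrA -E2 -E1 /D /=; ring.
have [Q [Qs DQ]] : exists P, `|P| < Num.min r1 r2 /\ D = t ^+ 2 * gwv (X + P).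
  have dh Y : is_derive Y w (fun Y => f (Y + t *: v) - f Y) (gw (Y + t *: v) - gw Y).
    apply: is_deriveB => //; apply: is_derive_line0.
    have := @is_derive_line _ _ f (Y + t *: v) w 0 (gw (Y + t *: v)).
    rewrite scale0r addr0 => /(_ (fw _)); congr is_derive.
    by apply/funext => x; rewrite addrAC.
  have [c1 [c1t E1]] := line_mvt X t dh.
  have [c2 [c2t E2]] := line_mvt (X + c1 *: w) t gwd.
  exists (c2 *: v + c1 *: w); split; first exact: small.
  rewrite (addrC (c2 *: v)) addrA expr2 -mulrA -E2 -E1 /D /= (addrAC X (t *: w)); ring.
have : gvw (X + P) = gwv (X + Q).
  by apply: (mulfI (_ : t ^+ 2 != 0)); rewrite ?expf_neq0 ?gt_eqF// -DP -DQ.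
move: Ps Qs; rewrite !lt_min => /andP[/H1 P1 _] /andP[_ /H2 Q2] PQ.
have : `|gvw X - gwv X| < e + e.
  rewrite -(subrK (gvw (X + P)) (gvw X)) {2}PQ -addrA.
  by rewrite (le_lt_trans (ler_normD _ _))// ltrD// distrC.
by rewrite /e -splitr ltxx.
Qed.

Definition rpartial (i : 'I_N) f : 'rV[R]_N -> R := fun X => 'D_(delta_mx 0 i) f X.

Definition rjet f s : 'rV[R]_N -> R := foldr rpartial f s.

Definition rsmooth f : Prop := forall s,
  continuous (rjet f s) /\ forall i X, derivable (rjet f s) X (delta_mx 0 i).

(** What characterises the family of all iterated partial derivatives of a
    function, indexed by the words of differentiations: the derivative of each
    member in any direction is given by the members with one more letter. *)
Definition line_jet (U : seq 'I_N -> 'rV[R]_N -> R) : Prop :=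
  forall s X h, is_derive X h (U s) (\sum_l h 0 l * U (l :: s) X).

(** The coordinates of h are added one at a time, the continuity of the partial
    derivatives being what makes directional derivatives additive. *)
Lemma rsmooth_line_jet f : rsmooth f -> line_jet (rjet f).
Proof.
move=> fs s X h.
have ds i Y : is_derive Y (delta_mx 0 i) (rjet f s) (rjet f (i :: s) Y).
  by apply: derivableP; case: (fs s).
rewrite [h in is_derive _ h]row_sum_delta.
elim: (index_enum _) X => [|i r IH] X; first by rewrite !big_nil; exact: is_derive0.
rewrite !big_cons (addrC (h 0 i *: _)) (addrC (h 0 i * _)).
apply: (is_derive_dirD (gv := fun Y => \sum_(l <- r) h 0 l * rjet f (l :: s) Y)
  (gw := fun Y => h 0 i * rjet f (i :: s) Y)).
- by move=> Y; apply: is_derive_dirZ; exact: ds.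
- have [cf _] := fs (i :: s).
  by move=> Y; exact: (@cvgMl_tmp R _ (nbhs Y) _ (rjet f (i :: s)) _ _ (cf Y)).
Qed.

Lemma line_jet_partial U : line_jet U ->
  forall s i X, is_derive X (delta_mx 0 i) (U s) (U (i :: s) X).
Proof.
move=> JU s i X; have := JU s X (delta_mx 0 i); congr is_derive.
rewrite (bigD1 i)//= big1 ?addr0 ?mxE ?eqxx ?mul1r// => j ji.
by rewrite mxE (negbTE ji) andbF mul0r.
Qed.

Lemma line_jet_rjet U : line_jet U -> rjet (U [::]) = U.
Proof.
move=> JU; apply/funext; elim=> [//|i s IH] /=.
by rewrite IH; apply/funext => X; rewrite /rpartial; have [] := line_jet_partial JU s i X.
Qed.

Lemma line_jet_smooth U : line_jet U -> (forall s, continuous (U s)) ->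
  rsmooth (U [::]).
Proof.
move=> JU cU s; rewrite line_jet_rjet//; split => // i X.
by have [] := line_jet_partial JU s i X.
Qed.

(** Adjacent letters commute by Schwarz's theorem, so any letter can be brought
    to the front of a word. *)
Lemma rjet_perm f s s' : rsmooth f -> perm_eq s s' -> rjet f s = rjet f s'.
Proof.
move=> fs; have swap i j t : rjet f [:: i, j & t] = rjet f [:: j, i & t].
  have d k u Y : is_derive Y (delta_mx 0 k) (rjet f u) (rjet f (k :: u) Y).
    by apply: derivableP; case: (fs u).
  exact: (ddir_comm (d j t) (d i t) (d i (j :: t)) (d j (i :: t))
    (fs [:: i, j & t]).1 (fs [:: j, i & t]).1).
have front i a b : rjet f (a ++ i :: b) = rjet f (i :: a ++ b).
  elim: a => [//|j a IH].
  transitivity (rpartial j (rjet f (a ++ i :: b))); first by [].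
  by rewrite IH; exact: (swap j i (a ++ b)).
elim: s s' => [|i s IH] s'; first by rewrite perm_sym => /perm_nilP ->.
move=> p; have /splitPr is' : i \in s' by rewrite -(perm_mem p) mem_head.
case: is' p => a b p; rewrite front.
transitivity (rpartial i (rjet f s)); first by [].
rewrite (IH (a ++ b))//.
by rewrite -(perm_cons i) (perm_trans p)// perm_catC /= perm_cons perm_catC.
Qed.

End iterated_partials.

(** * Taylor expansion in words and a criterion of analyticity *)

Section taylor.
Context {R : realType}.
Implicit Types (phi : nat -> R -> R).

(** The Taylor polynomial at the point 1, as a function of its centre t, has a
    telescoping derivative phi_(m+1)(t) (1 - t)^m / m!; the mean value theorem
    on [0, 1] gives Cauchy's form of the remainder. *)
Lemma cauchy_remainder phi (M : R) m :
  (forall k (t : R), is_derive t 1 (phi k) (phi k.+1 t)) ->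
  (forall t : R, 0 <= t <= 1 -> `|phi m.+1 t| <= M) ->
  `|phi 0%N 1 - \sum_(k < m.+1) phi k 0 / k`!%:R| <= M / m`!%:R.
Proof.
move=> dphi phiM.
pose T n (t : R) := \sum_(k < n.+1) phi k t * ((1 - t) ^+ k / k`!%:R).
have dT n (t : R) : is_derive t 1 (T n) (phi n.+1 t * ((1 - t) ^+ n / n`!%:R)).
  elim: n => [|n IH].
    have -> : T 0%N = phi 0%N.
      by apply/funext => s; rewrite /T big_ord1 expr0 fact0 divr1 mulr1.
    by rewrite expr0 fact0 divr1 mulr1; exact: dphi.
  have -> : T n.+1 = T n + (phi n.+1 * (fun s => (1 - s) ^+ n.+1 / n.+1`!%:R)).
    by apply/funext => s; rewrite /T big_ord_recr.
  have dq : is_derive t 1 (fun s : R => (1 - s) ^+ n.+1 / n.+1`!%:R)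
      (- ((1 - t) ^+ n / n`!%:R)).
    have -> : (fun s : R => (1 - s) ^+ n.+1 / n.+1`!%:R) =
        n.+1`!%:R^-1 *: ((cst 1 - id : R -> R) ^+ n.+1).
      by apply/funext => s; rewrite !fctE /GRing.scale/= mulrC.
    apply: is_derive_eq; rewrite /= !fctE factS natrM sub0r.
    rewrite /GRing.scale/= -mulr_natl.
    have n0 : n`!%:R != 0 :> R by rewrite pnatr_eq0 -lt0n fact_gt0.
    have n1 : n.+1%:R != 0 :> R by rewrite pnatr_eq0.
    by field; rewrite n0 addrC natr1 n1.
  apply: is_derive_eq; rewrite /GRing.scale/=; ring.
have T1 : T m 1 = phi 0%N 1.
  rewrite /T big_ord_recl subrr expr0 fact0 divr1 mulr1 big1 ?addr0// => i _.
  by rewrite expr0n /= mul0r mulr0.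
have T0 : T m 0 = \sum_(k < m.+1) phi k 0 / k`!%:R.
  by apply: eq_bigr => i _; rewrite subr0 expr1n mul1r.
have cT : {within `[0, 1 : R], continuous (T m)}.
  by apply: derivable_within_continuous => x _; case: (dT m x).
have [c /[!in_itv]/= /andP[c0 c1] E] := MVT_segment ler01 (fun x _ => dT m x) cT.
rewrite -T1 -T0 E subr0 mulr1 normrM normrM normfV normr_nat mulrA.
rewrite ler_pM2r ?invr_gt0 ?ltr0n ?fact_gt0//.
rewrite -[leRHS]mulr1 ler_pM ?phiM ?c0// ger0_norm.
  by rewrite exprn_ile1 ?subr_ge0 ?gerBl.
by rewrite exprn_ge0 ?subr_ge0.
Qed.

End taylor.

Section words.
Context {N : nat}.

Definition words k : seq (seq 'I_N) :=
  iter k (fun ws => [seq l :: w | l <- index_enum 'I_N, w <- ws]) [:: [::]].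

Lemma size_in_words k s : s \in words k -> size s = k.
Proof.
elim: k s => [|k IH] s; first by rewrite inE => /eqP ->.
by case/allpairsP => -[l w] /= [_ /IH <- ->].
Qed.

Lemma size_words k : size (words k) = (N ^ k)%N.
Proof.
by elim: k => //= k IH; rewrite size_allpairs IH expnS /index_enum -enumT size_enum_ord.
Qed.

Lemma big_words0 (V : zmodType) (F : seq 'I_N -> V) :
  \sum_(s <- words 0) F s = F [::].
Proof. by rewrite big_seq1. Qed.

Lemma big_wordsS (V : zmodType) k (F : seq 'I_N -> V) :
  \sum_(s <- words k.+1) F s = \sum_l \sum_(s <- words k) F (l :: s).
Proof. by rewrite /= big_allpairs_dep. Qed.

Definition wtype (s : seq 'I_N) : {ffun 'I_N -> nat} := [ffun i => count_mem i s].

Lemma mlen_wtype s : mlen (wtype s) = size s.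
Proof.
rewrite /mlen; under eq_bigr do rewrite ffunE.
elim: s => [|l s IH] /=; first by rewrite big1.
rewrite big_split/= IH (bigD1 l)//= eqxx big1 ?addn0// => i il.
by rewrite eq_sym (negbTE il).
Qed.

Definition cube m : seq {ffun 'I_N -> nat} :=
  [seq [ffun i => val (k i)] | k : {ffun 'I_N -> 'I_m} <- index_enum _].

Lemma cube_uniq m : uniq (cube m).
Proof.
rewrite map_inj_uniq ?index_enum_uniq// => k k' /ffunP e; apply/ffunP => i.
by apply: val_inj; have := e i; rewrite !ffunE.
Qed.

Lemma mem_cube m a : (a \in cube m) = [forall i, (a i < m)%N].
Proof.
apply/mapP/forallP => [[k _ ->] i|am]; first by rewrite ffunE ltn_ord.
exists [ffun i => Ordinal (am i)]; first by rewrite mem_index_enum.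
by apply/ffunP => i; rewrite !ffunE.
Qed.

Lemma cubeS m m' : (m <= m')%N -> {subset cube m <= cube m'}.
Proof.
move=> mm' a; rewrite !mem_cube => /forallP am; apply/forallP => i.
exact: leq_trans (am i) mm'.
Qed.

Lemma mlen_cube m a : a \in cube m -> (mlen a <= N * m)%N.
Proof.
rewrite mem_cube => /forallP am; rewrite /mlen -[X in (X * _)%N]card_ord -sum_nat_const.
by apply: leq_sum => i _; exact: ltnW.
Qed.

Lemma cube_mlen a : a \in cube (mlen a).+1.
Proof. by rewrite mem_cube; apply/forallP => i; rewrite ltnS /mlen (bigD1 i)//= leq_addr. Qed.

Lemma notin_cube m a : a \notin cube m -> (m <= mlen a)%N.
Proof. by rewrite leqNgt; apply: contra => /cubeS; apply; exact: cube_mlen. Qed.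

(** Every word has one type, so a sum over multi-indices of sums over the words
    of that type is a sum over words; those with type in the cube of side m have
    length at most N m. *)
Lemma big_cube_words (V : zmodType) m L (t : seq 'I_N -> V) : (N * m < L)%N ->
  \sum_(a <- cube m) \sum_(s <- words (mlen a) | wtype s == a) t s =
  \sum_(k < L) \sum_(s <- words k | wtype s \in cube m) t s.
Proof.
move=> mL.
transitivity (\sum_(a <- cube m) \sum_(k < L) \sum_(s <- words k | wtype s == a) t s).
  rewrite big_seq [RHS]big_seq; apply: eq_bigr => a /mlen_cube aL.
  rewrite (bigD1 (Ordinal (leq_ltn_trans aL mL)))//= [X in _ + X]big1 ?addr0// => k ka.
  rewrite big_seq_cond big1// => s /andP[/size_in_words sk /eqP sa].
  by move: ka; rewrite -val_eqE /= -sa mlen_wtype sk eqxx.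
rewrite exchange_big/=; apply: eq_bigr => k _.
under eq_bigr do rewrite big_mkcond.
rewrite exchange_big [RHS]big_mkcond/=; apply: eq_bigr => s _.
case: ifP => [sm|/negbT sm].
  rewrite (bigD1_seq (wtype s)) ?cube_uniq//= eqxx big1 ?addr0// => a.
  by rewrite eq_sym => /negbTE ->.
rewrite big_seq big1// => a am; case: eqP => // e.
by move: sm; rewrite e am.
Qed.

End words.
Arguments cube : clear implicits.

Section cube_sums.
Context {R : realType} {N : nat}.
Implicit Types (u : {ffun 'I_N -> nat} -> R) (h : 'rV[R]_N).

Lemma big_cube m u :
  \sum_(k : {ffun 'I_N -> 'I_m}) (let a := [ffun i => val (k i)] in u a) =
  \sum_(a <- cube N m) u a.
Proof. by rewrite big_map. Qed.

Lemma big_sub_uniq (T : eqType) (V : nmodType) (A B : seq T) (v : T -> V) :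
  uniq A -> uniq B -> {subset A <= B} ->
  \sum_(a <- A) v a = \sum_(a <- B | a \in A) v a.
Proof.
move=> uA uB AB; rewrite -[RHS]big_filter; apply/perm_big/uniq_perm => //.
  by rewrite filter_uniq.
by move=> a; rewrite mem_filter andb_idr// => /AB.
Qed.

Lemma ler_sum_sub (T : eqType) (A B : seq T) (v : T -> R) :
  uniq A -> uniq B -> {subset A <= B} -> (forall a, 0 <= v a) ->
  \sum_(a <- A) v a <= \sum_(a <- B) v a.
Proof.
move=> uA uB AB v0; rewrite (big_sub_uniq v uA uB AB).
by rewrite [leRHS](bigID (fun a => a \in A))/= lerDl sumr_ge0.
Qed.

Lemma ler_cube m m' u : (forall a, 0 <= u a) -> (m <= m')%N ->
  \sum_(a <- cube N m) u a <= \sum_(a <- cube N m') u a.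
Proof.
by move=> u0 mm'; apply: ler_sum_sub; [exact: cube_uniq..|exact: cubeS|].
Qed.

Lemma summable_cube u (M : R) : (forall m, \sum_(a <- cube N m) `|u a| <= M) ->
  summable [set: {ffun 'I_N -> nat}] (fun a => (u a)%:E).
Proof.
move=> uM; rewrite /summable (@le_lt_trans _ _ M%:E) ?ltry//.
apply: ge_ereal_sup => _ [A [fA _] <-].
have -> : (\sum_(x \in A) `|(u x)%:E| = (\sum_(x \in A) `|u x|)%:E)%E.
  by rewrite -fsumEFin.
rewrite lee_fin fsbig_finite//=.
set B := (X in \sum_(a <- X) _).
have Bu : uniq B by exact: finmap.fset_uniq.
pose m := (\max_(a <- B) (mlen a).+1)%N.
apply: le_trans (uM m).
have sub : {subset B <= cube N m}.
  move=> a aA; apply: (cubeS _ (cube_mlen a)).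
  by rewrite /m (big_rem a)//= leq_maxl.
by apply: ler_sum_sub => //; exact: cube_uniq.
Qed.

Lemma cube_summable u : summable [set: {ffun 'I_N -> nat}] (fun a => (u a)%:E) ->
  exists M : R, forall m, \sum_(a <- cube N m) `|u a| <= M.
Proof.
rewrite summableE => us; exists (fine (\esum_(x in [set: {ffun 'I_N -> nat}]) `|(u x)%:E|%E)).
move=> m; rewrite -lee_fin fineK//.
have := @ereal_sup_ubound R; rewrite /esum => ub.
apply: ub; exists [set` cube N m] => //=.
  by split => //; exact: finite_seq.
by rewrite -fsbig_seq ?cube_uniq// -sumEFin.
Qed.

End cube_sums.

Section analytic_criterion.
Context {R : realType} {N : nat}.
Implicit Types (h X Y : 'rV[R]_N) (s : seq 'I_N).

Definition wprod h s : R := \prod_(l <- s) h 0 l.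

Lemma wprod_monomial h s : wprod h s = monomial (wtype s) h.
Proof.
rewrite /wprod /monomial; under [RHS]eq_bigr do rewrite ffunE.
elim: s => [|l s IH] /=; first by rewrite big_nil big1.
rewrite big_cons IH; under [RHS]eq_bigr do rewrite exprD.
rewrite big_split/=; congr *%R.
by rewrite (bigD1 l)//= eqxx expr1 big1 ?mulr1// => i il; rewrite eq_sym (negbTE il).
Qed.

Lemma wprod_le h s (r : R) : (forall i, `|h 0 i| <= r) -> `|wprod h s| <= r ^+ size s.
Proof.
move=> hr; elim: s => [|l s IH] /=; first by rewrite /wprod big_nil normr1 expr0.
by rewrite /wprod big_cons normrM exprS ler_pM.
Qed.

Lemma big_words_le k (F : seq 'I_N -> R) (P : pred (seq 'I_N)) (M : R) : 0 <= M ->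
  (forall s, size s = k -> `|F s| <= M) ->
  \sum_(s <- words k | P s) `|F s| <= N%:R ^+ k * M.
Proof.
move=> M0 FM; apply: (@le_trans _ _ (\sum_(s <- @words N k) M)); last first.
  by rewrite big_const_seq count_predT size_words iter_addr_0 -natrX mulr_natl.
rewrite big_mkcond big_seq [leRHS]big_seq ler_sum// => s /size_in_words sk.
by case: ifP => // _; exact: FM.
Qed.

(** The k-th derivative of t |-> W [::] (X + t h) is the sum over all words of
    length k of the corresponding derivative times a product of coordinates of
    h: Taylor's formula without multinomial coefficients. *)
Lemma word_taylor (W : seq 'I_N -> 'rV[R]_N -> R) X h m (M r : R) : line_jet W ->
  (forall i, `|h 0 i| <= r) -> 0 <= r -> 0 <= M ->
  (forall s (t : R), size s = m.+1 -> 0 <= t <= 1 -> `|W s (X + t *: h)| <= M) ->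
  `|W [::] (X + h) - \sum_(k < m.+1) \sum_(s <- words k) W s X * wprod h s / (size s)`!%:R|
    <= (N%:R * r) ^+ m.+1 * M / m`!%:R.
Proof.
move=> JW hr r0 M0 WM.
pose phi k (t : R) := \sum_(s <- words k) W s (X + t *: h) * wprod h s.
have dphi k (t : R) : is_derive t 1 (phi k) (phi k.+1 t).
  have -> : phi k = \sum_(i < size (@words N k))
      (wprod h (nth [::] (words k) i) *: (fun t : R => W (nth [::] (words k) i) (X + t *: h))).
    apply/funext => u; rewrite fct_sumE /phi (big_nth [::]) big_mkord.
    by apply: eq_bigr => i _; rewrite mulrC.
  have dW s : is_derive t 1 (fun t : R => W s (X + t *: h))
      (\sum_l h 0 l * W (l :: s) (X + t *: h)) by exact: is_derive_line.
  apply: is_derive_eq; rewrite /phi big_wordsS exchange_big/= [RHS](big_nth [::]) big_mkord.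
  apply: eq_bigr => i _; rewrite /GRing.scale/= mulr_sumr; apply: eq_bigr => l _.
  by rewrite /wprod big_cons; ring.
have -> : W [::] (X + h) = phi 0%N 1.
  by rewrite /phi big_words0 scale1r /wprod big_nil mulr1.
have -> : \sum_(k < m.+1) \sum_(s <- words k) W s X * wprod h s / (size s)`!%:R =
    \sum_(k < m.+1) phi k 0 / k`!%:R.
  apply: eq_bigr => k _; rewrite /phi scale0r addr0 mulr_suml big_seq [RHS]big_seq.
  by apply: eq_bigr => s /size_in_words ->.
apply: cauchy_remainder => // t t01.
rewrite /phi (le_trans (ler_norm_sum _ _ _))// exprMn -mulrA.
apply: big_words_le => [|s sm]; first by rewrite mulr_ge0// exprn_ge0.
by rewrite normrM mulrC ler_pM// ?WM// -sm wprod_le.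
Qed.

Lemma half_tail m L : (m <= L)%N ->
  \sum_(m <= k < L) (2^-1 : R) ^+ k <= 2 * 2^-1 ^+ m.
Proof.
move=> mL; suff -> : \sum_(m <= k < L) (2^-1 : R) ^+ k = 2 * 2^-1 ^+ m - 2 * 2^-1 ^+ L.
  by rewrite gerBl mulr_ge0// exprn_ge0// invr_ge0.
elim: L mL => [|L IH]; first by rewrite leqn0 => /eqP ->; rewrite big_geq// subrr.
rewrite leq_eqVlt => /predU1P[<-|mL]; first by rewrite big_geq// subrr.
by rewrite big_nat_recr//= IH// exprS; field.
Qed.

Lemma cvg_half_bound (u : nat -> R) (l K : R) :
  (forall m, `|l - u m| <= K * 2^-1 ^+ m) -> u @ \oo --> l.
Proof.
move=> uK; have K0 : (fun m => K * 2^-1 ^+ m) @ \oo --> (0 : R).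
  rewrite -(mulr0 K); apply: cvgMl_tmp; apply: cvg_expr.
  by rewrite ger0_norm ?invr_ge0// invf_lt1// ltr1n.
apply/cvgrPdist_le => e e0; move/cvgrPdist_le: K0 => /(_ _ e0).
apply: filterS => m; rewrite sub0r normrN => Ke.
exact: le_trans (uK m) (le_trans (ler_norm _) Ke).
Qed.

(** The expansion in words converges geometrically where |h_i| < r, since
    there are N^k words of length k. The coefficient at a multi-index a collects
    the coefficients of all words of type a. A cube contains the types of all
    words shorter than its side, so its sum differs from a Taylor polynomial by
    a tail of the geometric series. *)
Lemma real_analytic_line_jet (W : seq 'I_N -> 'rV[R]_N -> R) :
  line_jet W ->
  (forall X, exists M c : R, 0 <= M /\ 0 < c /\ forall s Y, (forall i, `|Y 0 i - X 0 i| < 1) ->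
     `|W s Y| <= M * c ^+ size s * (size s)`!%:R) ->
  real_analytic (W [::]).
Proof.
move=> JW WM X; have [M [c [M0 [c0 {}WM]]]] := WM X.
(* The 4 leaves one factor 2^-(m+1) to absorb the m+1 of Cauchy's remainder. *)
pose r : R := Num.min 1 (4 * N.+1%:R * c)^-1.
have r0 : 0 < r by rewrite lt_min ltr01 invr_gt0 !mulr_gt0.
have r1 : r <= 1 by rewrite ge_min lexx.
have Ncr : N%:R * r * c <= 4^-1.
  apply: (@le_trans _ _ (N.+1%:R * (4 * N.+1%:R * c)^-1 * c)).
    by rewrite ler_wpM2r ?(ltW c0)// ler_pM// ?ler_nat// ?(ltW r0)// ge_min lexx orbT.
  have n0 : N.+1%:R != 0 :> R by [].
  rewrite le_eqVlt; apply/orP; left; apply/eqP.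
  by field; rewrite (gt_eqF c0) addrC natr1 n0.
have half4 k : (4^-1 : R) ^+ k <= 2^-1 ^+ k.
  by apply: lerXn2r; rewrite ?nnegrE ?invr_ge0// lef_pV2 ?posrE// ler_nat.
pose t h s := W s X * wprod h s / (size s)`!%:R.
pose cc a := \sum_(s <- words (mlen a) | wtype s == a) W s X / (mlen a)`!%:R.
exists r, cc; split => // h hr.
have ccE a : cc a * monomial a h = \sum_(s <- words (mlen a) | wtype s == a) t h s.
  rewrite /cc mulr_suml big_seq_cond [RHS]big_seq_cond.
  apply: eq_bigr => s /andP[/size_in_words sa /eqP <-].
  by rewrite /t wprod_monomial mlen_wtype mulrAC.
have hr' i : `|h 0 i| <= r by exact/ltW.
have tk k (P : pred _) : \sum_(s <- words k | P s) `|t h s| <= M * 2^-1 ^+ k.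
  apply: (@le_trans _ _ (N%:R ^+ k * (M * (c * r) ^+ k))).
    apply: big_words_le => [|s sk]; first by rewrite mulr_ge0// exprn_ge0// mulr_ge0// ltW.
    rewrite /t sk normrM normfV normr_nat ler_pdivrMr ?ltr0n ?fact_gt0//.
    rewrite normrM exprMn mulrA mulrAC ler_pM//.
      by rewrite -sk WM// => i; rewrite subrr normr0.
    by rewrite -sk wprod_le.
  rewrite mulrCA -exprMn ler_wpM2l//; apply: le_trans (half4 _).
  apply: lerXn2r; rewrite ?nnegrE ?invr_ge0//; last by rewrite mulrCA mulrC.
  by rewrite !mulr_ge0// ltW.
have cubeE m : (\sum_(k : {ffun 'I_N -> 'I_m})
      (let a := [ffun i => val (k i)] in cc a * monomial a h)) =
    \sum_(k < (N * m).+1 + m) \sum_(s <- words k | wtype s \in cube N m) t h s.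
  rewrite (big_cube m (fun a => cc a * monomial a h)).
  under eq_bigr do rewrite ccE.
  by apply: big_cube_words; rewrite addSn ltnS leq_addr.
split.
  apply: (@summable_cube _ _ _ (M * 2)) => m.
  apply: (@le_trans _ _ (\sum_(a <- cube N m) \sum_(s <- words (mlen a) | wtype s == a) `|t h s|)).
    by apply: ler_sum => a _; rewrite ccE ler_norm_sum.
  rewrite (@big_cube_words _ _ m (N * m).+1)//.
  apply: (@le_trans _ _ (\sum_(0 <= k < (N * m).+1) M * 2^-1 ^+ k)).
    by rewrite big_mkord ler_sum.
  rewrite -mulr_sumr ler_wpM2l//.
  by rewrite (le_trans (half_tail _))// expr0 mulr1.
rewrite -cvg_shiftS; under eq_fun do rewrite cubeE.
apply: (@cvg_half_bound _ _ (M * 3)) => m.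
pose L := ((N * m.+1).+1 + m.+1)%N; pose Tm := \sum_(k < m.+1) \sum_(s <- words k) t h s.
have mL : (m.+1 <= L)%N by rewrite leq_addl.
rewrite /= -(big_mkord xpredT (fun k => \sum_(s <- words k | wtype s \in cube N m.+1) t h s)).
rewrite (big_cat_nat _ mL)//= opprD addrA.
have -> : \sum_(0 <= i < m.+1) \sum_(s <- words i | wtype s \in cube N m.+1) t h s = Tm.
  rewrite big_mkord; apply: eq_bigr => k _; rewrite big_seq_cond [RHS]big_seq.
  apply: eq_bigl => s; rewrite andb_idr// => /size_in_words sk.
  apply/negPn/negP => /notin_cube; rewrite mlen_wtype sk.
  by rewrite leqNgt ltn_ord.
have -> : M * 3 * 2^-1 ^+ m = M * 2^-1 ^+ m + M * 2 * 2^-1 ^+ m by ring.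
rewrite (le_trans (ler_normB _ _))// lerD//.
- apply: le_trans (word_taylor JW hr' _ (_ : 0 <= M * c ^+ m.+1 * m.+1`!%:R) _) _.
  + exact: ltW.
  + by rewrite !mulr_ge0// exprn_ge0// ltW.
  + move=> s u su /andP[u0 u1]; rewrite -su WM// => i.
    rewrite !mxE addrAC subrr add0r normrM ger0_norm//.
    by rewrite (le_lt_trans (ler_piMl _ u1))// (lt_le_trans (hr i)).
  + have -> : (N%:R * r) ^+ m.+1 * (M * c ^+ m.+1 * m.+1`!%:R) / m`!%:R =
        M * (m.+1%:R * (N%:R * r * c) ^+ m.+1).
      have n0 : m`!%:R != 0 :> R by rewrite pnatr_eq0 -lt0n fact_gt0.
      by rewrite factS natrM !exprMn; field.
    rewrite ler_wpM2l// (@le_trans _ _ (m.+1%:R * 4^-1 ^+ m.+1))//.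
      rewrite ler_wpM2l//; apply: lerXn2r; rewrite ?nnegrE ?invr_ge0//.
      by rewrite !mulr_ge0// ltW.
    have -> : (4^-1 : R) ^+ m.+1 = 2^-1 ^+ m.+1 * 2^-1 ^+ m.+1.
      by rewrite -exprMn; congr (_ ^+ _); field.
    rewrite mulrA -[leRHS]mul1r ler_pM ?mulr_ge0 ?exprn_ge0 ?invr_ge0//.
      rewrite exprVn ler_pdivrMr ?exprn_gt0// mul1r -natrX ler_nat.
      by rewrite ltnW// ltn_expl.
    by rewrite exprS ler_piMl ?exprn_ge0 ?invr_ge0// invf_le1// ler1n.
- rewrite (le_trans (ler_norm_sum _ _ _))//.
  apply: (@le_trans _ _ (\sum_(m.+1 <= k < L) M * 2^-1 ^+ k)).
    by rewrite ler_sum// => k _; rewrite (le_trans (ler_norm_sum _ _ _)).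
  rewrite -mulr_sumr -mulrA ler_wpM2l// (le_trans (half_tail mL))//.
  by rewrite ler_wpM2l// exprS ler_piMl ?exprn_ge0 ?invr_ge0// invf_le1// ler1n.
Qed.

End analytic_criterion.

(** * Analytic functions are smooth *)

Section power_series.
Context {R : realType}.
Implicit Types (y t d : R).

Definition pow_rem k y t : R := (y + t) ^+ k - y ^+ k - t * (k%:R * y ^+ k.-1).

Lemma pow_remS k y t :
  pow_rem k.+1 y t = (y + t) * pow_rem k y t + t ^+ 2 * (k%:R * y ^+ k.-1).
Proof.
rewrite /pow_rem; case: k => [|k] /=; first by rewrite !expr0 !expr1; ring.
by rewrite !exprS; ring.
Qed.

Lemma pow_rem0 y t : pow_rem 0 y t = 0.
Proof. by rewrite /pow_rem !expr0; ring. Qed.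

(** The remainder divided by t^2 is a polynomial in y and t with nonnegative
    coefficients, hence largest at (|y|, d). A remainder on the right-hand side
    makes the induction on k go through without a factor depending on k, which
    would spoil the summation over monomials. *)
Lemma pow_rem_le k y t d : `|t| <= d ->
  `|pow_rem k y t| * d ^+ 2 <= t ^+ 2 * pow_rem k `|y| d.
Proof.
move=> td; have d0 : 0 <= d by exact: le_trans td.
elim: k => [|k IH]; first by rewrite !pow_rem0 normr0 mul0r mulr0.
rewrite !pow_remS (le_trans (ler_wpM2r _ (ler_normD _ _))) ?sqr_ge0//.
rewrite [leLHS]mulrDl [leRHS]mulrDr lerD//.
- rewrite normrM -mulrA [leRHS]mulrCA ler_pM ?mulr_ge0 ?sqr_ge0//.
  by rewrite (le_trans (ler_normD _ _))// lerD2l.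
- rewrite normrM (ger0_norm (sqr_ge0 t)) normrM normrX normr_nat.
  by rewrite -mulrA (mulrC (_ * _) (d ^+ 2)).
Qed.

Lemma pow_rem_ge0 k y t : 0 <= y -> 0 <= t -> 0 <= pow_rem k y t.
Proof.
move=> y0 t0; elim: k => [|k IH]; first by rewrite pow_rem0.
by rewrite pow_remS addr_ge0// !mulr_ge0// ?addr_ge0 ?sqr_ge0// exprn_ge0.
Qed.

End power_series.

Section cube_limits.
Context {R : realType} {N : nat}.
Implicit Types (u : {ffun 'I_N -> nat} -> R).

Lemma cvg_norm_bound (v : nat -> R) (l K : R) :
  v @ \oo --> l -> (forall m, `|v m| <= K) -> `|l| <= K.
Proof.
move=> vl vK; rewrite leNgt; apply/negP => Kl.
have e0 : 0 < `|l| - K by rewrite subr_gt0.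
move/cvgrPdist_lt : vl => /(_ _ e0) [m _ /(_ _ (leqnn m))] /=.
apply/negP; rewrite -leNgt lerBlDr.
by rewrite (le_trans _ (lerD (lexx _) (vK m)))// -{1}(subrK (v m) l) ler_normD.
Qed.

Lemma cube_cvg u (M : R) : (forall m, \sum_(a <- cube N m) `|u a| <= M) ->
  cvgn (fun m => \sum_(a <- cube N m) u a).
Proof.
move=> uM.
have nn (v : {ffun 'I_N -> nat} -> R) (K : R) : (forall a, 0 <= v a) ->
    (forall m, \sum_(a <- cube N m) v a <= K) -> cvgn (fun m => \sum_(a <- cube N m) v a).
  move=> v0 vK; apply: nondecreasing_is_cvgn.
    by move=> m m' mm'; exact: ler_cube.
  by exists K => _ [m _ <-].
have -> : (fun m => \sum_(a <- cube N m) u a) =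
    (fun m => \sum_(a <- cube N m) (u a + `|u a|) - \sum_(a <- cube N m) `|u a|).
  by apply/funext => m; rewrite big_split/= addrK.
apply: is_cvgB; last exact: nn uM.
apply: (nn _ (M + M)) => [a|m]; first by rewrite -lerBlDl sub0r -[leRHS]normrN ler_norm.
by rewrite big_split/= lerD// (le_trans _ (uM m))// ler_sum// => a _; exact: ler_norm.
Qed.

(** Differentiating a power series shifts one index by 1 and so turns the
    cubes into boxes; these lie between consecutive cubes, up to indices whose
    terms vanish, and have the same limit because the sums of absolute values
    over consecutive cubes have differences tending to 0. *)
Lemma cube_cvg_between u (M l : R) (A : nat -> seq {ffun 'I_N -> nat}) :
  (forall m, \sum_(a <- cube N m) `|u a| <= M) ->
  (fun m => \sum_(a <- cube N m) u a) @ \oo --> l ->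
  (forall m, uniq (A m)) -> (forall m, {subset A m <= cube N m.+1}) ->
  (forall m a, a \in cube N m -> a \notin A m -> u a = 0) ->
  (fun m => \sum_(a <- A m) u a) @ \oo --> l.
Proof.
move=> uM ul Au A1 A0.
have : cvgn (fun m => \sum_(a <- cube N m) `|u a|).
  by apply: (@cube_cvg _ M) => m; under eq_bigr do rewrite normr_id.
move=> /cvg_ex[L uL].
have d0 : (fun m => \sum_(a <- cube N m.+1) `|u a| - \sum_(a <- cube N m) `|u a|) @ \oo --> (0 : R).
  have uL' : (fun m => \sum_(a <- cube N m.+1) `|u a|) @ \oo --> L.
    exact: (eq_ind_r id uL (cvg_shiftS _ _)).
  by have := cvgB uL' uL; rewrite subrr; apply.
have sub (B : seq _) m (v : {ffun 'I_N -> nat} -> R) : uniq B -> {subset B <= cube N m} ->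
    \sum_(a <- B) v a = \sum_(a <- cube N m | a \in B) v a.
  by move=> Bu Bm; apply: big_sub_uniq => //; exact: cube_uniq.
suff : (fun m => \sum_(a <- A m) u a - \sum_(a <- cube N m) u a) @ \oo --> (0 : R).
  move=> h; have := cvgD h ul; rewrite add0r => /(_ _) H; apply: cvg_trans H.
  by apply: near_eq_cvg; near=> m; rewrite /= subrK.
apply/cvgrPdist_le => e e0; move/cvgrPdist_le: d0 => /(_ _ e0); apply: filterS => m.
rewrite !sub0r !normrN => /(le_trans (ler_norm _)); apply: le_trans.
rewrite (sub (A m) m.+1)// (sub (cube N m) m.+1) ?cube_uniq//; last exact: cubeS.
rewrite (sub (cube N m) m.+1 (fun a => `|u a|)) ?cube_uniq//; last exact: cubeS.
rewrite (bigID (fun a => a \in cube N m))/= [X in _ - X](bigID (fun a => a \in A m))/=.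
rewrite [X in _ - (_ + X)]big1; last by move=> a /andP[am aA]; exact: A0 am aA.
rewrite addr0; under [X in _ - X]eq_bigl do rewrite andbC.
rewrite addrAC subrr add0r (le_trans (ler_norm_sum _ _ _))//.
rewrite [X in _ <= X - _](bigID (fun a => a \in cube N m))/= addrAC subrr add0r.
rewrite big_mkcond [leRHS]big_mkcond ler_sum// => a _.
by case: (a \in A m) => //=; case: ifP.
Unshelve. all: by end_near. Qed.

End cube_limits.

Section analytic_smooth.
Context {R : realType} {N : nat}.
Implicit Types (f : 'rV[R]_N -> R) (a b : {ffun 'I_N -> nat}) (h : 'rV[R]_N).

Definition mono_rest i a h : R := \prod_(j | j != i) h 0 j ^+ a j.
Definition mono_der i a h : R := (a i)%:R * h 0 i ^+ (a i).-1 * mono_rest i a h.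

Lemma monomialE i a h : monomial a h = h 0 i ^+ a i * mono_rest i a h.
Proof. by rewrite /monomial (bigD1 i). Qed.

Lemma monomial_le a h (r : R) : (forall i, `|h 0 i| <= r) -> `|monomial a h| <= r ^+ mlen a.
Proof.
move=> hr; rewrite /monomial /mlen normr_prod.
apply: (@le_trans _ _ (\prod_i r ^+ a i)); last by rewrite prodrXr.
by apply: ler_prod => i _; rewrite normr_ge0 normrX lerXn2r ?nnegrE// (le_trans _ (hr i)).
Qed.

Lemma monomial_diff_le a h (t p : R) : 0 <= t <= p -> (forall i, `|h 0 i| <= t) ->
  `|monomial a h - monomial a 0| * p <= t * p ^+ mlen a.
Proof.
move=> /andP[t0 tp] ht; have p0 : 0 <= p by exact: le_trans tp.
have [/forallP a0|/forallPn[i ai]] := boolP [forall i, a i == 0%N].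
  rewrite /monomial !big1 ?subrr ?normr0 ?mul0r ?mulr_ge0 ?exprn_ge0// => i _;
    by rewrite (eqP (a0 i)) expr0.
have -> : monomial a (0 : 'rV[R]_N) = 0.
  by rewrite /monomial (bigD1 i)//= mxE expr0n (negbTE ai) mul0r.
have : (0 < mlen a)%N by rewrite /mlen (bigD1 i)//= addn_gt0 lt0n ai.
rewrite subr0; have := monomial_le a ht; case: (mlen a) => // k hk _.
rewrite (le_trans (ler_wpM2r p0 hk))// !exprS -mulrA ler_wpM2l// mulrC ler_wpM2l//.
by apply: lerXn2r; rewrite ?nnegrE.
Qed.

Lemma mono_rest_le i a h (r : R) : (forall j, `|h 0 j| <= r) ->
  r ^+ a i * `|mono_rest i a h| <= r ^+ mlen a.
Proof.
move=> hr; have r0 : 0 <= r by exact: le_trans (hr i).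
have -> : mlen a = (a i + \sum_(j | j != i) a j)%N by rewrite /mlen (bigD1 i).
rewrite /mono_rest normr_prod exprD ler_wpM2l ?exprn_ge0//.
apply: (@le_trans _ _ (\prod_(j | j != i) r ^+ a j)); last by rewrite prodrXr.
by apply: ler_prod => j _; rewrite normr_ge0 normrX lerXn2r ?nnegrE// (le_trans _ (hr i)).
Qed.

Lemma mono_rest_shift i a h (t : R) : mono_rest i a (h + t *: delta_mx 0 i) = mono_rest i a h.
Proof.
by apply: eq_bigr => j ji; rewrite !mxE (negbTE ji) andbF mulr0 addr0.
Qed.

Lemma mono_der_rem i a h (t d r : R) : `|t| <= d -> (forall j, `|h 0 j| <= r - d) ->
  `|monomial a (h + t *: delta_mx 0 i) - monomial a h - t * mono_der i a h| * d ^+ 2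
    <= t ^+ 2 * r ^+ mlen a.
Proof.
move=> td hr; have d0 : 0 <= d by exact: le_trans td.
have hr' j : `|h 0 j| <= r by rewrite (le_trans (hr j))// gerBl.
have r0 : 0 <= r by exact: le_trans (hr' i).
rewrite !(monomialE i) mono_rest_shift !mxE !eqxx mulr1 /mono_der.
have -> : (h 0 i + t) ^+ a i * mono_rest i a h - h 0 i ^+ a i * mono_rest i a h -
    t * ((a i)%:R * h 0 i ^+ (a i).-1 * mono_rest i a h) =
    pow_rem (a i) (h 0 i) t * mono_rest i a h by rewrite /pow_rem; ring.
rewrite normrM mulrAC (le_trans (ler_wpM2r _ (pow_rem_le _ _ td)))//.
rewrite -mulrA ler_wpM2l ?sqr_ge0// (le_trans _ (mono_rest_le i a hr'))//.
rewrite ler_wpM2r//.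
apply: (@le_trans _ _ ((`|h 0 i| + d) ^+ a i)).
  rewrite /pow_rem -addrA -opprD gerBl addr_ge0 ?exprn_ge0//.
  by rewrite !mulr_ge0// exprn_ge0.
by apply: lerXn2r; rewrite ?nnegrE// ?addr_ge0// -lerBrDr.
Qed.

Lemma mono_der_le i a h (d r : R) : 0 <= d -> (forall j, `|h 0 j| <= r - d) ->
  `|mono_der i a h| * d <= r ^+ mlen a.
Proof.
move=> d0 hr.
have hr' j : `|h 0 j| <= r by rewrite (le_trans (hr j))// gerBl.
have r0 : 0 <= r by exact: le_trans (hr' i).
rewrite /mono_der normrM mulrAC (le_trans _ (mono_rest_le i a hr'))// ler_wpM2r//.
rewrite normrM normrX normr_nat mulrC.
apply: (@le_trans _ _ ((`|h 0 i| + d) ^+ a i)); last first.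
  by apply: lerXn2r; rewrite ?nnegrE// ?addr_ge0// -lerBrDr.
have := @pow_rem_ge0 _ (a i) `|h 0 i| d (normr_ge0 _) d0.
rewrite /pow_rem subr_ge0 => /le_trans; apply.
by rewrite gerBl exprn_ge0.
Qed.

Definition ainc i a : {ffun 'I_N -> nat} := [ffun j => (a j + (j == i))%N].

Lemma ainc_inj i : injective (ainc i).
Proof.
by move=> a b /ffunP e; apply/ffunP => j; have := e j; rewrite !ffunE => /addIn.
Qed.

Lemma mono_der_ainc i a h : mono_der i (ainc i a) h = (a i).+1%:R * monomial a h.
Proof.
rewrite /mono_der (monomialE i) !ffunE eqxx addn1 /= -mulrA; congr (_ * (_ * _)).
by apply: eq_bigr => j ji; rewrite ffunE (negbTE ji) addn0.
Qed.

Lemma mono_der0 i a h : a i = 0%N -> mono_der i a h = 0.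
Proof. by rewrite /mono_der => ->; rewrite !mul0r. Qed.

Lemma ainc_sub i m : {subset map (ainc i) (cube N m) <= cube N m.+1}.
Proof.
move=> b /mapP[a]; rewrite !mem_cube => /forallP am ->; apply/forallP => j.
by rewrite ffunE (leq_ltn_trans (leq_add (leqnn _) (leq_b1 _)))// addn1 ltnS.
Qed.

Lemma ainc_cover i m a : a \in cube N m -> a \notin map (ainc i) (cube N m) -> a i = 0%N.
Proof.
rewrite mem_cube => /forallP am na; apply/eqP; rewrite -leqn0 leqNgt.
apply: contra na => ai; apply/mapP; exists [ffun j => (a j - (j == i))%N].
  by rewrite mem_cube; apply/forallP => j; rewrite ffunE (leq_ltn_trans (leq_subr _ _)).
apply/ffunP => j; rewrite !ffunE subnK//; case: eqP => [->|//].
exact: ai.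
Qed.

(** Termwise differentiation. The expansion around X is differentiated at every
    point X + h of a smaller cube, not only at X: the resulting sum is then the
    power series of the derivative around X. *)
Lemma real_analytic_partial f : real_analytic f ->
  [/\ continuous f, forall i X, derivable f X (delta_mx 0 i) &
      forall i, real_analytic (rpartial i f)].
Proof.
move=> fan.
have key X : exists (r : R) (c : {ffun 'I_N -> nat} -> R), [/\ 0 < r,
    forall h, (forall i, `|h 0 i| < r) ->
      (fun m => \sum_(a <- cube N m) c a * monomial a h) @ \oo --> f (X + h) &
    forall p, 0 < p < r -> exists M, forall m, \sum_(a <- cube N m) `|c a| * p ^+ mlen a <= M].
  have [r [c [r0 H]]] := fan X; exists r, c; split => // [h /H[_]|p /andP[p0 pr]].
    by under eq_fun do rewrite (big_cube _ (fun a => c a * monomial a h)).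
  have [] := H (\row__ p) _; first by move=> i; rewrite mxE gtr0_norm.
  move=> /cube_summable[M HM] _; exists M => m; apply: le_trans (HM m).
  apply: ler_sum => a _; rewrite normrM ler_wpM2l//.
  rewrite /monomial; under eq_bigr do rewrite mxE.
  by rewrite prodrXr ger0_norm// exprn_ge0// ltW.
(* derivatives on the half cube, as sums of the differentiated monomials *)
have der X i : exists (r : R) (c : {ffun 'I_N -> nat} -> R) (M : R), [/\ 0 < r,
    forall h m, (forall j, `|h 0 j| < r) ->
      \sum_(a <- cube N m) `|c a * mono_der i a h| <= M &
    forall h, (forall j, `|h 0 j| < r) -> exists2 l,
      (fun m => \sum_(a <- cube N m) c a * mono_der i a h) @ \oo --> l &
      is_derive (X + h) (delta_mx 0 i) f l].
  have [r [c [r0 fc cM]]] := key X.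
  (* The radius r / 2 leaves room: monomials are estimated at p = r / 2 + d < r. *)
  pose d := r / 4; pose p := r / 2 + d.
  have d0 : 0 < d by rewrite divr_gt0.
  have pr : 0 < p < r by rewrite /p /d; apply/andP; split; lra.
  have [M HM] := cM _ pr.
  have bd h m : (forall j, `|h 0 j| < r / 2) -> \sum_(a <- cube N m) `|c a * mono_der i a h| <= M / d.
    move=> hr; rewrite ler_pdivlMr// mulr_suml (le_trans _ (HM m))// ler_sum// => a _.
    rewrite normrM -mulrA ler_wpM2l// mono_der_le// ?(ltW d0)// => j.
    by rewrite /p addrK ltW.
  exists (r / 2), c, (M / d); split; [by rewrite divr_gt0|exact: bd|].
  move=> h hr; have /cvg_ex[l Hl] := cube_cvg (fun m => bd h m hr).
  exists l => //; apply: (@is_derive_quad _ _ _ _ _ _ (M / d ^+ 2) d d0) => t td.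
  have H1 : (fun m => \sum_(a <- cube N m) c a * monomial a (h + t *: delta_mx 0 i)) @ \oo
      --> f (X + h + t *: delta_mx 0 i).
    rewrite -addrA; apply: fc => j; rewrite !mxE eqxx /=.
    rewrite (le_lt_trans (ler_normD _ _))// normrM.
    apply: (@lt_trans _ _ (r / 2 + d)); last by case/andP: pr.
    by rewrite ltr_leD// (le_trans _ (ltW td))// ler_piMr// normr_nat lern1 leq_b1.
  have H2 : (fun m => \sum_(a <- cube N m) c a * monomial a h) @ \oo --> f (X + h).
    apply: fc => j; rewrite (lt_trans (hr j))//; lra.
  have H3 := cvgB (cvgB H1 H2) (@cvgMl_tmp _ _ _ _ _ t _ Hl).
  apply: (cvg_norm_bound (H3 _ _ _)) => m /=.
  rewrite !fctE mulr_sumr -!sumrB (le_trans (ler_norm_sum _ _ _))//.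
  rewrite mulrAC ler_pdivlMr ?exprn_gt0// mulr_suml.
  apply: (@le_trans _ _ (\sum_(a <- cube N m) t ^+ 2 * (`|c a| * p ^+ mlen a))).
    apply: ler_sum => a _; rewrite [t * (c a * _)]mulrCA -!mulrBr normrM -mulrA [leRHS]mulrCA ler_wpM2l//.
    apply: mono_der_rem; first exact: ltW.
    by move=> j; rewrite /p addrK ltW.
  by rewrite -mulr_sumr mulrC ler_wpM2r ?sqr_ge0.
split.
- move=> X; have [r [c [r0 fc cM]]] := key X.
  have pr : 0 < r / 2 < r by rewrite divr_gt0//=; lra.
  have [M HM] := cM _ pr.
  have fX : (fun m => \sum_(a <- cube N m) c a * monomial a 0) @ \oo --> f X.
    by have := fc 0; rewrite addr0; apply => i; rewrite mxE normr0.
  have M0 : 0 <= M by rewrite (le_trans _ (HM 0%N))// sumr_ge0// => a _; rewrite mulr_ge0// exprn_ge0// divr_ge0// ltW.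
  have bd h (t : R) : 0 <= t <= r / 2 -> (forall i, `|h 0 i| <= t) ->
      `|f (X + h) - f X| <= t * (M / (r / 2)).
    move=> /andP[t0 tr] ht.
    have fXh : (fun m => \sum_(a <- cube N m) c a * monomial a h) @ \oo --> f (X + h).
      apply: fc => i; rewrite (le_lt_trans (ht i))//; lra.
    have H3 := cvgB fXh fX; apply: (cvg_norm_bound (H3 _)) => m /=.
    rewrite !fctE -sumrB (le_trans (ler_norm_sum _ _ _))// mulrA ler_pdivlMr; last by case/andP: pr.
    rewrite mulr_suml (le_trans _ (ler_wpM2l t0 (HM m)))// mulr_sumr ler_sum// => a _.
    rewrite -mulrBr normrM -mulrA [leRHS]mulrCA ler_wpM2l//.
    by apply: monomial_diff_le; rewrite // t0.
  apply: dist_continuous => e e0.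
  have K0 : 0 <= M / (r / 2) by rewrite divr_ge0// ltW// divr_gt0.
  exists (Num.min (r / 2) (e / (M / (r / 2) + 1))).
    by rewrite lt_min; apply/andP; split; rewrite divr_gt0// ltr_wpDl.
  move=> Y; rewrite lt_min => /andP[Yr Ye].
  rewrite (le_trans (bd Y `|Y| _ (coord_le_norm Y)))//; first by rewrite normr_ge0 ltW.
  move: Ye; rewrite ltr_pdivlMr ?ltr_wpDl// => /ltW; apply: le_trans.
  by rewrite ler_wpM2l// lerDl.
- move=> i X; have [r [c [M [r0 _ H]]]] := der X i.
  have [|l _] := H 0; first by move=> j; rewrite mxE normr0.
  by rewrite addr0 => -[].
- move=> i X; have [r [c [M [r0 bd H]]]] := der X i.
  exists r, (fun b => c (ainc i b) * (b i).+1%:R); split => // h hr.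
  have E b : c (ainc i b) * (b i).+1%:R * monomial b h = c (ainc i b) * mono_der i (ainc i b) h.
    by rewrite mono_der_ainc mulrA.
  split.
    apply: (@summable_cube _ _ _ M) => m; under eq_bigr do rewrite E.
    apply: le_trans (bd h m.+1 hr).
    rewrite -(big_map (ainc i) xpredT (fun a => `|c a * mono_der i a h|)).
    apply: ler_sum_sub => //; [|exact: cube_uniq|exact: ainc_sub].
    by rewrite map_inj_uniq ?cube_uniq//; exact: ainc_inj.
  have [l Hl dl] := H h hr; rewrite /rpartial; have [_ ->] := dl.
  under eq_fun do rewrite (big_cube _ (fun b => c (ainc i b) * (b i).+1%:R * monomial b h)).
  under eq_fun do under eq_bigr do rewrite E.
  apply: cvg_trans (cube_cvg_between (A := fun m => map (ainc i) (cube N m)) (fun m => bd h m hr) Hl _ _ _).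
  + by apply: near_eq_cvg; near=> m; rewrite big_map.
  + by move=> m; rewrite map_inj_uniq ?cube_uniq//; exact: ainc_inj.
  + by move=> m; exact: ainc_sub.
  + by move=> m a am /(ainc_cover am) a0; rewrite mono_der0// mulr0.
Unshelve. all: by end_near. Qed.

Lemma real_analytic_smooth f : real_analytic f -> rsmooth f.
Proof.
move=> fan s; have : real_analytic (rjet f s).
  by elim: s => //= i s /real_analytic_partial[_ _]; exact.
by case/real_analytic_partial.
Qed.

End analytic_smooth.

(** * Lebesgue measure on R^N and Gaussians *)

Section lebesgue_tuple.
Context {R : realType}.
Local Notation mR := (measurableTypeR R).

Definition tbox N (x : 'I_N -> R) (r : R) : set (N.-tuple mR) :=
  [set t | forall i, x i - r < tnth t i < x i + r].

Lemma measurable_tbox N (x : 'I_N -> R) r : measurable (tbox x r).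
Proof.
have -> : tbox x r = \bigcap_(i in [set: 'I_N]) ((@tnth _ mR ^~ i) @^-1` `]x i - r, x i + r[).
  apply/seteqP; split=> [t H i _|t H i] /=; first by rewrite in_itv/= H.
  by have := H i I; rewrite /= in_itv.
apply: fin_bigcap_measurable => [|i _]; first exact: finite_finset.
by rewrite -[X in measurable X]setTI; apply: measurable_tnth => //; exact: measurable_itv.
Qed.

Lemma leb_tbox N (x : 'I_N -> R) (r : R) : 0 < r -> (0 < leb R N (tbox x r))%E.
Proof.
move=> r0; elim: N x => [|N IH] x.
  rewrite /= diracE mem_set ?lte01//= => -[]; by case.
have mt := measurable_tbox x r.
have -> : leb R N.+1 (tbox x r) =
    (@lebesgue_measure R \x leb R N)%E (`]x ord0 - r, x ord0 + r[ `*` tbox (fun i => x (lift ord0 i)) r).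
  rewrite /= /leb_cons /pushforward; congr (_ _).
  apply/seteqP; split=> [[y t] H|[y t] [Hy Ht] i] /=.
    split=> [|i] /=; first by have := H ord0; rewrite in_itv.
    by have := H (lift ord0 i); rewrite tnthS.
  move: Hy => /=; rewrite in_itv/= => Hy.
  by case: (unliftP ord0 i) => [j ->|->]; [rewrite tnthS; exact: Ht|].
rewrite product_measure1E; [|exact: measurable_itv|exact: measurable_tbox].
apply: mule_gt0; last exact: IH.
have lr : x ord0 - r < x ord0 + r by rewrite ltrD2l gt0_cp.
by rewrite /= lebesgue_measure_itv/= lte_fin lr lte_fin subr_gt0.
Qed.

Lemma leb_setT N : (0 < leb R N [set: N.-tuple mR])%E.
Proof.
apply: lt_le_trans (@leb_tbox N (fun=> 0) 1 ltr01) _.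
by apply: le_measure; rewrite ?inE//; exact: measurable_tbox.
Qed.

(** A set of full measure is dense: almost everywhere bounds on continuous
    functions, and on suprema of continuous functions, are bounds everywhere. *)
Lemma ae_leb_dense N (P : 'rV[R]_N -> Prop) :
  (\forall t \ae leb R N, P (row_of_tuple t)) ->
  forall (X : 'rV[R]_N) (r : R), 0 < r ->
    exists2 Y : 'rV[R]_N, (forall i, `|Y 0 i - X 0 i| < r) & P Y.
Proof.
move=> aeP X r r0; apply: contrapT => nP.
have : (leb R N).-negligible (tbox (X 0) r).
  apply: negligibleS aeP => t tX /= Pt; apply: nP; exists (row_of_tuple t) => // i.
  by rewrite mxE ltr_distl.
rewrite negligibleP; last exact: measurable_tbox.
by move=> E; have := leb_tbox (X 0) r0; rewrite E ltxx.
Qed.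

Lemma normL_oo N (f : 'rV[R]_N -> \bar R) :
  normL +oo f = ess_sup (leb R N) (abse \o (f \o @row_of_tuple R N)).
Proof. by rewrite /normL unlock leb_setT. Qed.

Lemma normL_oo_ge0 N (f : 'rV[R]_N -> \bar R) : (0 <= normL +oo f)%E.
Proof. exact: Lnorm_ge0. Qed.

Lemma normL_oo_le N (f : 'rV[R]_N -> \bar R) (M : \bar R) :
  (forall X, `|f X| <= M)%E -> (normL +oo f <= M)%E.
Proof.
by move=> fM; rewrite normL_oo; apply/ess_supP; apply/nearW => t; exact: fM.
Qed.

Lemma normL_oo_dense N (f : 'rV[R]_N -> \bar R) (M : \bar R) :
  (normL +oo f <= M)%E ->
  forall (X : 'rV[R]_N) (r : R), 0 < r ->
    exists2 Y : 'rV[R]_N, (forall i, `|Y 0 i - X 0 i| < r) & (`|f Y| <= M)%E.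
Proof. by rewrite normL_oo => /ess_supP H; exact: ae_leb_dense H. Qed.

End lebesgue_tuple.

Section gaussian.
Context {R : realType}.
Local Notation mR := (measurableTypeR R).
Variable d : R.
Hypothesis d0 : 0 < d.

Definition gauss N (V : 'rV[R]_N) : R := expR (- (d * sqnorm V)).

Lemma measurable_gauss N : measurable_fun setT (@gauss N \o @row_of_tuple R N).
Proof.
apply: (measurableT_comp (f := expR)) => //.
have -> : (fun t => - (d * sqnorm (@row_of_tuple R N t))) =
    (fun t => - d * \sum_i tnth t i ^+ 2).
  by apply/funext => t; rewrite mulNr /sqnorm; under eq_bigr do rewrite mxE.
apply: measurable_funM => //.
by apply: measurable_sum => i; apply: measurable_funX; exact: measurable_tnth.
Qed.

Lemma integral_gauss1 : (\int[@lebesgue_measure R]_x (expR (- (d * x ^+ 2)))%:E < +oo)%E.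
Proof.
pose s : R := Num.sqrt (2 * d)^-1.
have s2 : s ^+ 2 = (2 * d)^-1 by rewrite sqr_sqrtr// invr_ge0 mulr_ge0// ltW.
have s0 : s != 0 by rewrite gt_eqF// sqrtr_gt0 invr_gt0 mulr_gt0.
have E x : expR (- (d * x ^+ 2)) = (normal_peak s)^-1 * normal_pdf 0 s x.
  rewrite normal_pdfE// mulKf ?gt_eqF ?normal_peak_gt0// /normal_fun subr0 s2.
  by congr expR; field; rewrite gt_eqF.
under eq_integral do rewrite E EFinM.
rewrite integralZl//; last exact: integrable_normal_pdf.
by rewrite integral_normal_pdf mule1 ltry.
Qed.

Lemma integral_gauss N : (\int[leb R N]_t (gauss (row_of_tuple t))%:E < +oo)%E.
Proof.
elim: N => [|N IH].
  rewrite integral_dirac//=; first by rewrite diracT ?mul1e ?ltry.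
  by apply/measurable_EFinP; exact: measurable_gauss.
rewrite [X in (X < _)%E](_ : _ = \int[pushforward (@lebesgue_measure R \x leb R N)
  (@tuple_of_prod R N)]_(t in setT) (gauss (row_of_tuple t))%:E)%E//.
rewrite ge0_integral_pushforward//=; last 3 first.
- exact: measurable_tuple_of_prod.
- by apply/measurable_EFinP; exact: measurable_gauss.
- by move=> t _; rewrite lee_fin expR_ge0.
rewrite preimage_setT fubini_tonelli1//=; last 2 first.
- apply/measurable_EFinP.
  apply: (measurableT_comp (@measurable_gauss N.+1)).
  exact: measurable_tuple_of_prod.
- by move=> t; rewrite lee_fin expR_ge0.
have E (x : R) (t : N.-tuple R) : gauss (row_of_tuple (tuple_of_prod (x, t))) =
    expR (- (d * x ^+ 2)) * gauss (row_of_tuple t).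
  rewrite /gauss -expRD -opprD -mulrDr; congr (expR (- (_ * _))).
  rewrite /sqnorm big_ord_recl mxE; congr (_ + _); apply: eq_bigr => i _.
  by rewrite !mxE tnthS.
have E2 (x : R) : (\int[leb R N]_t (gauss (row_of_tuple (tuple_of_prod (x, t))))%:E =
    (expR (- (d * x ^+ 2)))%:E * \int[leb R N]_t (gauss (row_of_tuple t))%:E)%E.
  under eq_integral => t _ do rewrite E EFinM.
  apply: ge0_integralZl => //.
  - by apply/measurable_EFinP; exact: measurable_gauss.
  - by move=> t _; rewrite lee_fin; exact: expR_ge0.
rewrite /fubini_F; under eq_integral => x _ do rewrite /= E2.
have I0 : (0 <= \int[leb R N]_t (gauss (row_of_tuple t))%:E)%E.
  by apply: integral_ge0 => t _; rewrite lee_fin expR_ge0.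
rewrite ge0_integralZr//.
- by rewrite lte_mul_pinfty ?ge0_fin_numE ?integral_gauss1// integral_ge0// => t _; rewrite lee_fin expR_ge0.
- apply/measurable_EFinP; apply: (measurableT_comp (f := expR)) => //.
  rewrite (_ : (fun x => _) = (fun x => - d * x ^+ 2)).
    by apply: measurable_funM => //; exact: measurable_funX.
  by apply/funext => x; rewrite mulNr.
Qed.

Lemma gauss_inL N (K : R) : 0 <= K ->
  inL 1 (fun V : 'rV[R]_N => K * gauss V) /\ inL +oo (fun V : 'rV[R]_N => K * gauss V).
Proof.
move=> K0; have mf : measurable_fun setT ((fun V : 'rV[R]_N => K * gauss V) \o @row_of_tuple R N).
  by apply: measurable_funM => //; exact: measurable_gauss.
split; apply/andP; split; rewrite inE//= /finite_norm.
- rewrite Lnorm1; under eq_integral => t _.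
    rewrite /= ger0_norm; last by rewrite mulr_ge0// expR_ge0.
    rewrite EFinM; over.
  rewrite ge0_integralZl//; last 2 first.
  - by apply/measurable_EFinP; exact: measurable_gauss.
  - by move=> t _; rewrite lee_fin expR_ge0.
  rewrite lte_mul_pinfty//; exact: integral_gauss.
- apply: le_lt_trans (@normL_oo_le _ _ (fun V => (K * gauss V)%:E) K%:E _) (ltry _) => V.
  rewrite /= lee_fin ger0_norm; last by rewrite mulr_ge0// expR_ge0.
  rewrite ler_piMr// /gauss -expR0 ler_expR oppr_le0 mulr_ge0 ?(ltW d0)//.
  by rewrite /sqnorm sumr_ge0// => i _; exact: sqr_ge0.
Qed.

End gaussian.

(** * Holomorphic extension by the Taylor series *)

Section sums.
Context {R : realType}.

Lemma exp_partial_sum (x : R) n : 0 <= x -> \sum_(k < n) x ^+ k / k`!%:R <= expR x.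
Proof.
move=> x0; have -> : \sum_(k < n) x ^+ k / k`!%:R = series (exp_coeff x) n.
  by rewrite /series/= big_mkord; apply: eq_bigr => k _; rewrite /exp_coeff/=.
apply: nondecreasing_cvgn_le; last exact: is_cvg_series_exp_coeff.
apply: nondecreasing_series => k _ _.
by rewrite /exp_coeff/= divr_ge0// exprn_ge0.
Qed.

Lemma amgm2 (x y : R) : x * y <= (x ^+ 2 + y ^+ 2) / 2.
Proof. by rewrite ler_pdivlMr// -subr_ge0; have := sqr_ge0 (x - y); lra. Qed.

(** Each term is at most the mean of (2 q^2)^k / k! and 2^-k. *)
Lemma sqrt_exp_partial_sum (q : R) n : 0 <= q ->
  \sum_(k < n) q ^+ k / Num.sqrt k`!%:R <= expR (2 * q ^+ 2) + 1.
Proof.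
move=> q0.
have term k : q ^+ k / Num.sqrt k`!%:R <=
    ((2 * q ^+ 2) ^+ k / k`!%:R + (2^-1) ^+ k) / 2.
  have f0 : 0 < k`!%:R :> R by rewrite ltr0n fact_gt0.
  have s0 : Num.sqrt k`!%:R != 0 :> R by rewrite gt_eqF// sqrtr_gt0.
  have p0 : (Num.sqrt 2 : R) ^+ k != 0 by rewrite expf_neq0// gt_eqF// sqrtr_gt0.
  rewrite (_ : q ^+ k / _ = ((Num.sqrt 2 ^+ k * q ^+ k) / Num.sqrt k`!%:R) *
    (Num.sqrt 2 ^+ k)^-1); last by field; rewrite s0 p0.
  apply: le_trans (amgm2 _ _) _; rewrite le_eqVlt; apply/orP; left; apply/eqP.
  have E2 : ((Num.sqrt 2 : R) ^+ k) ^+ 2 = 2 ^+ k by rewrite exprAC sqr_sqrtr.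
  congr ((_ + _) / 2); last by rewrite !exprVn E2.
  by rewrite exprMn exprVn sqr_sqrtr ?ltW// exprMn E2 exprMn [X in _ * X / _]exprAC.
apply: le_trans (ler_sum _ (fun (k : 'I_n) _ => term k)) _.
rewrite -mulr_suml big_split/= ler_pdivrMr// [leRHS]mulrDl mul1r.
apply: lerD.
  rewrite (le_trans (exp_partial_sum _ _)) ?mulr_ge0 ?sqr_ge0//.
  by rewrite ler_peMr ?expR_ge0// ler1n.
rewrite -(big_mkord xpredT (fun k => (2^-1 : R) ^+ k)).
by rewrite (le_trans (half_tail (leq0n n)))// expr0 mulr1.
Qed.

(** The binomial coefficient of k + j over k is at most 2^(k + j), which leaves
    a factor 2^(k + j) to spare under the root. *)
Lemma fact_sqrt_le k j :
  Num.sqrt (k + j)`!%:R <= 2 ^+ (k + j) * Num.sqrt k`!%:R * Num.sqrt j`!%:R :> R.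
Proof.
have -> : (2 : R) ^+ (k + j) = Num.sqrt (2 ^+ (k + j) ^+ 2) by rewrite sqrtr_sqr ger0_norm// exprn_ge0.
rewrite -sqrtrM ?sqr_ge0// -sqrtrM ?mulr_ge0 ?sqr_ge0//.
apply: ler_wsqrtr; rewrite -!natrX -!natrM ler_nat.
have -> : (k + j)`! = ('C(k + j, k) * (k`! * j`!))%N.
  by rewrite -{3}(addnK k j) (addnC j) bin_fact// leq_addr.
rewrite mulnA leq_mul2r; apply/orP; right; rewrite leq_mul2r; apply/orP; right.
apply: (@leq_trans (2 ^ (k + j))); last by rewrite -mulnn leq_pmulr// expn_gt0.
rewrite -[2%N]/(1 + 1)%N expnDn (bigD1 (inord k))//= inordK ?ltnS ?leq_addr//.
by rewrite !exp1n !muln1 leq_addr.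
Qed.

Lemma cvg_abs_sum (u : nat -> R) (M : R) : (forall n, \sum_(k < n) `|u k| <= M) ->
  cvgn (fun n => \sum_(k < n) u k).
Proof.
move=> uM; have -> : (fun n => \sum_(k < n) u k) = series u.
  by apply/funext => n; rewrite /series/= big_mkord.
apply: normed_cvg; apply: nondecreasing_is_cvgn.
  move=> m m' mm'; rewrite /= /series/=.
  by rewrite (big_cat_nat _ mm')//= lerDl sumr_ge0.
by exists M => _ [n _ <-]; rewrite /= /series/= big_mkord.
Qed.

Lemma cvg_sumn (I : Type) (r : seq I) (u : I -> nat -> R) (l : I -> R) :
  (forall i, u i @ \oo --> l i) ->
  (fun n => \sum_(i <- r) u i n) @ \oo --> \sum_(i <- r) l i.
Proof.
move=> ul; elim: r => [|i r IH].
  by rewrite big_nil; under eq_fun do rewrite big_nil; exact: cvg_cst.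
by rewrite big_cons; under eq_fun do rewrite big_cons; apply: cvgD.
Qed.

(** A uniform bound on the second derivatives bounds the quadratic remainders
    uniformly, and such a bound passes to the limit. *)
Lemma derive_limit (F F1 F2 : nat -> R -> R) (G : R -> R) (L M : R) :
  (forall n (t : R), is_derive t 1 (F n) (F1 n t)) ->
  (forall n (t : R), is_derive t 1 (F1 n) (F2 n t)) ->
  (forall n (t : R), `|t| <= 1 -> `|F2 n t| <= M) ->
  (forall t, (fun n => F n t) @ \oo --> G t) ->
  (fun n => F1 n 0) @ \oo --> L ->
  forall t : R, `|t| <= 1 -> `|G t - G 0 - t * L| <= M * t ^+ 2.
Proof.
move=> dF dF1 F2M FG F1L t t1.
have M0 : 0 <= M by apply: le_trans (F2M 0%N 0 _); rewrite // normr0.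
have H := cvgB (cvgB (FG t) (FG 0)) (@cvgMl_tmp _ _ _ _ _ t _ F1L).
apply: (cvg_norm_bound (H _ _ _)) => n; rewrite !fctE.
have [c [ct E]] := mvt_centered t (dF n).
have [c' [ct' E']] := mvt_centered c (dF1 n).
rewrite E -mulrBr E' !normrM.
have -> : M * t ^+ 2 = `|t| * (`|t| * M).
  by rewrite -(real_normK (num_real t)) expr2; ring.
rewrite ler_wpM2l// ler_pM// F2M// (le_trans ct')// (le_trans ct)//.
Qed.

End sums.

Section jets.
Context {R : realType} {d : nat}.
Implicit Types (U : seq 'I_d -> 'rV[R]_d -> R) (A B a b : 'rV[R]_d) (s : seq 'I_d).

Definition sym_jet U := line_jet U /\ forall s s', perm_eq s s' -> U s = U s'.

Lemma rjet_sym f : rsmooth f -> sym_jet (rjet f).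
Proof. by move=> fs; split; [exact: rsmooth_line_jet|move=> s s'; exact: rjet_perm]. Qed.

(** The jets of the derivative of a function in the direction a, and of its
    i-th partial derivative. *)
Definition dirjet a U s A : R := \sum_l a 0 l * U (l :: s) A.
Definition shift i U s : 'rV[R]_d -> R := U (i :: s).

Lemma perm_swap2 (i j : 'I_d) s : perm_eq [:: i, j & s] [:: j, i & s].
Proof. by have /permPl := perm_catCA [:: i] [:: j] s. Qed.

Lemma sym_jet_shift i U : sym_jet U -> sym_jet (shift i U).
Proof.
move=> [JU SU]; split=> [s A h|s s' ss']; last by apply: SU; rewrite perm_cons.
rewrite /shift; have := JU (i :: s) A h; congr is_derive.
apply: eq_bigr => l _; congr (_ * _).
by rewrite (SU _ _ (perm_swap2 l i s)).
Qed.

Lemma sym_jet_dirjet a U : sym_jet U -> sym_jet (dirjet a U).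
Proof.
move=> [JU SU]; split=> [s A h|s s' ss']; last first.
  apply/funext => A; apply: eq_bigr => l _; congr (_ * _).
  by rewrite (SU (l :: s) (l :: s')) ?perm_cons.
have -> : dirjet a U s = \sum_(l < d) (a 0 l *: U (l :: s)).
  by apply/funext => B; rewrite fct_sumE.
have dU l : is_derive A h (U (l :: s)) (\sum_j h 0 j * U [:: j, l & s] A) by exact: JU.
apply: is_derive_eq; rewrite /GRing.scale/= /dirjet.
under eq_bigr do rewrite mulr_sumr.
rewrite exchange_big/=; apply: eq_bigr => l _; rewrite mulr_sumr.
apply: eq_bigr => j _; rewrite mulrCA; congr (_ * (_ * _)).
by rewrite (SU _ _ (perm_swap2 l j s)).
Qed.

Lemma dirjetC a b U : sym_jet U -> dirjet a (dirjet b U) = dirjet b (dirjet a U).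
Proof.
move=> [_ SU]; apply/funext => s; apply/funext => A; rewrite /dirjet.
under eq_bigr do rewrite mulr_sumr.
rewrite exchange_big/=; apply: eq_bigr => l _; rewrite mulr_sumr.
apply: eq_bigr => j _; rewrite mulrCA; congr (_ * (_ * _)).
by rewrite (SU _ _ (perm_swap2 l j s)).
Qed.

Lemma dirjet_shift a i U : sym_jet U -> dirjet a (shift i U) = shift i (dirjet a U).
Proof.
move=> [_ SU]; apply/funext => s; apply/funext => A; rewrite /shift /dirjet.
by apply: eq_bigr => l _; rewrite (SU _ _ (perm_swap2 l i s)).
Qed.

(** The k-th derivative at A of the function with jet U, applied to B in each
    of its k arguments. *)
Definition homog k U A B : R := \sum_(s <- words k) wprod B s * U s A.

Lemma homog0 U A B : homog 0 U A B = U [::] A.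
Proof. by rewrite /homog big_words0 /wprod big_nil mul1r. Qed.

Lemma homogS k U A B : homog k.+1 U A B = \sum_l B 0 l * homog k (shift l U) A B.
Proof.
rewrite /homog big_wordsS; apply: eq_bigr => l _; rewrite mulr_sumr.
by apply: eq_bigr => s _; rewrite /wprod big_cons mulrA.
Qed.

Lemma homog_dirjet k U A B a :
  homog k (dirjet a U) A B = \sum_l a 0 l * homog k (shift l U) A B.
Proof.
rewrite /homog /dirjet; under eq_bigr do rewrite mulr_sumr.
rewrite exchange_big/=; apply: eq_bigr => l _; rewrite mulr_sumr.
by apply: eq_bigr => s _; rewrite mulrCA.
Qed.

(** The base point contributes the derivative in the direction a, and each of
    the k arguments B, by symmetry, one derivative in the direction b. *)
Lemma is_derive_homog k U A B a b (t : R) : sym_jet U ->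
  is_derive t 1 (fun t : R => homog k U (A + t *: a) (B + t *: b))
   (homog k (dirjet a U) (A + t *: a) (B + t *: b) +
    k%:R * homog k.-1 (dirjet b U) (A + t *: a) (B + t *: b)).
Proof.
elim: k U => [|k IH] U SU.
  rewrite mul0r addr0 homog0; under eq_fun do rewrite homog0.
  by case: SU => JU _; exact: is_derive_line.
have -> : (fun t : R => homog k.+1 U (A + t *: a) (B + t *: b)) =
    \sum_(l < d) ((fun t => B 0 l + t * b 0 l) *
      (fun t : R => homog k (shift l U) (A + t *: a) (B + t *: b))).
  apply/funext => u; rewrite homogS fct_sumE; apply: eq_bigr => l _.
  by rewrite !fctE !mxE.
have dl l : is_derive t 1 (fun t : R => homog k (shift l U) (A + t *: a) (B + t *: b))
    (homog k (shift l (dirjet a U)) (A + t *: a) (B + t *: b) +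
     k%:R * homog k.-1 (shift l (dirjet b U)) (A + t *: a) (B + t *: b)).
  by rewrite -!dirjet_shift//; apply: IH; exact: sym_jet_shift.
have dB l : is_derive t 1 (fun t : R => B 0 l + t * b 0 l) (b 0 l).
  by apply: is_derive_eq; rewrite /GRing.scale/=; ring.
apply: is_derive_eq; rewrite homogS /= -natr1 mulrDl mul1r.
have -> : k%:R * homog k (dirjet b U) (A + t *: a) (B + t *: b) =
  \sum_l (B + t *: b) 0 l * (k%:R * homog k.-1 (shift l (dirjet b U)) (A + t *: a) (B + t *: b)).
  case: k {IH dl} => [|k]; first by rewrite mul0r big1// => l _; rewrite mul0r mulr0.
  by rewrite homogS mulr_sumr; apply: eq_bigr => l _; rewrite mulrCA.
rewrite (homog_dirjet k U _ _ b) addrA -!big_split/=; apply: eq_bigr => l _.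
by rewrite /GRing.scale/= !mxE; ring.
Qed.

End jets.

Section continuation.
Context {R : realType} {d : nat}.
Implicit Types (U : seq 'I_d -> 'rV[R]_d -> R) (A B a b : 'rV[R]_d) (s : seq 'I_d).

(** The real part of the j-th power of the imaginary unit. *)
Definition eps (j : nat) : R := if odd j then 0 else (-1) ^+ j./2.

Lemma epsSS j : eps j.+2 = - eps j.
Proof. by rewrite /eps /= negbK; case: ifP; rewrite ?oppr0// exprS mulN1r. Qed.

Lemma eps_le1 j : `|eps j| <= 1.
Proof. by rewrite /eps; case: ifP; rewrite ?normr0// normrX normrN1 expr1n. Qed.

(** Partial sums of the real part of i^m f(A + i B), where f has jet U and
    f(A + i B) is the sum of the terms i^k / k! times the k-th derivative at A
    applied to B; multiplication by i is the shift of m. *)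
Definition ext_sum n m U A B : R := \sum_(k < n) eps (k + m) * (homog k U A B / k`!%:R).

Definition ext_fun m U A B : R := limn (fun n => ext_sum n m U A B).

(** The offset j keeps the constant C the same for a function and for all its
    derivatives: differentiating raises j and leaves K and C alone. *)
Definition jet_bound (K C : R) (j : nat) U : Prop := forall s A,
  `|U s A| <= K * C ^+ (size s + j) * Num.sqrt (size s + j)`!%:R.

Lemma jet_bound_shift K C j U i : jet_bound K C j U -> jet_bound K C j.+1 (shift i U).
Proof. by move=> BU s A; rewrite addnS; exact: BU. Qed.

Lemma jet_bound_dirjet K C j U a (al : R) : \sum_l `|a 0 l| <= al -> 0 <= K -> 0 <= C ->
  jet_bound K C j U -> jet_bound (al * K) C j.+1 (dirjet a U).
Proof.
move=> aal K0 C0 BU s A; rewrite /dirjet (le_trans (ler_norm_sum _ _ _))//.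
rewrite -!mulrA; apply: (le_trans _ (ler_wpM2r _ aal)); last by rewrite !mulr_ge0// exprn_ge0.
rewrite mulr_suml ler_sum// => l _; rewrite normrM ler_wpM2l// mulrA.
exact: jet_bound_shift.
Qed.

Lemma is_derive_ext_sum n m U A B a b (t : R) : sym_jet U ->
  is_derive t 1 (fun t : R => ext_sum n m U (A + t *: a) (B + t *: b))
   (ext_sum n m (dirjet a U) (A + t *: a) (B + t *: b) +
    ext_sum n.-1 m.+1 (dirjet b U) (A + t *: a) (B + t *: b)).
Proof.
move=> SU.
have -> : (fun t : R => ext_sum n m U (A + t *: a) (B + t *: b)) =
    \sum_(k < n) ((eps (k + m) / k`!%:R) *: (fun t : R => homog k U (A + t *: a) (B + t *: b))).
  apply/funext => u; rewrite fct_sumE; apply: eq_bigr => k _.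
  by rewrite !fctE /GRing.scale/=; ring.
have dh k := is_derive_homog k A B a b t SU.
apply: is_derive_eq; rewrite /ext_sum /GRing.scale/=.
under eq_bigr do rewrite mulrDr.
rewrite big_split/=; congr (_ + _).
  by apply: eq_bigr => k _; rewrite /GRing.scale/=; ring.
case: n => [|n]; first by rewrite !big_ord0.
rewrite big_ord_recl mul0r mulr0 add0r; apply: eq_bigr => k _.
rewrite /GRing.scale/=.
rewrite /bump /= add1n addSnnS factS natrM.
have f0 : k`!%:R != 0 :> R by rewrite pnatr_eq0 -lt0n fact_gt0.
have k0 : k.+1%:R != 0 :> R by rewrite pnatr_eq0.
by field; rewrite f0 addrC natr1 k0.
Qed.

Lemma ext_sum_dirjet n m U A B a :
  ext_sum n m (dirjet a U) A B = \sum_i a 0 i * ext_sum n m (shift i U) A B.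
Proof.
rewrite /ext_sum; under [RHS]eq_bigr do rewrite mulr_sumr.
rewrite exchange_big/=; apply: eq_bigr => k _; rewrite homog_dirjet mulr_suml mulr_sumr.
by apply: eq_bigr => i _; ring.
Qed.

Section bounds.
Variables (K C rho : R) (j : nat).
Hypotheses (K0 : 0 <= K) (C0 : 0 <= C) (rho0 : 0 <= rho).

Definition ext_bound : R :=
  K * (2 * C) ^+ j * Num.sqrt j`!%:R * (expR (2 * (2 * C * d%:R * rho) ^+ 2) + 1).

Lemma ext_sum_abs_le n m U A B : jet_bound K C j U -> (forall i, `|B 0 i| <= rho) ->
  \sum_(k < n) `|eps (k + m) * (homog k U A B / k`!%:R)| <= ext_bound.
Proof.
move=> BU Brho.
have q0 : 0 <= 2 * C * d%:R * rho by rewrite !mulr_ge0.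
apply: (le_trans _ (ler_wpM2l _ (sqrt_exp_partial_sum n q0))); last first.
  by rewrite !mulr_ge0// exprn_ge0// mulr_ge0.
rewrite mulr_sumr ler_sum// => k _.
rewrite normrM (le_trans (ler_piMl _ (eps_le1 _)))// normrM normfV normr_nat.
have f0 : 0 < k`!%:R :> R by rewrite ltr0n fact_gt0.
rewrite ler_pdivrMr// (le_trans (ler_norm_sum _ _ _))//.
apply: le_trans (@big_words_le R d k _ xpredT (rho ^+ k * (K * C ^+ (k + j) * Num.sqrt (k + j)`!%:R)) _ _) _.
- by rewrite !mulr_ge0// exprn_ge0.
- by move=> s sk; rewrite normrM ler_pM// -sk ?wprod_le.
rewrite [X in _ <= _ * (_ / _) * X](_ : _ = Num.sqrt k`!%:R ^+ 2); last by rewrite sqr_sqrtr ?ltW.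
have s0 : Num.sqrt k`!%:R != 0 :> R by rewrite gt_eqF// sqrtr_gt0.
rewrite [leRHS](_ : _ = (K * C ^+ (k + j) * (d%:R * rho) ^+ k) *
   (2 ^+ (k + j) * Num.sqrt k`!%:R * Num.sqrt j`!%:R)); last first.
  by rewrite !exprMn !exprD; field.
rewrite [leLHS](_ : _ = (K * C ^+ (k + j) * (d%:R * rho) ^+ k) * Num.sqrt (k + j)`!%:R); last first.
  by rewrite exprMn; ring.
by rewrite ler_wpM2l ?fact_sqrt_le// !mulr_ge0// exprn_ge0// mulr_ge0.
Qed.

Lemma ext_sum_le n m U A B : jet_bound K C j U -> (forall i, `|B 0 i| <= rho) ->
  `|ext_sum n m U A B| <= ext_bound.
Proof.
by move=> BU Brho; rewrite (le_trans _ (ext_sum_abs_le n m A BU Brho))// ler_norm_sum.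
Qed.

Lemma cvg_ext_sum_rho m U A B : jet_bound K C j U -> (forall i, `|B 0 i| <= rho) ->
  (fun n => ext_sum n m U A B) @ \oo --> ext_fun m U A B.
Proof.
move=> BU Brho.
exact: (@cvg_abs_sum _ (fun k => eps (k + m) * (homog k U A B / k`!%:R)) _
  (fun n => ext_sum_abs_le n m A BU Brho)).
Qed.

Lemma ext_fun_le m U A B : jet_bound K C j U -> (forall i, `|B 0 i| <= rho) ->
  `|ext_fun m U A B| <= ext_bound.
Proof.
move=> BU Brho; have cE := cvg_ext_sum_rho (m := m) (A := A) BU Brho.
apply: (cvg_norm_bound cE) => n; exact: ext_sum_le.
Qed.

End bounds.

(** With K and j left free, this is stable under differentiation in any
    direction. *)
Definition good_jet (C : R) U : Prop :=
  sym_jet U /\ exists K j, 0 <= K /\ jet_bound K C j U.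

Section good.
Variable C : R.
Hypothesis C0 : 0 <= C.

Lemma good_shift i U : good_jet C U -> good_jet C (shift i U).
Proof.
move=> [SU [K [j [K0 BU]]]]; split; first exact: sym_jet_shift.
by exists K, j.+1; split => //; exact: jet_bound_shift.
Qed.

Lemma good_dirjet a U : good_jet C U -> good_jet C (dirjet a U).
Proof.
move=> [SU [K [j [K0 BU]]]]; split; first exact: sym_jet_dirjet.
exists ((\sum_l `|a 0 l|) * K), j.+1; split; first by rewrite mulr_ge0// sumr_ge0.
exact: jet_bound_dirjet.
Qed.

Lemma cvg_ext_sum m U A B : good_jet C U ->
  (fun n => ext_sum n m U A B) @ \oo --> ext_fun m U A B.
Proof.
move=> [_ [K [j [K0 BU]]]].
exact: (cvg_ext_sum_rho K0 C0 (normr_ge0 B) BU (coord_le_norm B)).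
Qed.

Lemma ext_fun_dirjet m U A B a : good_jet C U ->
  ext_fun m (dirjet a U) A B = \sum_i a 0 i * ext_fun m (shift i U) A B.
Proof.
move=> gU; apply: cvg_lim => //; under eq_fun do rewrite ext_sum_dirjet.
apply: cvg_sumn => i; apply: cvgMl_tmp; apply: cvg_ext_sum; exact: good_shift.
Qed.

Lemma ext_funSS m U A B : good_jet C U -> ext_fun m.+2 U A B = - ext_fun m U A B.
Proof.
move=> gU; apply: cvg_lim => //.
rewrite (_ : (fun _ => _) = (fun n => - ext_sum n m U A B)).
  by apply: cvgN; exact: cvg_ext_sum.
apply/funext => n; rewrite /ext_sum -sumrN; apply: eq_bigr => k _.
by rewrite addnS addnS epsSS mulNr.
Qed.

(** Moving B in the direction b differentiates i^m f(A + i B) in the direction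
    i b, whence the shift of m in the second term. *)
Lemma is_derive_ext_fun_line m U A B a b : good_jet C U ->
  is_derive (0 : R) 1 (fun t : R => ext_fun m U (A + t *: a) (B + t *: b))
    (ext_fun m (dirjet a U) A B + ext_fun m.+1 (dirjet b U) A B).
Proof.
move=> gU.
pose F n (t : R) := ext_sum n m U (A + t *: a) (B + t *: b).
pose F1 n (t : R) := ext_sum n m (dirjet a U) (A + t *: a) (B + t *: b) +
  ext_sum n.-1 m.+1 (dirjet b U) (A + t *: a) (B + t *: b).
pose F2 n (t : R) := (ext_sum n m (dirjet a (dirjet a U)) (A + t *: a) (B + t *: b) +
  ext_sum n.-1 m.+1 (dirjet b (dirjet a U)) (A + t *: a) (B + t *: b)) +
  (ext_sum n.-1 m.+1 (dirjet a (dirjet b U)) (A + t *: a) (B + t *: b) +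
  ext_sum n.-2 m.+2 (dirjet b (dirjet b U)) (A + t *: a) (B + t *: b)).
have ga := good_dirjet a gU; have gb := good_dirjet b gU.
have dF n (t : R) : is_derive t 1 (F n) (F1 n t).
  by apply: is_derive_ext_sum; case: gU.
have dF1 n (t : R) : is_derive t 1 (F1 n) (F2 n t).
  by apply: is_deriveD; apply: is_derive_ext_sum; [case: ga|case: gb].
have bnd V : good_jet C V -> exists2 M, 0 <= M & forall n p (t : R), `|t| <= 1 ->
    `|ext_sum n p V (A + t *: a) (B + t *: b)| <= M.
  move=> [_ [K [j [K0 BV]]]].
  have r0 : 0 <= `|B| + `|b| by rewrite addr_ge0.
  exists (ext_bound K C (`|B| + `|b|) j).
    by rewrite /ext_bound !mulr_ge0// ?exprn_ge0 ?mulr_ge0// addr_ge0// expR_ge0.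
  move=> n p t t1; apply: ext_sum_le => // i; rewrite !mxE.
  rewrite (le_trans (ler_normD _ _))// lerD ?coord_le_norm// normrM.
  by rewrite (le_trans (ler_piMl _ t1))// coord_le_norm.
have [M1 M10 H1] := bnd _ (good_dirjet a ga).
have [M2 M20 H2] := bnd _ (good_dirjet b ga).
have [M3 M30 H3] := bnd _ (good_dirjet a gb).
have [M4 M40 H4] := bnd _ (good_dirjet b gb).
have F2M n (t : R) : `|t| <= 1 -> `|F2 n t| <= (M1 + M2) + (M3 + M4).
  move=> t1; rewrite /F2 (le_trans (ler_normD _ _))// lerD//.
    by rewrite (le_trans (ler_normD _ _))// lerD ?H1 ?H2.
  by rewrite (le_trans (ler_normD _ _))// lerD ?H3 ?H4.
have FG (t : R) : (fun n => F n t) @ \oo --> ext_fun m U (A + t *: a) (B + t *: b).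
  exact: cvg_ext_sum.
have F1L : (fun n => F1 n 0) @ \oo --> ext_fun m (dirjet a U) A B + ext_fun m.+1 (dirjet b U) A B.
  rewrite /F1; under eq_fun do rewrite !scale0r !addr0.
  apply: cvgD; first exact: cvg_ext_sum.
  rewrite -(cvg_shiftS (fun n => ext_sum n.-1 m.+1 (dirjet b U) A B)).
  exact: cvg_ext_sum.
have H := derive_limit dF dF1 F2M FG F1L.
apply: (@is_derive_quad _ _ _ _ _ _ ((M1 + M2) + (M3 + M4)) 1) => // t t1.
have := H t (ltW t1); rewrite !scale0r !addr0.
by rewrite add0r [t *: 1]mulr1.
Qed.

End good.
End continuation.

Section continuation_analytic.
Context {R : realType} {d D : nat}.
Variables (Al Bl : {linear 'rV[R]_D -> 'rV[R]_d}).
Implicit Types (U : seq 'I_d -> 'rV[R]_d -> R) (Z h : 'rV[R]_D) (w : seq 'I_D).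

Local Notation e_ l := (delta_mx 0 l : 'rV[R]_D).

Lemma is_derive_ext_fun (C : R) m U Z h : 0 <= C -> good_jet C U ->
  is_derive Z h (fun Z => ext_fun m U (Al Z) (Bl Z))
    (ext_fun m (dirjet (Al h) U) (Al Z) (Bl Z) + ext_fun m.+1 (dirjet (Bl h) U) (Al Z) (Bl Z)).
Proof.
move=> C0 gU; apply: is_derive_line0.
have := is_derive_ext_fun_line C0 m (Al Z) (Bl Z) (Al h) (Bl h) gU; congr is_derive.
by apply/funext => t; rewrite !linearD !linearZ.
Qed.

Lemma linear_coord (L : {linear 'rV[R]_D -> 'rV[R]_d}) h i :
  L h 0 i = \sum_l h 0 l * L (e_ l) 0 i.
Proof.
rewrite {1}[h]row_sum_delta linear_sum summxE; apply: eq_bigr => l _.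
by rewrite linearZ mxE.
Qed.

(** The iterated partial derivatives of Z |-> Re (i^m f(Al Z + i Bl Z)): a
    differentiation through Bl multiplies by i, that is, increments m. *)
Fixpoint ext_jet w m U Z : R :=
  if w is l :: w' then
    ext_jet w' m (dirjet (Al (e_ l)) U) Z + ext_jet w' m.+1 (dirjet (Bl (e_ l)) U) Z
  else ext_fun m U (Al Z) (Bl Z).

Lemma is_derive_ext_jet (C : R) w m U Z h : 0 <= C -> good_jet C U ->
  is_derive Z h (ext_jet w m U) (\sum_l h 0 l * ext_jet (l :: w) m U Z).
Proof.
move=> C0; elim: w m U => [|l w IH] m U gU.
  apply: is_derive_eq; first exact: (is_derive_ext_fun m Z h C0 gU).
  have E p (L : {linear 'rV[R]_D -> 'rV[R]_d}) : ext_fun p (dirjet (L h) U) (Al Z) (Bl Z) =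
      \sum_l h 0 l * ext_fun p (dirjet (L (e_ l)) U) (Al Z) (Bl Z).
    rewrite (ext_fun_dirjet C0)//; under eq_bigr do rewrite linear_coord mulr_suml.
    rewrite exchange_big/=; apply: eq_bigr => l _.
    by rewrite (ext_fun_dirjet C0)// mulr_sumr; apply: eq_bigr => i _; rewrite mulrA.
  by rewrite !E -big_split/=; apply: eq_bigr => l _; rewrite mulrDr.
have SU := gU.1.
have g1 := good_dirjet C0 (Al (e_ l)) gU; have g2 := good_dirjet C0 (Bl (e_ l)) gU.
apply: is_derive_eq; first by apply: is_deriveD; apply: IH.
rewrite -big_split/=; apply: eq_bigr => j _; rewrite -mulrDr; congr (_ * _).
by rewrite !(dirjetC _ (_ (e_ l)) SU) addrACA.
Qed.

Lemma ext_jet_le (K C rho al : R) j w m U Z : 0 <= K -> 0 <= C -> 0 <= rho -> 0 <= al ->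
  jet_bound K C j U -> (forall i, `|Bl Z 0 i| <= rho) ->
  (forall l, \sum_i `|Al (e_ l) 0 i| <= al) -> (forall l, \sum_i `|Bl (e_ l) 0 i| <= al) ->
  `|ext_jet w m U Z| <= (2 * al) ^+ size w * @ext_bound R d K C rho (size w + j).
Proof.
move=> + C0 r0 al0 + Zr Aal Bal; elim: w m U K j => [|l w IH] m U K j K0 BU.
  by rewrite expr0 mul1r; exact: ext_fun_le.
have aK0 : 0 <= al * K by exact: mulr_ge0.
rewrite /= (le_trans (ler_normD _ _))//.
apply: le_trans (lerD (IH _ _ _ _ aK0 (jet_bound_dirjet (Aal l) K0 C0 BU))
  (IH _ _ _ _ aK0 (jet_bound_dirjet (Bal l) K0 C0 BU))) _.
rewrite addSnnS le_eqVlt; apply/orP; left; apply/eqP.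
by rewrite exprS /ext_bound; ring.
Qed.

Lemma real_analytic_ext_fun (K C : R) m U : 0 <= K -> 0 < C -> sym_jet U ->
  jet_bound K C 0 U -> real_analytic (fun Z => ext_fun m U (Al Z) (Bl Z)).
Proof.
move=> K0 C0 SU BU; have gU : good_jet C U by split => //; exists K, 0%N.
apply: (@real_analytic_line_jet _ _ (fun w => ext_jet w m U)).
  by move=> w Z h; exact: is_derive_ext_jet (ltW C0) gU.
move=> Z0.
pose al : R := \sum_l (\sum_i `|Al (e_ l) 0 i| + \sum_i `|Bl (e_ l) 0 i|) + 1.
have ge0 l : 0 <= \sum_i `|Al (e_ l) 0 i| + \sum_i `|Bl (e_ l) 0 i|.
  by rewrite addr_ge0// sumr_ge0.
have al1 l : \sum_i `|Al (e_ l) 0 i| + \sum_i `|Bl (e_ l) 0 i| <= al.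
  by rewrite /al (bigD1 l)//= -addrA lerDl addr_ge0// sumr_ge0.
have al0 : 0 < al by rewrite /al ltr_wpDl// sumr_ge0.
have Aal l : \sum_i `|Al (e_ l) 0 i| <= al.
  by apply: le_trans (al1 l); rewrite lerDl sumr_ge0.
have Bal l : \sum_i `|Bl (e_ l) 0 i| <= al.
  by apply: le_trans (al1 l); rewrite lerDr sumr_ge0.
pose rho := (\sum_l (`|Z0 0 l| + 1)) * al.
have r0 : 0 <= rho by rewrite mulr_ge0 ?(ltW al0)// sumr_ge0// => l _; rewrite addr_ge0.
exists (K * (expR (2 * (2 * C * d%:R * rho) ^+ 2) + 1)), (2 * al * (2 * C)).
split; first by rewrite mulr_ge0// addr_ge0// expR_ge0.
split; first by rewrite !mulr_gt0.
move=> w Z ZZ0.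
have Zr i : `|Bl Z 0 i| <= rho.
  rewrite linear_coord (le_trans (ler_norm_sum _ _ _))// /rho mulr_suml ler_sum// => l _.
  rewrite normrM ler_pM//.
    rewrite -(subrK (Z0 0 l) (Z 0 l)) (le_trans (ler_normD _ _))// addrC lerD2l.
    exact/ltW/ZZ0.
  by apply: le_trans (Bal l); rewrite (bigD1 i)//= lerDl sumr_ge0.
apply: le_trans (ext_jet_le w m K0 (ltW C0) r0 (ltW al0) BU Zr Aal Bal) _.
rewrite addn0 /ext_bound [leRHS](_ : _ = (2 * al) ^+ size w *
  (K * (2 * C) ^+ size w * (size w)`!%:R * (expR (2 * (2 * C * d%:R * rho) ^+ 2) + 1))); last first.
  rewrite [X in _ * X * _]exprMn; move: ((2 * al) ^+ _) ((2 * C) ^+ _) (expR _) => p q e.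
  by ring.
rewrite ler_wpM2l ?exprn_ge0 ?mulr_ge0 ?(ltW al0)//.
rewrite ler_wpM2r ?addr_ge0 ?expR_ge0// ler_wpM2l ?mulr_ge0 ?exprn_ge0 ?mulr_ge0 ?(ltW C0)//.
rewrite -[leRHS]ger0_norm// -sqrtr_sqr ler_wsqrtr// -natrX ler_nat.
by rewrite -mulnn leq_pmulr// fact_gt0.
Qed.

End continuation_analytic.

(** * Growth of the extension *)
Section growth.
Context {R : realType} {d : nat}.
Implicit Types (U : seq 'I_d -> 'rV[R]_d -> R) (A B : 'rV[R]_d) (s : seq 'I_d).

Lemma mfact_wtype_cons l s : mfact (wtype (l :: s)) = ((count_mem l s).+1 * mfact (wtype s))%N.
Proof.
rewrite /mfact (bigD1 l)//= [in RHS](bigD1 l)//= !ffunE /= eqxx add1n factS -!mulnA.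
congr (_ * (_ * _))%N; apply: eq_bigr => i il.
by rewrite !ffunE /= eq_sym (negbTE il).
Qed.

Lemma mfact_wtype_le s : (mfact (wtype s) <= (size s)`!)%N.
Proof.
elim: s => [|l s IH]; first by rewrite /mfact big1// => i _; rewrite ffunE.
by rewrite mfact_wtype_cons factS leq_mul// ltnS count_size.
Qed.

(** Prolonging a word by a letter multiplies the factorial of its type by that
    letter's multiplicity plus 1, and over the d letters these factors add up
    to k + d. *)
Lemma sum_mfact_words k :
  (\sum_(s <- @words d k) mfact (wtype s) * d`! <= (k + d)`!)%N.
Proof.
elim: k => [|k IH].
  by rewrite big_seq1 /mfact big1 ?mul1n// => i _; rewrite ffunE.
rewrite /= big_allpairs_dep/= exchange_big/= big_seq.
apply: (@leq_trans (\sum_(s <- @words d k | s \in words k) (k + d) * (mfact (wtype s) * d`!))).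
  apply: leq_sum => s /size_in_words sk.
  under eq_bigr do rewrite mfact_wtype_cons -mulnA.
  rewrite -big_distrl/= leq_mul2r; apply/orP; right.
  under eq_bigr do rewrite -addn1.
  rewrite big_split/= sum1_card card_ord leq_add2r -sk -mlen_wtype /mlen.
  by apply: leq_sum => l _; rewrite ffunE.
rewrite -big_seq -big_distrr/= addSn factS.
by rewrite leq_mul.
Qed.

Lemma sum_wprod_sqr k B : \sum_(s <- words k) wprod B s ^+ 2 = sqnorm B ^+ k.
Proof.
elim: k => [|k IH]; first by rewrite big_words0 /wprod big_nil expr1n expr0.
rewrite big_wordsS exprS {1}/sqnorm mulr_suml; apply: eq_bigr => l _.
rewrite -IH mulr_sumr; apply: eq_bigr => s _.
by rewrite /wprod big_cons exprMn.
Qed.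

(** What remains is the binomial coefficient of k + d over k, and its product
    with 4^k is bounded by one term of the expansion of (4 + 1)^(k + d). *)
Lemma sum_mfact_fact k :
  (\sum_(s <- @words d k) mfact (wtype s))%:R / k`!%:R <= (5 / 4) ^+ k * 5 ^+ d :> R.
Proof.
have f0 n : 0 < n`!%:R :> R by rewrite ltr0n fact_gt0.
rewrite ler_pdivrMr// -(ler_pM2r (f0 d)) -natrM big_distrl/=.
apply: (@le_trans _ _ (k + d)`!%:R); first by rewrite ler_nat sum_mfact_words.
have -> : (k + d)`! = ('C(k + d, k) * (k`! * d`!))%N.
  by rewrite -{3}(addnK k d) (addnC d) bin_fact// leq_addr.
rewrite !natrM -mulrA ler_wpM2r ?mulr_ge0//.
rewrite exprMn exprVn mulrAC ler_pdivlMr ?exprn_gt0// -exprD -!natrX -natrM ler_nat.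
rewrite -[X in (_ <= X ^ _)%N]/(1 + 4)%N expnDn (bigD1 (inord k))//= inordK ?ltnS ?leq_addr//.
by rewrite exp1n mul1n leq_addr.
Qed.

Lemma geometric_le (x : R) n : 0 <= x < 1 -> \sum_(k < n) x ^+ k <= (1 - x)^-1.
Proof.
move=> /andP[x0 x1]; have x10 : 0 < 1 - x by rewrite subr_gt0.
rewrite -[leRHS]mul1r ler_pdivlMr// mulrC.
rewrite (_ : _ * _ = 1 - x ^+ n) ?gerBl ?exprn_ge0//.
elim: n => [|n IH]; first by rewrite big_ord0 mulr0 expr0 subrr.
by rewrite big_ord_recr mulrDr IH exprS; ring.
Qed.

Definition growth_const : R := 6 * 5 ^+ d.

(** Cauchy-Schwarz over the words of length k, as an inequality of the means with
    weights (3/2)^k and (2/3)^k: the first sum gives exp(3/2 C^2 |B|^2), the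
    second is bounded by the geometric series of ratio 2/3 * 5/4 = 5/6. Any
    exponent above C^2 |B|^2 could be reached in this way; 3/2 is small enough
    for the first implication, where 2 C^2 |B|^2 is the threshold. *)
Lemma ext_sum_growth (K C : R) n m U A B : 0 <= K -> 0 <= C ->
  (forall s A, `|U s A| <= K * C ^+ size s * Num.sqrt (mfact (wtype s))%:R) ->
  `|ext_sum n m U A B| <= K * growth_const * expR (3 / 2 * C ^+ 2 * sqnorm B).
Proof.
move=> K0 C0 UK.
have sq0 : 0 <= sqnorm B by rewrite /sqnorm sumr_ge0// => i _; rewrite sqr_ge0.
pose y := 3 / 2 * C ^+ 2 * sqnorm B.
have y0 : 0 <= y by rewrite !mulr_ge0// sqr_ge0.
have f0 k : 0 < k`!%:R :> R by rewrite ltr0n fact_gt0.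
have term k : `|eps (k + m) * (homog k U A B / k`!%:R)| <=
    K / 2 * (y ^+ k / k`!%:R + (5 / 6) ^+ k * 5 ^+ d).
  rewrite normrM (le_trans (ler_piMl _ (eps_le1 _)))// normrM normfV normr_nat.
  rewrite ler_pdivrMr// (le_trans (ler_norm_sum _ _ _))//.
  apply: (@le_trans _ _ (\sum_(s <- words k) K / 2 * ((3 / 2 * C ^+ 2) ^+ k * wprod B s ^+ 2 +
      (2 / 3) ^+ k * (mfact (wtype s))%:R))).
    rewrite big_seq [leRHS]big_seq; apply: ler_sum => s /size_in_words sk.
    rewrite normrM; apply: le_trans (ler_wpM2l (normr_ge0 _) (UK s A)) _.
    rewrite sk [leLHS](_ : _ = K * ((Num.sqrt (3 / 2) ^+ k * C ^+ k * `|wprod B s|) *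
      ((Num.sqrt (3 / 2) ^+ k)^-1 * Num.sqrt (mfact (wtype s))%:R))); last first.
      have p0 : (Num.sqrt (3 / 2) : R) ^+ k != 0.
        by rewrite expf_neq0// gt_eqF// sqrtr_gt0.
      by field.
    rewrite -[leRHS]mulrA ler_wpM2l//; apply: le_trans (amgm2 _ _) _.
    have q2 : ((Num.sqrt (3 / 2) : R) ^+ k) ^+ 2 = (3 / 2) ^+ k.
      by rewrite exprAC sqr_sqrtr// divr_ge0.
    rewrite mulrC le_eqVlt; apply/orP; left; apply/eqP; congr (_ * (_ + _)).
      rewrite [(_ * `|_|) ^+ 2]exprMn real_normK ?num_real// [(_ * _) ^+ 2]exprMn q2.
      by rewrite [X in _ = X * _]exprMn [X in _ * X * _]exprAC.
    rewrite [LHS]exprMn exprVn q2 sqr_sqrtr// -exprVn; congr (_ ^+ _ * _).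
    by field.
  rewrite -mulr_sumr big_split/= -!mulr_sumr sum_wprod_sqr -natr_sum -exprMn -/y.
  rewrite -[leRHS]mulrA ler_wpM2l ?divr_ge0// [leRHS]mulrDl divfK ?gt_eqF// lerD2l.
  rewrite -ler_pdivrMr// -mulrA.
  apply: le_trans (ler_wpM2l _ (sum_mfact_fact k)) _; first by rewrite exprn_ge0// divr_ge0.
  rewrite mulrA -exprMn le_eqVlt; apply/orP; left; apply/eqP; congr (_ ^+ _ * _).
  by field.
rewrite -/y; move: y y0 term => y y0 term.
rewrite /ext_sum (le_trans (ler_norm_sum _ _ _))//.
apply: le_trans (ler_sum _ (fun (k : 'I_n) _ => term k)) _.
rewrite -mulr_sumr big_split/= -mulr_suml -!mulrA ler_wpM2l//.
have e1 : 1 <= expR y by rewrite -expR0 ler_expR.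
apply: (@le_trans _ _ (2^-1 * (expR y + 6 * 5 ^+ d))).
  rewrite ler_wpM2l ?invr_ge0// lerD// ?exp_partial_sum//.
  rewrite ler_wpM2r ?exprn_ge0// (le_trans (geometric_le n _))//.
    by apply/andP; split; lra.
  by rewrite le_eqVlt; apply/orP; left; apply/eqP; field.
have d1 : 1 <= 5 ^+ d :> R by rewrite exprn_ege1// ler1n.
rewrite /growth_const; move: (5 ^+ d) (expR y) d1 e1 => p e p1 e1.
have := mulr_ge0 (_ : 0 <= p - 1) (_ : 0 <= e - 1); rewrite !subr_ge0 => /(_ p1 e1); nra.
Qed.

End growth.

(** * Complex-valued functions *)

Section complex_bridge.
Context {R : realType} {N : nat}.
Implicit Types (F : 'rV[R]_N -> R[i]) (s : seq 'I_N) (X : 'rV[R]_N).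

Lemma ReIm_foldr F s :
  (fun X => complex.Re (foldr (@cpartial R N) F s X)) = rjet (fun X => complex.Re (F X)) s /\
  (fun X => complex.Im (foldr (@cpartial R N) F s X)) = rjet (fun X => complex.Im (F X)) s.
Proof.
elim: s => [//|i s [IHr IHi]]; split.
  rewrite [RHS]/rjet /= -/(rjet _ s) -IHr; apply/funext => X /=.
  by rewrite /rpartial.
rewrite [RHS]/rjet /= -/(rjet _ s) -IHi; apply/funext => X /=.
by rewrite /rpartial.
Qed.

Lemma csmoothP F : csmooth F <->
  rsmooth (fun X => complex.Re (F X)) /\ rsmooth (fun X => complex.Im (F X)).
Proof.
split=> [Fs|[Fr Fi] s /=].
  split=> s; have [cr ci H] := Fs s; have [Er Ei] := ReIm_foldr F s.
    by rewrite -Er; split => // i X; have [] := H i X.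
  by rewrite -Ei; split => // i X; have [] := H i X.
have [Er Ei] := ReIm_foldr F s; have [cr dr] := Fr s; have [ci di] := Fi s.
by rewrite Er Ei; split => // i X; split => //.
Qed.

Definition mword (a : {ffun 'I_N -> nat}) : seq 'I_N :=
  flatten [seq nseq (a i) i | i <- enum 'I_N].

Lemma mpartial_mword a F : mpartial a F = foldr (@cpartial R N) F (mword a).
Proof.
rewrite /mpartial /mword; elim: (enum 'I_N) => //= i r ->.
by rewrite foldr_cat; elim: (a i) => //= k ->.
Qed.

Lemma wtype_mword a : wtype (mword a) = a.
Proof.
apply/ffunP => i; rewrite ffunE /mword count_flatten -map_comp sumnE big_map.
rewrite big_enum/= (bigD1 i)//= count_nseq /= eqxx mul1n big1 ?addn0// => j ji.
by rewrite count_nseq /= (negbTE ji).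
Qed.

Lemma perm_mword s : perm_eq s (mword (wtype s)).
Proof.
apply/allP => i _ /=; have /ffunP/(_ i) := wtype_mword (wtype s).
by rewrite !ffunE => ->.
Qed.

Lemma normc_Re (z : R[i]) : `|complex.Re z| <= Normc.normc z.
Proof. by case: z => a b /=; rewrite -sqrtr_sqr ler_wsqrtr// lerDl sqr_ge0. Qed.

Lemma normc_Im (z : R[i]) : `|complex.Im z| <= Normc.normc z.
Proof. by case: z => a b /=; rewrite -sqrtr_sqr ler_wsqrtr// lerDr sqr_ge0. Qed.

Lemma normc_le (z : R[i]) : Normc.normc z <= `|complex.Re z| + `|complex.Im z|.
Proof.
case: z => a b /=; rewrite -[leRHS]ger0_norm ?addr_ge0// -sqrtr_sqr ler_wsqrtr//.
rewrite sqrrD !real_normK ?num_real// addrAC lerDl.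
by rewrite mulrn_wge0// mulr_ge0.
Qed.

Lemma norm_lt_coord (h : 'rV[R]_N) (r : R) : 0 < r -> (forall i, `|h 0 i| < r) -> `|h| < r.
Proof.
move=> r0 hr; have [->|/eqP h0] := eqVneq h 0; first by rewrite normr0.
have [|[i j] /= E] := @mx_norm_neq0 _ _ _ h.
  by apply: contra_notN h0 => /eqP /mx_norm_eq0.
by rewrite -[`|h|]/(mx_norm h) E ord1.
Qed.

Lemma dense_bound (f : 'rV[R]_N -> R) (M : R) : continuous f ->
  (forall X (r : R), 0 < r ->
     exists2 Y : 'rV[R]_N, (forall i, `|Y 0 i - X 0 i| < r) & `|f Y| <= M) ->
  forall X, `|f X| <= M.
Proof.
move=> cf H X; rewrite leNgt; apply/negP => MX.
have e0 : 0 < `|f X| - M by rewrite subr_gt0.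
have [r r0 Hr] := continuous_dist (cf X) e0; have [Y XY fY] := H X r r0.
have := Hr (Y - X); rewrite subrKC => /(_ _)/wrap[].
  by apply: norm_lt_coord => // i; rewrite !mxE.
apply/negP; rewrite -leNgt distrC.
by rewrite (le_trans _ (lerB_dist _ _))// lerB.
Qed.

End complex_bridge.

(** * From derivative bounds to D_lambda *)

Section doubled.
Context {R : realType} {n : nat}.
Implicit Types (V X Y : 'rV[R]_(n + n)) (Z : 'rV[R]_(n + n + (n + n))) (j : 'I_n).

(** Multiplication by -i, when (x, xi) is identified with x + i xi. *)
Definition symJ V : 'rV[R]_(n + n) := row_mx (rsubmx V) (- lsubmx V).

(** The real and imaginary parts of the point of the complexified space that
    corresponds to the pair Z = (X, Y). *)
Definition midpt Z : 'rV[R]_(n + n) := 2^-1 *: (lsubmx Z + rsubmx Z).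
Definition skew Z : 'rV[R]_(n + n) := 2^-1 *: symJ (lsubmx Z - rsubmx Z).

Fact symJ_linear : linear symJ.
Proof.
move=> c U V; apply/rowP => i; rewrite !mxE.
by case: (fintype.split i) => k; rewrite !mxE; ring.
Qed.
HB.instance Definition _ := GRing.isLinear.Build R _ _ _ symJ symJ_linear.

Fact midpt_linear : linear midpt.
Proof. by move=> c U V; apply/rowP => i; rewrite !mxE; ring. Qed.
HB.instance Definition _ := GRing.isLinear.Build R _ _ _ midpt midpt_linear.

Fact skew_linear : linear skew.
Proof.
move=> c U V; apply/rowP => i; rewrite !mxE.
by case: (fintype.split i) => k; rewrite !mxE; ring.
Qed.
HB.instance Definition _ := GRing.isLinear.Build R _ _ _ skew skew_linear.

Local Notation el j := (delta_mx 0 (lshift n j) : 'rV[R]_(n + n)).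
Local Notation er j := (delta_mx 0 (rshift n j) : 'rV[R]_(n + n)).

Lemma delta_lshift m (k : 'I_m) p :
  delta_mx 0 (lshift p k) = row_mx (delta_mx 0 k) 0 :> 'rV[R]_(m + p).
Proof.
apply/rowP => i; case: (split_ordP i) => l ->; rewrite ?row_mxEl ?row_mxEr !mxE eq_shift//.
Qed.

Lemma delta_rshift m p (k : 'I_p) :
  delta_mx 0 (rshift m k) = row_mx 0 (delta_mx 0 k) :> 'rV[R]_(m + p).
Proof.
apply/rowP => i; case: (split_ordP i) => l ->; rewrite ?row_mxEl ?row_mxEr !mxE eq_shift//.
Qed.

Lemma symJ_el j : symJ (el j) = - er j.
Proof. by rewrite /symJ delta_lshift delta_rshift row_mxKl row_mxKr opp_row_mx oppr0. Qed.

Lemma symJ_er j : symJ (er j) = el j.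
Proof. by rewrite /symJ delta_lshift delta_rshift row_mxKl row_mxKr oppr0. Qed.

Lemma midpt_l (k : 'I_(n + n)) : midpt (delta_mx 0 (lshift (n + n) k)) = 2^-1 *: delta_mx 0 k.
Proof. by rewrite /midpt delta_lshift row_mxKl row_mxKr addr0. Qed.

Lemma midpt_r (k : 'I_(n + n)) : midpt (delta_mx 0 (rshift (n + n) k)) = 2^-1 *: delta_mx 0 k.
Proof. by rewrite /midpt delta_rshift row_mxKl row_mxKr add0r. Qed.

Lemma skew_l (k : 'I_(n + n)) : skew (delta_mx 0 (lshift (n + n) k)) = 2^-1 *: symJ (delta_mx 0 k).
Proof. by rewrite /skew delta_lshift row_mxKl row_mxKr subr0. Qed.

Lemma skew_r (k : 'I_(n + n)) : skew (delta_mx 0 (rshift (n + n) k)) = - 2^-1 *: symJ (delta_mx 0 k).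
Proof. by rewrite /skew delta_rshift row_mxKl row_mxKr sub0r linearN scalerN scaleNr. Qed.

Lemma midpt_diag X : midpt (row_mx X X) = X.
Proof.
by rewrite /midpt row_mxKl row_mxKr; apply/rowP => i; rewrite !mxE; field.
Qed.

Lemma skew_diag X : skew (row_mx X X) = 0.
Proof. by rewrite /skew row_mxKl row_mxKr subrr linear0 scaler0. Qed.

Lemma sqnorm_row_mx m p (a : 'rV[R]_m) (b : 'rV[R]_p) :
  sqnorm (row_mx a b) = sqnorm a + sqnorm b.
Proof.
rewrite /sqnorm big_split_ord/=; congr (_ + _); apply: eq_bigr => i _.
  by rewrite row_mxEl.
by rewrite row_mxEr.
Qed.

Lemma sqnormZ m (c : R) (a : 'rV[R]_m) : sqnorm (c *: a) = c ^+ 2 * sqnorm a.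
Proof. by rewrite /sqnorm mulr_sumr; apply: eq_bigr => i _; rewrite mxE exprMn. Qed.

Lemma sqnorm_symJ V : sqnorm (symJ V) = sqnorm V.
Proof.
rewrite sqnorm_row_mx -[V in RHS]hsubmxK sqnorm_row_mx addrC; congr (_ + _).
by rewrite -scaleN1r sqnormZ sqrrN expr1n mul1r.
Qed.

Lemma sqnorm_skew X Y : sqnorm (skew (row_mx X Y)) = sqnorm (X - Y) / 4.
Proof.
rewrite /skew row_mxKl row_mxKr sqnormZ sqnorm_symJ mulrC; congr (_ * _).
by rewrite exprVn; congr (_^-1); rewrite -natrX.
Qed.

End doubled.

Section extension_in_D.
Context {R : realType} {n : nat}.
Implicit Types (Z : 'rV[R]_(n + n + (n + n))).
Local Notation jetT := (seq 'I_(n + n) -> 'rV[R]_(n + n) -> R).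

(** The real part of i^m f(A + i B), where f has jet U, as a function of the pair
    (X, Y) that defines A and B. *)
Definition ext_pull m (U : jetT) Z : R := ext_fun m U (midpt Z) (skew Z).

Lemma ext_pull_partial (C : R) m (U : jetT) Z i k l (sg : R) : 0 <= C -> good_jet C U ->
  midpt (delta_mx 0 l) = 2^-1 *: delta_mx 0 i :> 'rV[R]_(n + n) ->
  skew (delta_mx 0 l) = sg *: delta_mx 0 k :> 'rV[R]_(n + n) ->
  is_derive Z (delta_mx 0 l) (ext_pull m U)
    (2^-1 * ext_pull m (shift i U) Z + sg * ext_pull m.+1 (shift k U) Z).
Proof.
move=> C0 gU ml sl.
have := @is_derive_ext_fun R _ _ (@midpt R n) (@skew R n) C m U Z (delta_mx 0 l) C0 gU.
have E p (c : R) (q : 'I_(n + n)) : ext_fun p (dirjet (c *: delta_mx 0 q) U) (midpt Z) (skew Z) =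
    c * ext_pull p (shift q U) Z.
  rewrite (ext_fun_dirjet C0)// (bigD1 q)//= big1 ?addr0.
    by rewrite !mxE !eqxx mulr1.
  by move=> i' iq; rewrite !mxE (negbTE iq) andbF mulr0 mul0r.
by rewrite /= ml sl !E.
Qed.

Lemma ext_pull_diag (C : R) m (U : jetT) X : 0 <= C -> good_jet C U ->
  ext_pull m U (row_mx X X) = eps m * U [::] X.
Proof.
move=> C0 gU; rewrite /ext_pull midpt_diag skew_diag.
have E p : ext_sum p.+1 m U X 0 = eps m * U [::] X.
  rewrite /ext_sum big_ord_recl big1 ?addr0.
    by rewrite add0n homog0 fact0 divr1.
  move=> k _; rewrite homogS big1 ?mul0r ?mulr0// => l _.
  by rewrite mxE mul0r.
have := cvg_ext_sum C0 (m := m) (A := X) (B := 0) gU.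
rewrite -cvg_shiftS; under eq_fun do rewrite E.
by move=> H; apply: (cvg_unique _ H) => //; exact: cvg_cst.
Qed.

(** The sum of the extension of u and of i times that of v; ext_pull 1 is minus
    the imaginary part of an extension. *)
Definition complex_ext (u v : jetT) Z : R[i] :=
  (ext_pull 0 u Z + ext_pull 1 v Z) +i* (ext_pull 0 v Z - ext_pull 1 u Z).

Lemma real_analyticD N (f g : 'rV[R]_N -> R) :
  real_analytic f -> real_analytic g -> real_analytic (fun X => f X + g X).
Proof.
move=> fa ga X; have [r [c [r0 H]]] := fa X; have [r' [c' [r'0 H']]] := ga X.
exists (Num.min r r'), (fun a => c a + c' a); split; first by rewrite lt_min r0.
move=> h hr; have [|s1 l1] := H h _; first by move=> i; have := hr i; rewrite lt_min => /andP[].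
have [|s2 l2] := H' h _; first by move=> i; have := hr i; rewrite lt_min => /andP[].
split.
  have := summableD s1 s2; congr summable; apply/funext => a.
  by rewrite /= -EFinD mulrDl.
have := cvgD l1 l2; rewrite -/(_ \o _) => L; apply: cvg_trans (L _).
apply: near_eq_cvg; near=> m; rewrite /= !fctE -big_split/=.
by apply: eq_bigr => k _; rewrite mulrDl.
Unshelve. all: by end_near. Qed.

Lemma real_analyticN N (f : 'rV[R]_N -> R) : real_analytic f -> real_analytic (fun X => - f X).
Proof.
move=> fa X; have [r [c [r0 H]]] := fa X.
exists r, (fun a => - c a); split => // h hr; have [s1 l1] := H h hr.
split.
  move: s1; rewrite summableN; congr summable; apply/funext => a.
  by rewrite /= mulNr.
have L := cvgN l1; apply: cvg_trans (L _).
apply: near_eq_cvg; near=> m; rewrite /= !fctE -sumrN.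
by apply: eq_bigr => k _; rewrite mulNr.
Unshelve. all: by end_near. Qed.

(** Along l the point A + i B moves by (e_i - i sg e_k) / 2, and along l' by
    (e_k + i sg e_i) / 2, which is i sg times as much. The sign sg is 1 in the
    variable X, where the extension is holomorphic, and -1 in Y. *)
Lemma complex_ext_CR (C : R) (u v : jetT) i k l l' Z (sg : R) : 0 <= C -> good_jet C u -> good_jet C v ->
  midpt (delta_mx 0 l) = 2^-1 *: delta_mx 0 i :> 'rV[R]_(n + n) ->
  skew (delta_mx 0 l) = - (sg / 2) *: delta_mx 0 k :> 'rV[R]_(n + n) ->
  midpt (delta_mx 0 l') = 2^-1 *: delta_mx 0 k :> 'rV[R]_(n + n) ->
  skew (delta_mx 0 l') = sg / 2 *: delta_mx 0 i :> 'rV[R]_(n + n) ->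
  sg ^+ 2 = 1 ->
  cpartial l (complex_ext u v) Z + (0 +i* sg) * cpartial l' (complex_ext u v) Z = 0.
Proof.
move=> C0 gu gv ml sl ml' sl' sg2.
have du m := ext_pull_partial m Z C0 gu ml sl; have dv m := ext_pull_partial m Z C0 gv ml sl.
have du' m := ext_pull_partial m Z C0 gu ml' sl'; have dv' m := ext_pull_partial m Z C0 gv ml' sl'.
have DR := is_deriveD (du 0%N) (dv 1%N); have DI := is_deriveB (dv 0%N) (du 1%N).
have DR' := is_deriveD (du' 0%N) (dv' 1%N); have DI' := is_deriveB (dv' 0%N) (du' 1%N).
have E2 (w : jetT) q : good_jet C w -> ext_pull 2 (shift q w) Z = - ext_pull 0 (shift q w) Z.
  by move=> gw; apply: (ext_funSS C0); exact: good_shift.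
rewrite /cpartial /complex_ext /=.
have [_ ->] := DR; have [_ ->] := DI; have [_ ->] := DR'; have [_ ->] := DI'.
rewrite !E2//; apply/eqP; rewrite eq_complex/=; apply/andP; split; apply/eqP.
  by transitivity ((1 - sg ^+ 2) * ((ext_pull 0 (shift i u) Z + ext_pull 1 (shift i v) Z) / 2));
    [ring|rewrite sg2 subrr mul0r].
by transitivity ((1 - sg ^+ 2) * ((ext_pull 0 (shift i v) Z - ext_pull 1 (shift i u) Z) / 2));
  [ring|rewrite sg2 subrr mul0r].
Qed.

Lemma mcat_split (a : {ffun 'I_(n + n) -> nat}) :
  mcat [ffun j => a (lshift n j)] [ffun j => a (rshift n j)] = a.
Proof.
apply/ffunP => i; rewrite ffunE; case: splitP => j E; rewrite ffunE;
  by congr (a _); apply: val_inj.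
Qed.

(** The extension grows like exp(3/8 C^2 |X - Y|^2), while 1 / (4 lam) exceeds
    C^2 / 2: the quotient by the allowed growth is at most a Gaussian, which is
    both integrable and bounded. *)
Lemma derivative_bounds_in_D (F : 'rV[R]_(n + n) -> R[i]) (K C lam : R) :
  csmooth F -> 0 < K -> 0 < C ->
  (forall alpha beta : {ffun 'I_n -> nat},
     (cnormLoo (mpartial (mcat alpha beta) F) <=
      (K * C ^+ mlen [ffun j => (alpha j + beta j)%N]
         * Num.sqrt ((mfact alpha)%:R * (mfact beta)%:R))%:E)%E) ->
  0 < lam -> lam < 1 / (2 * C ^+ 2) ->
  in_D lam F.
Proof.
move=> Fs K0 C0 FK lam0 lamC.
have [sr si] := (csmoothP F).1 Fs.
pose u := rjet (fun X => complex.Re (F X)); pose v := rjet (fun X => complex.Im (F X)).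
have uv s : (fun X => complex.Re (mpartial (wtype s) F X)) = u s /\
    (fun X => complex.Im (mpartial (wtype s) F X)) = v s.
  rewrite mpartial_mword; have [-> ->] := ReIm_foldr F (mword (wtype s)).
  by split; apply: rjet_perm => //; rewrite perm_sym perm_mword.
have bnd s : (forall X, `|u s X| <= K * C ^+ size s * Num.sqrt (mfact (wtype s))%:R) /\
    (forall X, `|v s X| <= K * C ^+ size s * Num.sqrt (mfact (wtype s))%:R).
  have := FK [ffun j => wtype s (lshift n j)] [ffun j => wtype s (rshift n j)].
  rewrite mcat_split; set M := (X in (_ <= X%:E)%E).
  have -> : M = K * C ^+ size s * Num.sqrt (mfact (wtype s))%:R.
    rewrite /M -(mlen_wtype s) /mlen /mfact -natrM; congr (_ * _ ^+ _ * Num.sqrt _%:R).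
      rewrite [in RHS]big_split_ord/= -big_split/=; apply: eq_bigr => j _.
      by rewrite !ffunE.
    rewrite [in RHS]big_split_ord/=.
    by congr (_ * _)%N; apply: eq_bigr => j _; rewrite ffunE.
  move: (_ * _ * _) => {}M /normL_oo_dense H; have [<- <-] := uv s.
  have [Er Ei] := uv s; split; apply: dense_bound.
  - by rewrite Er; case: (sr s).
  - move=> X r r0; have [Y XY] := H X r r0.
    rewrite /= lee_fin ger0_norm; last exact: le_trans (normc_Re _).
    by move=> YM; exists Y => //; exact: le_trans (normc_Re _) YM.
  - by rewrite Ei; case: (si s).
  - move=> X r r0; have [Y XY] := H X r r0.
    rewrite /= lee_fin ger0_norm; last exact: le_trans (normc_Re _).
    by move=> YM; exists Y => //; exact: le_trans (normc_Im _) YM.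
have toB (w : jetT) : (forall s X, `|w s X| <= K * C ^+ size s * Num.sqrt (mfact (wtype s))%:R) ->
    jet_bound K C 0 w.
  move=> H s X; rewrite !addn0 (le_trans (H s X))// ler_wpM2l//.
    by rewrite mulr_ge0 ?(ltW K0)// exprn_ge0// ltW.
  by rewrite ler_wsqrtr// ler_nat mfact_wtype_le.
have ub := toB u (fun s => (bnd s).1); have vb := toB v (fun s => (bnd s).2).
have su := rjet_sym sr; have sv := rjet_sym si.
have gu : good_jet C u by split => //; exists K, 0%N; split => //; exact: ltW.
have gv : good_jet C v by split => //; exists K, 0%N; split => //; exact: ltW.
have an m w : sym_jet w -> jet_bound K C 0 w -> real_analytic (ext_pull m w).
  by move=> sw bw; exact: (real_analytic_ext_fun (@midpt R n) (@skew R n) m (ltW K0) C0 sw bw).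
pose del := 1 / (4 * lam) - 3 / 8 * C ^+ 2.
have del0 : 0 < del.
  move: lamC; rewrite ltr_pdivlMr ?mulr_gt0 ?exprn_gt0// => lamC.
  rewrite subr_gt0 ltr_pdivlMr ?mulr_gt0//; lra.
exists (complex_ext u v); split.
- split; first by apply: real_analyticD; exact: an.
  by apply: real_analyticD; [|apply: real_analyticN]; exact: an.
- move=> j Z; split.
    apply: (@complex_ext_CR C u v (lshift n j) (rshift n j) _ _ _ 1 (ltW C0) gu gv) => //.
    + exact: midpt_l.
    + by rewrite /ix skew_l symJ_el scalerN scaleNr mul1r.
    + exact: midpt_l.
    + by rewrite /ixi skew_l symJ_er mul1r.
    + by rewrite expr1n.
  have := @complex_ext_CR C u v (lshift n j) (rshift n j) (iy j) (ieta j) Z (-1) (ltW C0) gu gv.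
  rewrite /iy /ieta !midpt_r !skew_r symJ_el symJ_er mulN1r opprK scalerN scaleNr opprK sqrrN expr1n.
  move=> /(_ erefl erefl erefl erefl erefl).
  have -> : (0 +i* (-1) : R[i]) = - (0 +i* 1) by apply/eqP; rewrite eq_complex/= oppr0 !eqxx.
  by rewrite mulNr.
- move=> X; rewrite /complex_ext !(ext_pull_diag _ _ (ltW C0))// /eps /= expr0 !mul1r !mul0r addr0 subr0.
  by rewrite /u /v /=; case: (F X).
- pose K' := 4 * (K * @growth_const R (n + n)).
  have gc0 : 0 <= K * @growth_const R (n + n) by rewrite mulr_ge0 ?(ltW K0)// /growth_const mulr_ge0// exprn_ge0.
  have K'0 : 0 <= K' by rewrite mulr_ge0.
  have [i1 ioo] := gauss_inL del0 (n + n) K'0.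
  exists (fun V => K' * gauss del V); split => // X Y.
  pose e := K * @growth_const R (n + n) * expR (3 / 8 * C ^+ 2 * sqnorm (X - Y)).
  have Eb m w : good_jet C w ->
      (forall s X, `|w s X| <= K * C ^+ size s * Num.sqrt (mfact (wtype s))%:R) ->
      `|ext_pull m w (row_mx X Y)| <= e.
    move=> gw wb; have cE := cvg_ext_sum (ltW C0) (m := m) (A := midpt (row_mx X Y))
      (B := skew (row_mx X Y)) gw.
    apply: (cvg_norm_bound cE) => N.
    apply: le_trans (ext_sum_growth N m _ _ (ltW K0) (ltW C0) wb) _.
    rewrite sqnorm_skew /e le_eqVlt; apply/orP; left; apply/eqP.
    by congr (_ * expR _); field.
  have -> : expR (sqnorm (X - Y) / (4 * lam)) * (K' * gauss del (X - Y)) = 4 * e.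
    have -> : sqnorm (X - Y) / (4 * lam) =
        3 / 8 * C ^+ 2 * sqnorm (X - Y) + del * sqnorm (X - Y).
      by rewrite /del; field; rewrite gt_eqF.
    rewrite expRD /gauss /K' /e -[RHS]mulr1 -(expRxMexpNx_1 (del * sqnorm (X - Y))).
    ring.
  rewrite (le_trans (normc_le _))//= [leRHS](_ : _ = (e + e) + (e + e)); last by ring.
  have ub' s := (bnd s).1; have vb' s := (bnd s).2.
  by apply: lerD; rewrite (le_trans (ler_normD _ _))// ?normrN lerD// Eb.
Qed.

End extension_in_D.

(** * Gradient estimate for harmonic functions *)

Section maximum_principle.
Context {R : realType}.

Lemma second_derivative_test (g g1 g2 : R -> R) (a b x0 : R) :
  (forall x : R, is_derive x 1 g (g1 x)) -> (forall x : R, is_derive x 1 g1 (g2 x)) ->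
  a < x0 < b -> (forall x, a < x < b -> g x <= g x0) -> g2 x0 <= 0.
Proof.
move=> dg dg1 /andP[ax xb] gmax; rewrite leNgt; apply/negP => g20.
have g10 : g1 x0 = 0.
  have ab : a <= b by rewrite ltW// (lt_trans ax).
  have [_ <-] : is_derive x0 1 g 0.
    apply: (@derive1_at_max _ g a b x0 ab).
    - by move=> t _; have [] := dg t.
    - by rewrite in_itv/= ax.
    - by move=> t; rewrite in_itv/=; exact: gmax.
  by have [_ ->] := dg x0.
have [/cvg_ex[l gl]] := dg1 x0; rewrite /derive (cvg_lim _ gl)// => lE.
have l0 : 0 < l by rewrite lE.
have /cvgrPdist_lt /(_ _ l0) := gl.
rewrite -nbhs_nearE => /nbhs_ballP[r /= r0 Hr].
pose h := Num.min (r / 2) ((b - x0) / 2).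
have h0 : 0 < h by rewrite lt_min !divr_gt0// subr_gt0.
have hb : x0 + h < b.
  have : h <= (b - x0) / 2 by rewrite ge_min lexx orbT.
  by move=> hb; lra.
have g1pos c : x0 < c < x0 + h -> 0 < g1 c.
  move=> /andP[xc ch].
  have k0 : 0 < c - x0 by rewrite subr_gt0.
  have kr : c - x0 < r.
    have : h <= r / 2 by rewrite ge_min lexx.
    by move=> hr; lra.
  have := Hr (c - x0); rewrite /ball/= sub0r normrN gtr0_norm// => /(_ kr).
  move=> /(_ (lt0r_neq0 k0)).
  rewrite [_ *: 1]mulr1 subrK g10 subr0 => /ltr_distlBl.
  rewrite subrr /GRing.scale/= pmulr_rgt0// invr_gt0//.
have cg : {within `[x0, x0 + h], continuous g}.
  by apply: derivable_within_continuous => x _; case: (dg x).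
have xh : x0 < x0 + h by rewrite ltrDl.
have [c] := MVT xh (fun x _ => dg x) cg; rewrite in_itv/= => cx E.
have : g (x0 + h) <= g x0 by rewrite gmax// hb andbT (lt_trans ax)// ltrDl.
rewrite -subr_le0 E addrAC subrr add0r pmulr_lle0// leNgt.
by rewrite g1pos.
Qed.

Record harmonic2 (u ux uxx uy uyy : R -> R -> R) : Prop := Harmonic2 {
  h2_x : forall x y : R, is_derive x 1 (u ^~ y) (ux x y);
  h2_xx : forall x y : R, is_derive x 1 (ux ^~ y) (uxx x y);
  h2_y : forall x y : R, is_derive y 1 (u x) (uy x y);
  h2_yy : forall x y : R, is_derive y 1 (uy x) (uyy x y);
  h2_lap : forall x y, uxx x y + uyy x y = 0;
  h2_cont : continuous (fun p : R * R => u p.1 p.2) }.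

(** Comparison on a half square with the harmonic function
    M (y^2 + x (2 d - x)) / d^2, which dominates M on three sides and is
    nonnegative on the fourth one, where v vanishes. *)
Lemma half_square_comparison v vx vxx vy vyy (M d : R) :
  harmonic2 v vx vxx vy vyy -> 0 < d -> 0 <= M ->
  (forall y, v 0 y = 0) ->
  (forall x y, 0 <= x <= d -> - d <= y <= d -> v x y <= M) ->
  forall x, 0 <= x <= d -> v x 0 <= 2 * M / d * x.
Proof.
move=> [vX vXX vY vYY lap cv] d0 M0 v0 vM x xd.
suff H : forall e, 0 < e -> v x 0 - M / d ^+ 2 * (x * (2 * d - x)) <= e * d ^+ 2.
  have : v x 0 - M / d ^+ 2 * (x * (2 * d - x)) <= 0.
    rewrite leNgt; apply/negP => t0; set t := (X in 0 < X) in t0.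
    have := H (t / (2 * d ^+ 2)); rewrite divr_gt0 ?mulr_gt0 ?exprn_gt0// => /(_ isT).
    rewrite -/t (_ : t / (2 * d ^+ 2) * d ^+ 2 = t / 2); last by field; rewrite gt_eqF.
    by move=> tt; lra.
  rewrite subr_le0 => /le_trans; apply.
  rewrite (_ : _ / d * x = M / d ^+ 2 * (x * (2 * d))); last by field; rewrite gt_eqF.
  by rewrite ler_wpM2l ?divr_ge0 ?exprn_ge0 ?(ltW d0)//; case/andP: xd => x0 _; nra.
move=> e e0.
(* The term e x^2 makes the Laplacian positive, so w has no interior maximum. *)
pose w x y := v x y - M / d ^+ 2 * (y ^+ 2 + x * (2 * d - x)) + e * x ^+ 2.
pose A : set (R * R) := `[0, d] `*` `[- d, d].
have cw : {within A, continuous (fun p : R * R => w p.1 p.2)}.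
  apply: continuous_subspaceT => p; rewrite /w.
  have cx : {for p, continuous (fun p : R * R => p.1)} by exact: cvg_fst.
  have cy : {for p, continuous (fun p : R * R => p.2)} by exact: cvg_snd.
  apply: cvgD; first apply: cvgB; first exact: cv.
    apply: cvgMl_tmp; apply: cvgD; first by rewrite /=; apply: cvgM; exact: cy.
    by apply: cvgM; [exact: cx|apply: cvgB; [exact: cvg_cst|exact: cx]].
  by apply: cvgMl_tmp; apply: cvgM; exact: cx.
have A0 : A !=set0 by exists (0, 0); split; rewrite /= in_itv/= ?lexx ?oppr_le0 ?(ltW d0).
have cA : compact A by apply: compact_setX; exact: segment_compact.
have [[x0 y0]] := compact_EVT_max A0 cA cw.
rewrite inE => -[]; rewrite /= !in_itv/= => /andP[x00 x0d] /andP[y0d y0d'] wmax.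
have {}wmax a b : 0 <= a <= d -> - d <= b <= d -> w a b <= w x0 y0.
  by move=> ad bd; apply: (wmax (a, b)); rewrite inE; split; rewrite /= in_itv.
have wb : w x0 y0 <= e * d ^+ 2.
  have Md0 : 0 <= M / d ^+ 2 by rewrite divr_ge0// exprn_ge0// ltW.
  have ed a : 0 <= a <= d -> e * a ^+ 2 <= e * d ^+ 2.
    by move=> /andP[a0 ad]; rewrite ler_wpM2l ?(ltW e0)// lerXn2r ?nnegrE ?(ltW d0).
  have MM : M = M / d ^+ 2 * d ^+ 2 by field; rewrite gt_eqF.
  have [x0E|x0n] := eqVneq x0 0.
    rewrite /w x0E v0 expr0n/= mul0r mulr0 !addr0 sub0r (@le_trans _ _ 0)//.
      by rewrite oppr_le0 mulr_ge0// sqr_ge0.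
    by rewrite mulr_ge0 ?(ltW e0)// sqr_ge0.
  have bdry : d ^+ 2 <= y0 ^+ 2 + x0 * (2 * d - x0) -> w x0 y0 <= e * d ^+ 2.
    move=> H; rewrite /w -[leRHS]add0r lerD//; last by rewrite ed// x00.
    rewrite subr_le0 (le_trans (vM x0 y0 _ _)) ?x00 ?y0d//.
    by rewrite {1}MM ler_wpM2l.
  have [x0E|x0dn] := eqVneq x0 d; first by apply: bdry; rewrite x0E; nra.
  have [y0E|y0n] := eqVneq y0 d; first by apply: bdry; rewrite y0E lerDl mulr_ge0//; lra.
  have [y0E|y0n'] := eqVneq y0 (- d).
    by apply: bdry; rewrite y0E sqrrN lerDl mulr_ge0//; lra.
  exfalso.
  have x01 : 0 < x0 < d by rewrite !lt_def x0n x00 eq_sym x0dn.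
  have y01 : - d < y0 < d by rewrite !lt_def y0n' y0d eq_sym y0n.
  have wx (a : R) : is_derive a 1 (w ^~ y0) (vx a y0 - M / d ^+ 2 * (2 * d - 2 * a) + e * (2 * a)).
    have := vX a y0 => va; rewrite /w; apply: is_derive_eq; rewrite /GRing.scale/=; ring.
  have wxx (a : R) : is_derive a 1 (fun a => vx a y0 - M / d ^+ 2 * (2 * d - 2 * a) + e * (2 * a))
     (vxx a y0 + M / d ^+ 2 * 2 + e * 2).
    have := vXX a y0 => va; apply: is_derive_eq; rewrite /GRing.scale/=; ring.
  have wy (b : R) : is_derive b 1 (w x0) (vy x0 b - M / d ^+ 2 * (2 * b)).
    have := vY x0 b => vb; rewrite /w; apply: is_derive_eq; rewrite /GRing.scale/=; ring.
  have wyy (b : R) : is_derive b 1 (fun b => vy x0 b - M / d ^+ 2 * (2 * b)) (vyy x0 b - M / d ^+ 2 * 2).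
    have := vYY x0 b => vb; apply: is_derive_eq; rewrite /GRing.scale/=; ring.
  have := second_derivative_test wx wxx x01; have := second_derivative_test wy wyy y01.
  move=> /(_ _)/wrap[b /andP[b1 b2]|].
    by apply: wmax; rewrite ?x00// !ltW.
  move=> H1 /(_ _)/wrap[b /andP[b1 b2]|H2].
    by apply: wmax; rewrite ?y0d// !ltW.
  have := lap x0 y0; lra.
have := wmax x 0; rewrite xd oppr_le0 (ltW d0) => /(_ isT isT)/le_trans/(_ wb).
rewrite /w expr0n/= add0r; apply: le_trans.
by rewrite lerDl mulr_ge0 ?(ltW e0)// sqr_ge0.
Qed.

Lemma harmonic2_odd u ux uxx uy uyy : harmonic2 u ux uxx uy uyy ->
  harmonic2 (fun x y => (u x y - u (- x) y) / 2) (fun x y => (ux x y + ux (- x) y) / 2)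
    (fun x y => (uxx x y - uxx (- x) y) / 2) (fun x y => (uy x y - uy (- x) y) / 2)
    (fun x y => (uyy x y - uyy (- x) y) / 2).
Proof.
have opp (g : R -> R) (x dg : R) : is_derive (- x) 1 g dg ->
    is_derive x 1 (fun x => g (- x)) (- dg).
  move=> dg'; have dN : is_derive x 1 (-%R : R -> R) (- 1) by exact: is_deriveNid.
  have := @is_derive1_comp _ g (-%R) x _ _ dg' dN.
  by rewrite mulrN1.
move=> [uX uXX uY uYY lap cu]; split.
- move=> x y; have d1 := uX x y; have d2 := opp _ _ _ (uX (- x) y).
  by apply: is_derive_eq; rewrite /GRing.scale/=; ring.
- move=> x y; have d1 := uXX x y; have d2 := opp _ _ _ (uXX (- x) y).
  by apply: is_derive_eq; rewrite /GRing.scale/=; ring.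
- move=> x y; have d1 := uY x y; have d2 := uY (- x) y.
  by apply: is_derive_eq; rewrite /GRing.scale/=; ring.
- move=> x y; have d1 := uYY x y; have d2 := uYY (- x) y.
  by apply: is_derive_eq; rewrite /GRing.scale/=; ring.
- by move=> x y; have := lap x y; have := lap (- x) y; lra.
- move=> p.
  apply: (@cvgMr_tmp R _ (nbhs p) _ (fun p : R * R => u p.1 p.2 - u (- p.1) p.2) _ 2^-1).
  have cx : {for p, continuous (fun p : R * R => (- p.1, p.2))}.
    have c1 : (fun p : R * R => - p.1) @ nbhs p --> - p.1.
      exact: (@cvgN R R _ (nbhs p) _ _ _ (@cvg_fst _ _ _ _ _)).
    exact: (cvg_pair c1 (@cvg_snd _ _ _ _ _)).
  have c2 := @continuous_comp _ _ _ (fun p : R * R => (- p.1, p.2))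
    (fun p : R * R => u p.1 p.2) p cx (cu _).
  exact: (@cvgB _ _ _ (nbhs p) _ _ _ _ _ (cu p) c2).
Qed.

Lemma harmonic2N u ux uxx uy uyy : harmonic2 u ux uxx uy uyy ->
  harmonic2 (fun x y => - u x y) (fun x y => - ux x y) (fun x y => - uxx x y)
    (fun x y => - uy x y) (fun x y => - uyy x y).
Proof.
move=> [uX uXX uY uYY lap cu]; split.
- by move=> x y; have d1 := uX x y; exact: is_deriveN.
- by move=> x y; have d1 := uXX x y; exact: is_deriveN.
- by move=> x y; have d1 := uY x y; exact: is_deriveN.
- by move=> x y; have d1 := uYY x y; exact: is_deriveN.
- by move=> x y; rewrite -opprD lap oppr0.
- by move=> p; apply: cvgN; exact: cu.
Qed.

(** The odd part of u in x vanishes on the axis x = 0, so the comparison bounds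
    its slope there, and this slope is that of u. *)
Lemma gradient_estimate u ux uxx uy uyy (M d : R) :
  harmonic2 u ux uxx uy uyy -> 0 < d ->
  (forall x y, `|x| <= d -> `|y| <= d -> `|u x y| <= M) ->
  `|ux 0 0| <= 2 * M / d.
Proof.
suff half w wx wxx wy wyy : harmonic2 w wx wxx wy wyy -> 0 < d ->
    (forall x y, `|x| <= d -> `|y| <= d -> `|w x y| <= M) -> wx 0 0 <= 2 * M / d.
  move=> hu d0 uM; rewrite ler_norml (half _ _ _ _ _ hu)// andbT lerNl.
  apply: (half _ _ _ _ _ (harmonic2N hu)) => // x y xd yd.
  by rewrite normrN uM.
move=> hw d0 wM; have ho := harmonic2_odd hw.
have M0 : 0 <= M by rewrite (le_trans _ (wM 0 0 _ _)) ?normr0 ?(ltW d0).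
have cmp := half_square_comparison ho d0 M0.
have {}cmp x : 0 <= x <= d -> (w x 0 - w (- x) 0) / 2 <= 2 * M / d * x.
  apply: cmp => [y|a b /andP[a0 ad] bd]; first by rewrite oppr0 subrr mul0r.
  have aN : `|a| <= d by rewrite ger0_norm.
  have bN : `|b| <= d by rewrite ler_norml.
  have := wM a b aN bN; have := wM (- a) b; rewrite normrN => /(_ aN bN).
  by rewrite !ler_norml => /andP[? ?] /andP[? ?]; lra.
rewrite leNgt; apply/negP => gt.
pose e := wx 0 0 - 2 * M / d; have e0 : 0 < e by rewrite subr_gt0.
have E : (wx 0 0 + wx (- 0) 0) / 2 = wx 0 0 by rewrite oppr0; field.
have := h2_x ho 0 0; rewrite E => -[/cvg_ex[l gl]].
rewrite /derive (cvg_lim _ gl)// => lE.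
move/cvgrPdist_lt : gl => /(_ _ e0).
rewrite -nbhs_nearE => /nbhs_ballP[r /= r0 Hr].
pose h := Num.min (r / 2) d.
have h0 : 0 < h by rewrite lt_min d0 divr_gt0.
have hd : 0 <= h <= d by rewrite (ltW h0) ge_min lexx orbT.
have hr : h < r.
  have : h <= r / 2 by rewrite ge_min lexx.
  by move=> ?; lra.
have := Hr h; rewrite /ball/= sub0r normrN gtr0_norm// => /(_ hr (lt0r_neq0 h0)).
rewrite lE [_ *: 1]mulr1 addr0 oppr0 subrr mul0r subr0 => /ltr_distlBl.
rewrite /e opprB addrC subrK /GRing.scale/= ltNge mulrC ler_pdivrMr// cmp//.
Qed.

End maximum_principle.

(** * Iterated gradient estimates *)

Section directional_words.
Context {R : realType} {N d : nat}.
Implicit Types (U : seq 'I_N -> 'rV[R]_N -> R) (Z : 'rV[R]_N) (s : seq 'I_d).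
Variables (al be : 'I_d -> 'rV[R]_N).

Definition cont_jet U : Prop := forall w, continuous (U w).

Lemma cont_dirjet a U : cont_jet U -> cont_jet (dirjet a U).
Proof.
move=> cU w; rewrite /dirjet; elim: (index_enum _) => [|l r IH].
  by under eq_fun do rewrite big_nil; exact: cst_continuous.
under eq_fun do rewrite big_cons; move=> Z.
exact: (@cvgD _ _ _ (nbhs Z) _ _ _ _ _
  (@cvgMl_tmp R _ (nbhs Z) _ (U (l :: w)) _ _ (cU (l :: w) Z)) (IH Z)).
Qed.

Definition worddir s U : seq 'I_N -> 'rV[R]_N -> R := foldr (fun l => dirjet (al l)) U s.

Lemma worddir_sym s U : sym_jet U -> sym_jet (worddir s U).
Proof. by move=> SU; elim: s => //= l s; exact: sym_jet_dirjet. Qed.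

Lemma worddir_cont s U : cont_jet U -> cont_jet (worddir s U).
Proof. by move=> SU; elim: s => //= l s; exact: cont_dirjet. Qed.

Definition harmonic_jet U : Prop := forall l w Z,
  dirjet (al l) (dirjet (al l) U) w Z + dirjet (be l) (dirjet (be l) U) w Z = 0.

Lemma dirjetD a U V w Z :
  dirjet a (fun w Z => U w Z + V w Z) w Z = dirjet a U w Z + dirjet a V w Z.
Proof. by rewrite /dirjet -big_split/=; apply: eq_bigr => l _; rewrite mulrDr. Qed.

Lemma harmonic_dirjet a U : sym_jet U -> harmonic_jet U -> harmonic_jet (dirjet a U).
Proof.
move=> SU hU l w Z; have Sa v := sym_jet_dirjet v SU.
rewrite (dirjetC (al l) a)// (dirjetC (al l) a)// (dirjetC (be l) a)// (dirjetC (be l) a)//.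
rewrite -dirjetD /dirjet big1// => i _; rewrite -/(dirjet _ _ _ _).
by rewrite hU mulr0.
Qed.

Lemma worddir_harmonic s U : sym_jet U -> harmonic_jet U -> harmonic_jet (worddir s U).
Proof.
move=> SU hU; elim: s => //= l s IH; apply: harmonic_dirjet => //.
exact: worddir_sym.
Qed.

(** The gradient estimate in the plane through Z spanned by al l and be l. *)
Lemma plane_gradient_estimate U l Z (M r : R) :
  sym_jet U -> cont_jet U -> harmonic_jet U -> 0 < r ->
  (forall x y : R, `|x| <= r -> `|y| <= r -> `|U [::] (Z + x *: al l + y *: be l)| <= M) ->
  `|dirjet (al l) U [::] Z| <= 2 * M / r.
Proof.
move=> SU cU hU r0 UM.
pose pt (x y : R) := Z + x *: al l + y *: be l.
have dx V (x y : R) : sym_jet V ->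
    is_derive x 1 (fun x => V [::] (pt x y)) (dirjet (al l) V [::] (pt x y)).
  move=> [JV _]; have := is_derive_line (JV [::] (Z + y *: be l + x *: al l) (al l)).
  rewrite /pt (addrAC Z); congr is_derive.
  by apply/funext => u; rewrite addrAC.
have dy V (x y : R) : sym_jet V ->
    is_derive y 1 (fun y => V [::] (pt x y)) (dirjet (be l) V [::] (pt x y)).
  by move=> [JV _]; exact: is_derive_line (JV [::] (pt x y) (be l)).
have h : harmonic2 (fun x y => U [::] (pt x y))
   (fun x y => dirjet (al l) U [::] (pt x y))
   (fun x y => dirjet (al l) (dirjet (al l) U) [::] (pt x y))
   (fun x y => dirjet (be l) U [::] (pt x y))
   (fun x y => dirjet (be l) (dirjet (be l) U) [::] (pt x y)).
  split=> [x y|x y|x y|x y|x y|].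
  - exact: dx.
  - by apply: dx; exact: sym_jet_dirjet.
  - exact: dy.
  - by apply: dy; exact: sym_jet_dirjet.
  - exact: hU.
  - move=> p; have c1 : (fun p : R * R => pt p.1 p.2) @ nbhs p --> pt p.1 p.2.
      apply: cvgD; first apply: cvgD; first exact: cvg_cst.
        by apply: cvgZr_tmp; exact: cvg_fst.
      by apply: cvgZr_tmp; exact: cvg_snd.
    exact: (@continuous_comp _ _ _ (fun p : R * R => pt p.1 p.2) (U [::]) p c1 (cU _ _)).
have := gradient_estimate h r0 UM.
by rewrite /pt !scale0r !addr0.
Qed.

(** A differentiation in the direction al l costs a square of half side rho l in
    the plane of al l and be l. Counting the letters of the word separately for
    each l, rather than taking a ball around Z, is what leads to a product of
    factorials instead of the factorial of the length. *)
Lemma worddir_bound (rho : 'I_d -> R) s U : (forall l, 0 < rho l) ->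
  sym_jet U -> cont_jet U -> harmonic_jet U ->
  forall Z (M : R),
  (forall a b : 'I_d -> R, (forall l, `|a l| <= (count_mem l s)%:R * rho l) ->
     (forall l, `|b l| <= (count_mem l s)%:R * rho l) ->
     `|U [::] (Z + \sum_l (a l *: al l + b l *: be l))| <= M) ->
  `|worddir s U [::] Z| <= \prod_(l <- s) (2 / rho l) * M.
Proof.
move=> rho0 SU cU hU; elim: s => [|j s IH] Z M UM.
  rewrite big_nil mul1r; have := UM (fun=> 0) (fun=> 0).
  rewrite big1 ?addr0; last by move=> l _; rewrite !scale0r addr0.
  by apply => l; rewrite normr0 mul0r.
have cs : cont_jet (worddir s U) by exact: worddir_cont.
have hs : harmonic_jet (worddir s U) by exact: worddir_harmonic.
have := @plane_gradient_estimate (worddir s U) j Z (\prod_(l <- s) (2 / rho l) * M) (rho j)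
  (worddir_sym s SU) cs hs (rho0 j).
rewrite big_cons (_ : 2 / rho j * _ * M = 2 * (\prod_(l <- s) (2 / rho l) * M) / rho j); last by ring.
apply=> x y xr yr; apply: IH => a b ar br.
have := UM (fun l => a l + (l == j)%:R * x) (fun l => b l + (l == j)%:R * y).
have -> : Z + \sum_l ((a l + (l == j)%:R * x) *: al l + (b l + (l == j)%:R * y) *: be l) =
    Z + x *: al j + y *: be j + \sum_l (a l *: al l + b l *: be l).
  rewrite -!addrA; congr (_ + _); rewrite addrA.
  under eq_bigr do rewrite !scalerDl addrACA addrC.
  rewrite big_split/=; congr (_ + _).
  rewrite (bigD1 j)//= eqxx !mul1r big1 ?addr0// => l lj.
  by rewrite (negbTE lj) !mul0r !scale0r addr0.
have step (c : 'I_d -> R) (z : R) : `|z| <= rho j ->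
    (forall l, `|c l| <= (count_mem l s)%:R * rho l) ->
    forall l, `|c l + (l == j)%:R * z| <= (count_mem l (j :: s))%:R * rho l.
  move=> zr cr l; rewrite /= natrD mulrDl addrC (le_trans (ler_normD _ _))// lerD//.
  rewrite eq_sym normrM normr_nat; case: eqP => [<-|_]; last by rewrite !mul0r.
  by rewrite !mul1r.
by apply; exact: step.
Qed.

End directional_words.

(** * From D_lambda to derivative bounds *)

Section continuity.
Context {R : realType}.

Lemma linear_rV_bounded N D (L : {linear 'rV[R]_D -> 'rV[R]_N}) :
  exists2 K : R, 0 <= K & forall h, `|L h| <= K * `|h|.
Proof.
exists (\sum_l `|L (delta_mx 0 l)|); first exact: sumr_ge0.
move=> h; rewrite {1}[h]row_sum_delta linear_sum (le_trans (ler_norm_sum _ _ _))//.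
rewrite mulr_suml ler_sum// => l _; rewrite linearZ /= normrZ mulrC ler_wpM2l//.
exact: coord_le_norm.
Qed.

Lemma continuous_affine N D (f : 'rV[R]_N -> R) (L : {linear 'rV[R]_D -> 'rV[R]_N}) Z0 :
  continuous f -> continuous (fun V => f (Z0 + L V)).
Proof.
move=> cf V; apply: dist_continuous => e e0.
have [K K0 LK] := linear_rV_bounded L.
have [r r0 H] := continuous_dist (cf (Z0 + L V)) e0.
exists (r / (K + 1)); first by rewrite divr_gt0// ltr_wpDl.
move=> Y; rewrite ltr_pdivlMr ?ltr_wpDl// => Yr.
rewrite linearD addrA ltW// H// (le_lt_trans (LK Y))// (le_lt_trans _ Yr)//.
by rewrite mulrC ler_wpM2l// lerDl.
Qed.

Lemma continuous_mulR N (f g : 'rV[R]_N -> R) :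
  continuous f -> continuous g -> continuous (fun X => f X * g X).
Proof. by move=> cf cg X; exact: (@cvgM R _ (nbhs X) _ f g _ _ (cf X) (cg X)). Qed.

Lemma continuous_sqnorm N : continuous (@sqnorm R N).
Proof.
rewrite /sqnorm; elim: (index_enum _) => [|i r IH].
  by under eq_fun do rewrite big_nil; exact: cst_continuous.
under eq_fun do rewrite big_cons; move=> Z.
have ci := @coord_continuous R 1 N 0 i Z.
exact: (@cvgD _ _ _ (nbhs Z) _ _ _ _ _ (@cvgM R _ (nbhs Z) _ _ _ _ _ ci ci) (IH Z)).
Qed.

Lemma expn_le_fact (k : nat) : (k%:R : R) ^+ k <= expR 1 ^+ k * k`!%:R.
Proof.
case: k => [|k]; first by rewrite !expr0 mul1r fact0.
rewrite -expRM_natl mulr1 -ler_pdivrMr ?ltr0n ?fact_gt0//.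
by rewrite (le_trans _ (expR_ge1Dxn k (ler0n _ _)))// lerDr.
Qed.

End continuity.

Section bounds_on_diagonal.
Context {R : realType} {n : nat}.
Implicit Types (X Y V : 'rV[R]_(n + n)) (Z : 'rV[R]_(n + n + (n + n))) (l : 'I_(n + n)).
Local Notation D := (n + n + (n + n))%N.
Local Notation jetT := (seq 'I_D -> 'rV[R]_D -> R).

(** The direction in which A + i B moves by the l-th basis vector, and the one
    in which it moves by i times this vector: the extension is holomorphic in
    X and antiholomorphic in Y, so that i acts as (- J, J). *)
Definition real_dir l : 'rV[R]_D := row_mx (delta_mx 0 l) (delta_mx 0 l).
Definition imag_dir l : 'rV[R]_D := row_mx (- symJ (delta_mx 0 l)) (symJ (delta_mx 0 l)).

Lemma dirjet_pair (i k : 'I_D) (c c' : R) (U : jetT) w Z :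
  dirjet (c *: delta_mx 0 i + c' *: delta_mx 0 k) U w Z = c * U (i :: w) Z + c' * U (k :: w) Z.
Proof.
have one (m : 'I_D) (b : R) : \sum_i0 (b *: (delta_mx 0 m : 'rV[R]_D)) 0 i0 * U (i0 :: w) Z = b * U (m :: w) Z.
  rewrite (bigD1 m)//= big1 ?addr0; first by rewrite !mxE !eqxx mulr1.
  by move=> j jm; rewrite !mxE (negbTE jm) andbF mulr0 mul0r.
rewrite /dirjet -!one -big_split/=; apply: eq_bigr => j _.
by rewrite -mulrDl; congr (_ * _); rewrite [LHS]mxE.
Qed.

Lemma real_dirE l : real_dir l = 1 *: delta_mx 0 (lshift (n + n) l) + 1 *: delta_mx 0 (rshift (n + n) l).
Proof. by rewrite !scale1r delta_lshift delta_rshift add_row_mx addr0 add0r. Qed.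

Lemma imag_dir_l j : imag_dir (lshift n j) = 1 *: delta_mx 0 (ixi j) + (- 1) *: delta_mx 0 (ieta j).
Proof.
rewrite /imag_dir symJ_el opprK scale1r scaleN1r /ixi /ieta (delta_lshift (rshift n j)) (delta_rshift _ (rshift n j)).
by rewrite opp_row_mx add_row_mx oppr0 addr0 add0r.
Qed.

Lemma imag_dir_r j : imag_dir (rshift n j) = (- 1) *: delta_mx 0 (ix j) + 1 *: delta_mx 0 (iy j).
Proof.
rewrite /imag_dir symJ_er scale1r scaleN1r /ix /iy (delta_lshift (lshift n j)) (delta_rshift _ (lshift n j)).
by rewrite opp_row_mx add_row_mx oppr0 addr0 add0r.
Qed.

Lemma sum_row_mx N M (I : finType) (u : I -> 'rV[R]_N) (v : I -> 'rV[R]_M) :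
  \sum_i row_mx (u i) (v i) = row_mx (\sum_i u i) (\sum_i v i).
Proof.
elim: (index_enum _) => [|l r IH]; first by rewrite !big_nil row_mx0.
by rewrite !big_cons IH add_row_mx.
Qed.

Lemma rjetN N (f : 'rV[R]_N -> R) s : rsmooth f -> rjet (fun x => - f x) s = (fun x => - rjet f s x).
Proof.
move=> fs.
rewrite -[fun x => - f x]/((fun s (x : 'rV[R]_N) => - rjet f s x) [::]) line_jet_rjet//.
move=> t x h; have := is_deriveN (rsmooth_line_jet fs t x h); congr is_derive.
by rewrite -sumrN; apply: eq_bigr => l _; rewrite mulrN.
Qed.

Lemma rjet_cons_partial N (f : 'rV[R]_N -> R) s i : rsmooth f ->
  rjet f (i :: s) = rjet (rpartial i f) s.
Proof.
move=> fs; have e : perm_eq (i :: s) (rcons s i) by rewrite perm_sym perm_rcons.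
rewrite (rjet_perm fs e) /rjet foldr_rcons; exact: erefl.
Qed.

Section extension.
Variable G : 'rV[R]_D -> R[i].
Let p Z := complex.Re (G Z).
Let q Z := complex.Im (G Z).
Hypotheses (ps : rsmooth p) (qs : rsmooth q).
Hypothesis CR : forall (j : 'I_n) Z,
  cpartial (ix j) G Z + (0 +i* 1) * cpartial (ixi j) G Z = 0 /\
  cpartial (iy j) G Z - (0 +i* 1) * cpartial (ieta j) G Z = 0.

Lemma CR_jets j s Z :
  [/\ rjet q (ixi j :: s) Z = rjet p (ix j :: s) Z,
      rjet p (ixi j :: s) Z = - rjet q (ix j :: s) Z,
      rjet q (ieta j :: s) Z = - rjet p (iy j :: s) Z &
      rjet p (ieta j :: s) Z = rjet q (iy j :: s) Z].
Proof.
have H Z' : [/\ rpartial (ixi j) q Z' = rpartial (ix j) p Z',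
    rpartial (ixi j) p Z' = - rpartial (ix j) q Z',
    rpartial (ieta j) q Z' = - rpartial (iy j) p Z' &
    rpartial (ieta j) p Z' = rpartial (iy j) q Z'].
  have [/eqP] := CR j Z'; rewrite eq_complex/= => /andP[+ +].
  rewrite -/p -/q -!/(rpartial _ _ Z') => /eqP e1 /eqP e2.
  move=> /eqP; rewrite eq_complex/= => /andP[+ +].
  rewrite -/p -/q -!/(rpartial _ _ Z') => /eqP e3 /eqP e4.
  move: e1 e2 e3 e4; move: (rpartial (ix j) p Z') (rpartial (ixi j) p Z')
    (rpartial (iy j) p Z') (rpartial (ieta j) p Z') (rpartial (ix j) q Z')
    (rpartial (ixi j) q Z') (rpartial (iy j) q Z') (rpartial (ieta j) q Z').
  by move=> a b c e a' b' c' e' e1 e2 e3 e4; split; lra.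
have sp i : rsmooth (rpartial i p).
  by move=> t; have := ps (rcons t i); rewrite /rjet foldr_rcons.
have sq i : rsmooth (rpartial i q).
  by move=> t; have := qs (rcons t i); rewrite /rjet foldr_rcons.
rewrite !rjet_cons_partial//; split.
- by congr (rjet _ s Z); apply/funext => Z'; case: (H Z').
- by rewrite -[RHS]/((fun Z => - rjet (rpartial (ix j) q) s Z) Z) -rjetN//;
    congr (rjet _ s Z); apply/funext => Z'; case: (H Z').
- by rewrite -[RHS]/((fun Z => - rjet (rpartial (iy j) p) s Z) Z) -rjetN//;
    congr (rjet _ s Z); apply/funext => Z'; case: (H Z').
- by congr (rjet _ s Z); apply/funext => Z'; case: (H Z').
Qed.

Lemma CR_dirjet l w Z :
  dirjet (imag_dir l) (rjet p) w Z = - dirjet (real_dir l) (rjet q) w Z /\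
  dirjet (imag_dir l) (rjet q) w Z = dirjet (real_dir l) (rjet p) w Z.
Proof.
rewrite real_dirE !dirjet_pair; case: (split_ordP l) => j ->.
  rewrite imag_dir_l !dirjet_pair; have [-> -> -> ->] := CR_jets j w Z.
  by rewrite /ix /iy; split; ring.
rewrite imag_dir_r !dirjet_pair; have := CR_jets j w Z; rewrite /ixi /ieta => -[-> -> -> ->].
by rewrite /ix /iy; split; ring.
Qed.

Lemma dirjetN N (a : 'rV[R]_N) U w x : dirjet a (fun w x => - U w x) w x = - dirjet a U w x.
Proof. by rewrite /dirjet -sumrN; apply: eq_bigr => i _; rewrite mulrN. Qed.

(** By the Cauchy-Riemann equations, differentiating twice in the direction
    imag_dir l is minus differentiating twice in the direction real_dir l. *)
Lemma harmonic_ReIm : harmonic_jet real_dir imag_dir (rjet p) /\ harmonic_jet real_dir imag_dir (rjet q).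
Proof.
have Sp := rjet_sym ps; have Sq := rjet_sym qs.
have Ep l : dirjet (imag_dir l) (rjet p) = (fun w Z => - dirjet (real_dir l) (rjet q) w Z).
  by apply/funext => w; apply/funext => Z; case: (CR_dirjet l w Z).
have Eq l : dirjet (imag_dir l) (rjet q) = dirjet (real_dir l) (rjet p).
  by apply/funext => w; apply/funext => Z; case: (CR_dirjet l w Z).
split=> l w Z.
  by rewrite Ep dirjetN dirjetC// Eq subrr.
by rewrite Eq dirjetC// Ep dirjetN subrr.
Qed.

End extension.

Section diagonal.
Variable f : 'rV[R]_D -> R.
Hypothesis fs : rsmooth f.

Definition diagjet s X : R := worddir real_dir s (rjet f) [::] (row_mx X X).

Lemma cont_rjet : cont_jet (rjet f).
Proof. by move=> w; case: (fs w). Qed.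

(** A displacement h on the diagonal is (h, h), the combination of the
    directions real_dir l with the coordinates of h as coefficients. *)
Lemma diagjet_line : line_jet diagjet.
Proof.
move=> s X h; apply: is_derive_line0.
have [J _] := worddir_sym real_dir s (rjet_sym fs).
have J0 := J [::] (row_mx X X + 0 *: row_mx h h) (row_mx h h).
have := is_derive_line J0; congr is_derive.
  apply/funext => t; rewrite /diagjet scale_row_mx add_row_mx//.
rewrite scale0r addr0 /diagjet /= /dirjet.
under [RHS]eq_bigr do rewrite mulr_sumr.
rewrite exchange_big/=; apply: eq_bigr => i _.
under eq_bigr do rewrite mulrA.
rewrite -mulr_suml; congr (_ * _).
have -> : row_mx h h = \sum_l h 0 l *: real_dir l.
  under eq_bigr do rewrite scale_row_mx.
  by rewrite sum_row_mx -row_sum_delta.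
by rewrite summxE; apply: eq_bigr => l _; rewrite mxE.
Qed.

Lemma diagjet_cont s : continuous (diagjet s).
Proof.
have cw : continuous (worddir real_dir s (rjet f) [::]).
  by apply: worddir_cont; exact: cont_rjet.
have -> : diagjet s = (fun V => worddir real_dir s (rjet f) [::]
    (0 + mulmxr (row_mx 1%:M 1%:M : 'M[R]_(n + n, D)) V)).
  by apply/funext => X; rewrite /= add0r mul_mx_row mulmx1.
exact: (@continuous_affine R _ _ _ (mulmxr (row_mx 1%:M 1%:M)) 0 cw).
Qed.

Lemma diag_smooth : rsmooth (fun X => f (row_mx X X)).
Proof. exact: line_jet_smooth diagjet_line diagjet_cont. Qed.

Lemma diag_rjet s X : rjet (fun X => f (row_mx X X)) s X = worddir real_dir s (rjet f) [::] (row_mx X X).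
Proof. by have := line_jet_rjet diagjet_line => /(congr1 (fun U => U s X)). Qed.

(** The steps sqrt(lam / a_l) balance the two factors: after a_l steps the l-th
    imaginary part is at most sqrt(lam a_l), so that the growth factor
    exp(|B|^2 / lam) stays below e^|a|, while the steps themselves cost
    (4 a_l / lam)^(a_l / 2), controlled by k^k <= e^k k!. *)
Lemma diag_derivative_bound (lam M : R) (a : {ffun 'I_(n + n) -> nat}) X :
  0 < lam -> 0 <= M -> harmonic_jet real_dir imag_dir (rjet f) ->
  (forall X Y, `|f (row_mx X Y)| <= M * expR (sqnorm (X - Y) / (4 * lam))) ->
  `|rjet (fun X => f (row_mx X X)) (mword a) X| <=
    Num.sqrt (mfact a)%:R * (4 * expR 1 ^+ 3 / lam) `^ ((mlen a)%:R / 2) * M.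
Proof.
move=> lam0 M0 hf fM; rewrite diag_rjet.
(* The value 1 is a placeholder for the directions that do not occur. *)
pose rho l : R := if a l == 0%N then 1 else Num.sqrt (lam / (a l)%:R).
have al0 l : a l != 0%N -> 0 < (a l)%:R :> R by rewrite ltr0n lt0n.
have rho0 l : 0 < rho l.
  by rewrite /rho; case: eqP => // /eqP/al0 ?; rewrite sqrtr_gt0 divr_gt0.
have cnt l : count_mem l (mword a) = a l by have /ffunP/(_ l) := wtype_mword a; rewrite ffunE.
have bound (b c : 'I_(n + n) -> R) :
    (forall l, `|b l| <= (count_mem l (mword a))%:R * rho l) ->
    (forall l, `|c l| <= (count_mem l (mword a))%:R * rho l) ->
    `|f (row_mx X X + \sum_l (b l *: real_dir l + c l *: imag_dir l))| <= M * expR (mlen a)%:R.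
  move=> _ cr.
  under eq_bigr do rewrite !scale_row_mx add_row_mx.
  rewrite sum_row_mx add_row_mx (le_trans (fM _ _))// ler_wpM2l// ler_expR.
  rewrite opprD addrACA subrr add0r -sumrB.
  rewrite [X in sqnorm X](_ : _ = symJ (\row_l (- 2 * c l))); last first.
    rewrite [\row_l _]row_sum_delta linear_sum; apply: eq_bigr => l _.
    rewrite linearZ mxE; apply/rowP => i; rewrite !mxE.
    by case: (fintype.split i) => k; rewrite !mxE; ring.
  rewrite sqnorm_symJ ler_pdivrMr ?mulr_gt0// /mlen natr_sum mulr_suml /sqnorm ler_sum// => l _.
  have := cr l; rewrite cnt mxE exprMn sqrrN => cl.
  rewrite -(real_normK (num_real (c l))) (@le_trans _ _ (2 ^+ 2 * ((a l)%:R * rho l) ^+ 2))//.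
    by rewrite ler_wpM2l ?exprn_ge0// lerXn2r ?nnegrE// mulr_ge0// ltW.
  rewrite le_eqVlt; apply/orP; left; apply/eqP; rewrite /rho; case: eqP => [->|/eqP/al0 a0].
    by rewrite !mul0r expr0n/= mulr0.
  by rewrite exprMn sqr_sqrtr ?divr_ge0 ?(ltW lam0)//; field; rewrite gt_eqF.
have := worddir_bound rho0 (rjet_sym fs) cont_rjet hf bound.
move=> /le_trans; apply; rewrite mulrCA [leRHS]mulrC ler_wpM2l//.
have -> : \prod_(l <- mword a) (2 / rho l) = \prod_l (2 / rho l) ^+ a l.
  have := wprod_monomial (\row_l (2 / rho l)) (mword a); rewrite wtype_mword /wprod /monomial.
  by under eq_bigr do rewrite mxE; under [X in _ = X -> _]eq_bigr do rewrite mxE.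
pose c : R := 2 * Num.sqrt (expR 1 / lam).
have c0 : 0 <= c by rewrite mulr_ge0.
apply: (@le_trans _ _ (\prod_l (c ^+ a l * Num.sqrt (a l)`!%:R) * expR (mlen a)%:R)).
  rewrite ler_wpM2r ?expR_ge0//; apply: ler_prod => l _.
  rewrite exprn_ge0 ?divr_ge0 ?(ltW (rho0 l))//= /rho.
  case: eqP => [->|/eqP /[dup] al /al0 a0]; first by rewrite !expr0 fact0 sqrtr1 mulr1.
  have -> : 2 / Num.sqrt (lam / (a l)%:R) = 2 * Num.sqrt ((a l)%:R / lam) :> R.
    by rewrite -sqrtrV ?divr_ge0 ?(ltW lam0)// invf_div.
  rewrite !exprMn -mulrA ler_wpM2l ?exprn_ge0//.
  have s0 (x : R) k : 0 <= x -> Num.sqrt x ^+ k = Num.sqrt (x ^+ k).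
    move=> x0; elim: k => [|k IH]; first by rewrite !expr0 sqrtr1.
    by rewrite !exprS sqrtrM// IH.
  rewrite !s0 ?divr_ge0 ?expR_ge0 ?(ltW lam0)// -sqrtrM ?exprn_ge0 ?divr_ge0 ?expR_ge0 ?(ltW lam0)//.
  rewrite ler_wsqrtr// !exprMn mulrAC ler_wpM2r ?exprn_ge0 ?invr_ge0 ?(ltW lam0)//.
  exact: expn_le_fact.
rewrite big_split/= prodrXr -/(mlen a) mulrAC mulrC [leRHS]mulrC.
have -> : \prod_i Num.sqrt (a i)`!%:R = Num.sqrt (mfact a)%:R :> R.
  rewrite /mfact natr_prod; elim: (index_enum _) => [|l r IH]; first by rewrite !big_nil sqrtr1.
  by rewrite !big_cons sqrtrM ?IH.
rewrite -[X in _ <= X]mulrC; set m := Num.sqrt (mfact a)%:R.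
have -> : (4 * expR 1 ^+ 3 / lam) `^ ((mlen a)%:R / 2) = (c * expR 1) ^+ mlen a.
  have x0 : 0 <= 4 * expR 1 ^+ 3 / lam by rewrite divr_ge0 ?(ltW lam0)// mulr_ge0// exprn_ge0// expR_ge0.
  rewrite [(mlen a)%:R / 2]mulrC powRrM powR12_sqrt// powR_mulrn ?sqrtr_ge0//; congr (_ ^+ _).
  rewrite -[RHS]ger0_norm ?mulr_ge0 ?expR_ge0// -sqrtr_sqr; congr Num.sqrt.
  rewrite /c !exprMn sqr_sqrtr ?divr_ge0 ?expR_ge0 ?(ltW lam0)//.
  by field; rewrite gt_eqF.
have -> : expR (mlen a)%:R = expR 1 ^+ mlen a :> R by rewrite -expRM_natl mulr1.
by rewrite [(c * expR 1) ^+ _]exprMn.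
Qed.

End diagonal.

(** The least admissible function is a supremum of continuous functions, so
    that its essential bounds are bounds for the extension at every point. *)
Lemma psi_min_bound (F : 'rV[R]_(n + n) -> R[i]) (lam M : R) (f : 'rV[R]_D -> R) :
  (normL +oo (psi_min lam F) <= M%:E)%E -> continuous f ->
  (forall Z, `|f Z| <= Normc.normc (Fext lam F Z)) ->
  forall X Y, `|f (row_mx X Y)| <= M * expR (sqnorm (X - Y) / (4 * lam)).
Proof.
move=> FM cf fF X Y.
pose g V := f (row_mx (Y + V) Y) * expR (- (sqnorm V / (4 * lam))).
have cg : continuous g.
  apply: continuous_mulR.
    have -> : (fun V => f (row_mx (Y + V) Y)) =
        (fun V => f (row_mx Y Y + mulmxr (row_mx 1%:M 0 : 'M[R]_(n + n, D)) V)).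
      by apply/funext => V; rewrite /= mul_mx_row mulmx1 mulmx0 add_row_mx addr0.
    exact: (@continuous_affine R _ _ _ (mulmxr (row_mx 1%:M 0)) (row_mx Y Y) cf).
  have cs : continuous (fun V => - (4 * lam)^-1 * sqnorm V).
    apply: continuous_mulR; [exact: cst_continuous|exact: continuous_sqnorm].
  have -> : (fun V => expR (- (sqnorm V / (4 * lam)))) =
      (fun V => expR (- (4 * lam)^-1 * sqnorm V)).
    by apply/funext => V; rewrite mulNr mulrC.
  move=> V; exact: (continuous_comp (cs V) (@continuous_expR R _)).
have /(_ (X - Y)) : forall V, `|g V| <= M.
  apply: dense_bound cg _ => V r r0; have [V' VV' H] := normL_oo_dense FM V r0.
  exists V' => //; rewrite -lee_fin; apply: le_trans H; apply: le_trans (lee_abs _).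
  apply: (@le_trans _ _ (Normc.normc (Fext lam F (row_mx (Y + V') Y)) *
      expR (- (sqnorm V' / (4 * lam))))%:E).
    by rewrite lee_fin /g normrM (ger0_norm (expR_ge0 _)) ler_wpM2r ?expR_ge0.
  by apply: ereal_sup_ubound; exists (Y + V'), Y; rewrite addrAC subrr add0r.
rewrite /g subrKC normrM (ger0_norm (expR_ge0 _)) expRN => gM.
by rewrite -ler_pdivrMr ?expR_gt0.
Qed.

Lemma in_D_smooth_bounds (lam : R) : 0 < lam ->
  exists K C : R, 0 < K /\ 0 < C /\
    forall F : 'rV[R]_(n + n) -> R[i], in_D lam F ->
      csmooth F /\
      forall alpha : {ffun 'I_(n + n) -> nat},
        (cnormLoo (mpartial alpha F) <=
         (K * Num.sqrt (mfact alpha)%:R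
            * (C / lam) `^ ((mlen alpha)%:R / 2))%:E * normD lam F)%E.
Proof.
(* The factor 2 adds up the real and the imaginary part. *)
move=> lam0; exists 2, (4 * expR 1 ^+ 3); split => //; split.
  by rewrite mulr_gt0// exprn_gt0// expR_gt0.
move=> F FD; have [Gan CR GF _] : is_Fext lam F (Fext lam F) by exact: xgetPex FD.
set G := Fext lam F in Gan CR GF.
have [/real_analytic_smooth ps /real_analytic_smooth qs] := Gan.
have [hp hq] := harmonic_ReIm ps qs CR.
have ReF : (fun X => complex.Re (F X)) = (fun X => complex.Re (G (row_mx X X))).
  by apply/funext => X; rewrite GF.
have ImF : (fun X => complex.Im (F X)) = (fun X => complex.Im (G (row_mx X X))).
  by apply/funext => X; rewrite GF.
split.
  by apply/csmoothP; rewrite ReF ImF; split; [exact: diag_smooth ps|exact: diag_smooth qs].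
move=> a; set B := _ * _ * _.
have B0 : 0 < B.
  rewrite /B !mulr_gt0// ?sqrtr_gt0 ?ltr0n.
    by rewrite /mfact prodn_gt0// => i; exact: fact_gt0.
  by rewrite powR_gt0// divr_gt0// mulr_gt0// exprn_gt0// expR_gt0.
have psi0 := normL_oo_ge0 (psi_min lam F).
apply: (@le_trans _ _ (B%:E * normL +oo (psi_min lam F))%E); last first.
  by apply: lee_wpmul2l; rewrite ?lee_fin ?(ltW B0)// /normD leeDr// Lnorm_ge0.
case E : (normL +oo (psi_min lam F)) psi0 => [M| |//] M0; last by rewrite gt0_muley ?lte_fin// leey.
have {E}FM : (normL +oo (psi_min lam F) <= M%:E)%E by rewrite E.
rewrite lee_fin in M0.
have cp : continuous (fun Z => complex.Re (G Z)) by have [] := ps [::].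
have cq : continuous (fun Z => complex.Im (G Z)) by have [] := qs [::].
have pM := psi_min_bound FM cp (fun Z => normc_Re (G Z)).
have qM := psi_min_bound FM cq (fun Z => normc_Im (G Z)).
rewrite -EFinM; apply: normL_oo_le => X; rewrite lee_fin ger0_norm; last exact: le_trans (normc_Re _).
rewrite mpartial_mword (le_trans (normc_le _))//.
have [Er Ei] := ReIm_foldr F (mword a).
move/(congr1 (fun h => h X)) : Er => ->; move/(congr1 (fun h => h X)) : Ei => ->.
rewrite ReF ImF.
have := diag_derivative_bound ps a X lam0 M0 hp pM.
have := diag_derivative_bound qs a X lam0 M0 hq qM.
move=> H1 H2; apply: le_trans (lerD H2 H1) _.
by rewrite /B le_eqVlt; apply/orP; left; apply/eqP; ring.
Qed.

End bounds_on_diagonal.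

Theorem theorem2p5 (R : realType) (n : nat) :
  (forall (F : 'rV[R]_(n + n) -> R[i]) (K C lam : R),
     csmooth F -> 0 < K -> 0 < C ->
     (forall alpha beta : {ffun 'I_n -> nat},
        (cnormLoo (mpartial (mcat alpha beta) F) <=
         (K * C ^+ mlen [ffun j => (alpha j + beta j)%N]
            * Num.sqrt ((mfact alpha)%:R * (mfact beta)%:R))%:E)%E) ->
     0 < lam -> lam < 1 / (2 * C ^+ 2) ->
     in_D lam F)
  /\
  (forall lam : R, 0 < lam ->
     exists K C : R, 0 < K /\ 0 < C /\
       forall F : 'rV[R]_(n + n) -> R[i], in_D lam F ->
         csmooth F /\
         forall alpha : {ffun 'I_(n + n) -> nat},
           (cnormLoo (mpartial alpha F) <=
            (K * Num.sqrt (mfact alpha)%:R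
               * (C / lam) `^ ((mlen alpha)%:R / 2))%:E * normD lam F)%E).
Proof.
split; first exact: derivative_bounds_in_D.
by move=> lam lam0; exact: in_D_smooth_bounds.
Qed.
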